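(* Let $h:[-1,1]\to[0,+\infty]$ be absolutely monotone on $[-1,1]$ (continuous, finite on $[-1,1)$, with $h^{(j)}\ge0$ on $[-1,1)$ for all $j\ge 0$). For each code $C\subset\mathbb{S}^{n-1}$ below there exists $\widetilde{x}\in\mathbb{S}^{n-1}$ such that the inner products $\widetilde{x}\cdot y$, $y\in C$, take exactly the listed values with the listed multiplicities, and $\inf_{x\in\mathbb{S}^{n-1}}\sum_{y\in C}h(x\cdot y)=\sum_{y\in C}h(\widetilde{x}\cdot y)$, i.e. equals the corresponding sum: (a) $C$ = the 12 vertices of a regular icosahedron inscribed in $\mathbb{S}^2$: the values $\pm\sqrt{(1+2/\sqrt5)/3}$, $\pm\sqrt{(1-2/\sqrt5)/3}$, each with multiplicity $3$; (b) $C$ = the 20 vertices of a regular dodecahedron inscribed in $\mathbb{S}^2$: the same four values, each with multiplicity $5$; (c) $C\subset\mathbb{S}^7$ the 240 points consisting of all $(\pm1/\sqrt8,\dots,\pm1/\sqrt8)$ with an even number of minus signs and all vectors with exactly two nonzero coordinates, each equal to $\pm1/\sqrt2$: the values $-\sqrt2/2,-\sqrt2/4,0,\sqrt2/4,\sqrt2/2$ with multiplicities $14,64,84,64,14$; (d) $C\subset\mathbb{S}^{23}$ the 196560 minimal vectors of the Leech lattice scaled to unit length: the values $-\sqrt6/4,-\sqrt6/6,-\sqrt6/12,0,\sqrt6/12,\sqrt6/6,\sqrt6/4$ with multiplicities $552,11178,48600,75900,48600,11178,552$. *)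

(* Defs.v *)
From HB Require Import structures.
From mathcomp Require Import all_boot all_order all_algebra.
From mathcomp Require Import all_classical all_reals all_analysis.
Set Implicit Arguments. Unset Strict Implicit. Unset Printing Implicit Defensive.
Import Order.TTheory GRing.Theory Num.Theory.
Import numFieldNormedType.Exports.
Local Open Scope classical_set_scope.
Local Open Scope ring_scope.

Section Defs.
Variable R : realType.

Definition dot (n : nat) (u v : 'rV[R]_n) : R := \sum_(i < n) u 0 i * v 0 i.

Definition sphere (n : nat) : set 'rV[R]_n := [set x | dot x x = 1].

Definition absolutely_monotone (h : R -> \bar R) : Prop :=
  [/\ {within `[-1, 1], continuous h},
      (forall t, t \in `[-1, 1] -> (0 <= h t)%E),
      (forall t, t \in `[-1, 1[ -> h t \is a fin_num) &
      (forall (j : nat) t, t \in `]-1, 1[ ->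
         derivable (derive1n j (fun s => fine (h s))) t 1
         /\ 0 <= derive1n j (fun s => fine (h s)) t)].

Definition hsum (n : nat) (h : R -> \bar R) (C : seq 'rV[R]_n) (x : 'rV[R]_n)
  : \bar R := (\sum_(y <- C) h (dot x y))%E.

Definition min_attained_with (n : nat) (h : R -> \bar R) (C : seq 'rV[R]_n)
    (vals : seq (R * nat)) : Prop :=
  exists xt : 'rV[R]_n,
    [/\ @sphere n xt,
        (forall y, y \in C -> dot xt y \in map fst vals),
        (forall vm, vm \in vals -> count (fun y => dot xt y == vm.1) C = vm.2) &
        ereal_inf [set hsum h C x | x in @sphere n] = hsum h C xt].

Definition orthogonal3 (Q : 'M[R]_3) : Prop := Q *m Q^T = 1%:M.

Definition vec3 (a b c : R) : 'rV[R]_3 :=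
  \row_(i < 3) (if i == 0 :> nat then a else if i == 1 :> nat then b else c).

Definition phi : R := (1 + Num.sqrt 5) / 2.

Definition icosa_std : seq 'rV[R]_3 :=
  let c := (Num.sqrt (1 + phi ^+ 2))^-1 in
  flatten [seq [:: c *: vec3 0 s (t * phi); c *: vec3 s (t * phi) 0;
                   c *: vec3 (t * phi) 0 s]
          | s <- [:: 1; -1], t <- [:: 1; -1]].

Definition dodeca_std : seq 'rV[R]_3 :=
  let c := (Num.sqrt 3)^-1 in
  flatten [seq [seq c *: vec3 a b d | d <- [:: 1; -1]] | a <- [:: 1; -1], b <- [:: 1; -1]] ++
  flatten [seq [:: c *: vec3 0 (s / phi) (t * phi); c *: vec3 (s / phi) (t * phi) 0;
                   c *: vec3 (t * phi) 0 (s / phi)]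
          | s <- [:: 1; -1], t <- [:: 1; -1]].

(** C is the vertex set of a regular polytope congruent (by an orthogonal map)
    to the standard one; every regular icosahedron/dodecahedron inscribed in S^2
    is of this form. *)
Definition is_rotated (std : seq 'rV[R]_3) (C : seq 'rV[R]_3) : Prop :=
  exists Q : 'M[R]_3, orthogonal3 Q /\ (forall y, y \in C <-> exists2 v, v \in std & y = v *m Q).

Definition E8_code_pt (y : 'rV[R]_8) : Prop :=
  (exists s : 'I_8 -> bool,
     ~~ odd #|[set i | s i]| /\
     y = \row_i ((if s i then -1 else 1) / Num.sqrt 8))
  \/ (exists (i j : 'I_8) (a b : bool), i != j /\
     y = \row_k (if k == i then (if a then -1 else 1) / Num.sqrt 2
                 else if k == j then (if b then -1 else 1) / Num.sqrt 2 else 0)).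

End Defs.

(** Extended binary Golay code: extension by a parity bit of the cyclic
    [23,12,7] code generated by g(x) = 1 + x^2 + x^4 + x^5 + x^6 + x^10 + x^11. *)
Definition golay_gcoef (k : nat) : bool :=
  nth false [:: true; false; true; false; true; true; true; false; false; false; true; true] k.

Definition golay_gen : 'M['F_2]_(12, 24) :=
  \matrix_(k < 12, i < 24)
    (if (i < 23)%N then (if (k <= i)%N && (i - k <= 11)%N then (golay_gcoef (i - k))%:R else 0)
     else 1).

Definition golay_word (c : 'rV['F_2]_24) : Prop := exists a : 'rV['F_2]_12, c = a *m golay_gen.

Definition golay_set (S : {set 'I_24}) : Prop :=
  golay_word (\row_i (if i \in S then 1 else 0)).

Local Open Scope ring_scope.
(** Leech lattice (scaled by sqrt 8), Conway's construction (SPLAG ch.4, 11):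
    x in Z^24 with all x_i = m (mod 2), for every nu the set {i | x_i = nu (mod 4)}
    is a Golay codeword, and sum x_i = 4m (mod 8). *)
Definition leech (x : 'rV[int]_24) : Prop :=
  exists m : int, (m == 0 \/ m == 1) /\
    (forall i, (x ord0 i = m %[mod 2])%Z) /\
    (forall nu : int, golay_set [set i | (x ord0 i == nu %[mod 4])%Z]) /\
    ((\sum_i x ord0 i) = 4 * m %[mod 8])%Z.

Definition sqnorm24 (x : 'rV[int]_24) : int := \sum_i x 0 i ^+ 2.

Definition leech_minimal (x : 'rV[int]_24) : Prop :=
  leech x /\ x != 0 /\ forall z, leech z -> z != 0 -> sqnorm24 x <= sqnorm24 z.

Definition leech_code_pt (R : realType) (y : 'rV[R]_24) : Prop :=
  exists2 x, leech_minimal x &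
    y = (Num.sqrt ((sqnorm24 x)%:~R))^-1 *: map_mx (fun z : int => z%:~R) x.

(* Main.v *)
(** Write P_C for the potential of the code C and w for the claimed minimizer.  A Taylor
    expansion at 0 (Bernstein's theorem) reduces an absolutely monotone h to polynomials
    F(t^2) with nonnegative coefficients, since the codes are antipodal.  Let s_1, ..., s_d be
    the values (w . y)^2, each taken as many times as makes p(s) = prod (s - s_i) nonnegative
    on [0, 1].  In Newton's form F = p Q + (interpolant), all divided differences are
    nonnegative, and the interpolant has degree d - 1 in s.  The codes are designs in the
    degrees up to 2(d - 2), and the harmonics of degree 2d (but not those of degree 2(d - 1))
    also vanish on them.  So only the leading coefficient c >= 0 of the interpolant matters,
    together with the moment M of degree 2(d - 1); and M is minimal at w because p, which
    vanishes at w, averages to a positive multiple of M plus a constant.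

    The design properties of the E8 and Leech codes follow from their distance distributions,
    by positivity of the Fischer inner product on harmonic polynomials.  For the Leech lattice
    the distribution is forced by the moments of degree 2 and 4, which are computed from the
    number of Golay octads through one or two points. *)

(* The positive multiple of M is a - (s_1 + ... + s_d), where -a is the second coefficient of the
   monic Gegenbauer polynomial of degree 2d: as the harmonics of degree 2d vanish on the code, its
   moment of degree 2d is a M plus a constant. So each code comes with one numerical condition, s_1
   + ... + s_d < a.

   As h may be infinite at 1, the Taylor series is never summed at an arbitrary point x; there its
   partial sums are only lower bounds. At w the inner products stay inside an interval [-q, q] with
   q < 1, so the remainder decays geometrically.

   No integral over the sphere occurs. For a fixed degree, let f be the sum over the code of the
   zonal harmonics with poles in the code. The Fischer norm of f is, up to a factorial, the sum of f
   over the code, so the inner products within the code decide whether f is zero.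

   For the Leech lattice only the 4096 Golay words are enumerated. Sign changes on codewords
   annihilate most entries of the fourth moment tensor, and the others reduce to counts of octads,
   sign patterns and pairs of coordinates. For the two polyhedra the moments are polynomial
   identities modulo the equation of the golden ratio. *)
From Stdlib Require Import NArith.
From HB Require Import structures.
From mathcomp Require Import all_boot all_order all_algebra.
From mathcomp Require mpoly.
From mathcomp Require Import ring lra zify.
Set Implicit Arguments. Unset Strict Implicit. Unset Printing Implicit Defensive.
Import Order.TTheory GRing.Theory Num.Theory.

(** * The Fischer inner product and zonal harmonics *)

Module Fischer.
Import mpoly.
Local Open Scope ring_scope.

Section Fischer.
Variables (R : realDomainType) (n : nat).
Implicit Types (p q : {mpoly R[n]}) (u v : 'I_n -> R).

Definition mfact (m : 'X_{1..n}) : nat := (\prod_i (m i)`!)%N.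

(* The degree-k part of the Fischer inner product p(d/dx) q. *)
Definition fischer k p q : R :=
  \sum_(m : 'X_{1..n < k.+1} | mdeg m == k) p@_m * q@_m * (mfact m)%:R.

Lemma fischerC k p q : fischer k p q = fischer k q p.
Proof. by apply: eq_bigr => m _; rewrite [p@_m * _]mulrC. Qed.

Lemma fischer_suml k (I : Type) (r : seq I) (P : pred I) (F : I -> {mpoly R[n]}) q :
  fischer k (\sum_(i <- r | P i) F i) q = \sum_(i <- r | P i) fischer k (F i) q.
Proof.
rewrite /fischer exchange_big /=; apply: eq_bigr => m _.
by rewrite raddf_sum /= !mulr_suml.
Qed.

Lemma fischer_sumr k (I : Type) (r : seq I) (P : pred I) (F : I -> {mpoly R[n]}) q :
  fischer k q (\sum_(i <- r | P i) F i) = \sum_(i <- r | P i) fischer k q (F i).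
Proof. by rewrite fischerC fischer_suml; apply: eq_bigr => i _; rewrite fischerC. Qed.

Lemma fischerZl k c p q : fischer k (c *: p) q = c * fischer k p q.
Proof.
by rewrite /fischer mulr_sumr; apply: eq_bigr => m _; rewrite mcoeffZ !mulrA.
Qed.

Lemma fischerZr k c p q : fischer k p (c *: q) = c * fischer k p q.
Proof. by rewrite fischerC fischerZl fischerC. Qed.

Lemma fischerDr k p q1 q2 : fischer k p (q1 + q2) = fischer k p q1 + fischer k p q2.
Proof.
by rewrite /fischer -big_split; apply: eq_bigr => m _; rewrite mcoeffD mulrDr mulrDl.
Qed.

Lemma fischer0r k p : fischer k p 0 = 0.
Proof. by rewrite /fischer big1 // => m _; rewrite mcoeff0 mulr0 mul0r. Qed.

Lemma fischerXl k (m : 'X_{1..n}) q :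
  fischer k 'X_[m] q = if mdeg m == k then q@_m * (mfact m)%:R else 0.
Proof.
rewrite /fischer; case: eqP => [mk|mk]; last first.
  rewrite big1 // => m' /eqP m'k; rewrite mcoeffX.
  by case: eqP => [mm|]; [rewrite mm in mk | rewrite !mul0r].
have lt : (mdeg m < k.+1)%N by rewrite mk.
rewrite (bigD1 (BMultinom lt)) /=; last by rewrite mk.
rewrite mcoeffX eqxx mul1r big1 ?addr0 // => m' /andP[_ m'm].
rewrite mcoeffX; case: eqP => [mm|]; last by rewrite !mul0r.
by case/eqP: m'm; apply: val_inj.
Qed.

(** Multiplication by a variable is adjoint to differentiation because the weight [mfact] grows by
    exactly the factor that [mderiv] produces. *)
Lemma fischer_mulX k i p q :
  fischer k.+1 ('X_i * p) q = fischer k p (mderiv i q).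
Proof.
rewrite [p in LHS]mpolyE [p in RHS]mpolyE mulr_sumr !fischer_suml.
apply: eq_bigr => m _; rewrite -scalerAr !fischerZl; congr (_ * _).
rewrite -mpolyXD !fischerXl mdegD mdeg1 add1n eqSS; case: eqP => // _.
rewrite mcoeff_deriv addmC -[X in _ = X * _]mulr_natr -mulrA -natrM; congr (_ * _%:R).
rewrite /mfact (bigD1 i) //= mnmDE mnm1E eqxx addn1 factS [in RHS](bigD1 i) //= mulnA.
congr muln; apply: eq_bigr => j ji; rewrite mnmDE mnm1E eq_sym (negPf ji).
by rewrite addn0.
Qed.

(** Over an ordered domain [fischer k p p] is a sum of squares with positive weights, so the
    degree-k coefficients of [p] all vanish. *)
Lemma fischer_eq0 k p : fischer k p p = 0 -> forall q, fischer k q p = 0.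
Proof.
rewrite /fischer => pp0 q.
have ge0 (m : 'X_{1..n < k.+1}) : 0 <= p@_m * p@_m * (mfact m)%:R.
  by rewrite mulr_ge0 ?ler0n // -expr2 sqr_ge0.
apply: big1 => m mk; move/eqP: pp0; rewrite psumr_eq0 // => /allP /(_ m).
rewrite mem_index_enum mk /= => /(_ isT); rewrite mulf_eq0 => /orP[|].
  by rewrite mulf_eq0 orbb => /eqP ->; rewrite mulr0 mul0r.
by rewrite pnatr_eq0 gtn_eqF // prodn_gt0 // => i; exact: fact_gt0.
Qed.

Definition lin u : {mpoly R[n]} := \sum_i u i *: 'X_i.
Definition nrm : {mpoly R[n]} := \sum_i 'X_i ^+ 2.
Definition dotp u v : R := \sum_i u i * v i.
Definition laplace p : {mpoly R[n]} := \sum_i mderiv i (mderiv i p).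
Definition dirder u p : {mpoly R[n]} := \sum_i u i *: mderiv i p.

Lemma fischer_lin k u p q : fischer k.+1 (lin u * p) q = fischer k p (dirder u q).
Proof.
rewrite /lin /dirder mulr_suml fischer_suml fischer_sumr; apply: eq_bigr => i _.
by rewrite -scalerAl fischerZl fischerZr fischer_mulX.
Qed.

Lemma fischer_nrm k p q : fischer k.+2 (nrm * p) q = fischer k p (laplace q).
Proof.
rewrite /nrm /laplace mulr_suml fischer_suml fischer_sumr; apply: eq_bigr => i _.
by rewrite expr2 -mulrA !fischer_mulX.
Qed.

Lemma mderivXU i j : mderiv i 'X_j = (i == j)%:R :> {mpoly R[n]}.
Proof.
rewrite mderivX mnm1E eq_sym; case: eqP => [->|_]; last by rewrite scale0r.
rewrite scale1r; have -> : (U_(j) - U_(j))%MM = 0%MM :> 'X_{1..n}.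
  by apply/mnmP => k; rewrite mnmBE mnm0E subnn.
by rewrite mpolyX0.
Qed.

Lemma mderiv_lin i u : mderiv i (lin u) = (u i)%:MP.
Proof.
rewrite /lin raddf_sum /= (bigD1 i) //= mderivZ mderivXU eqxx.
rewrite big1 => [|j ji]; first by rewrite addr0 -mul_mpolyC mulr1.
by rewrite mderivZ mderivXU eq_sym (negPf ji) scaler0.
Qed.

Lemma mderiv_nrm i : mderiv i nrm = 2%:R * 'X_i.
Proof.
rewrite /nrm raddf_sum /= (bigD1 i) //= expr2 mderivM mderivXU eqxx mulr1 mul1r.
rewrite big1 => [|j ji]; first by rewrite addr0 mulr_natl mulr2n.
by rewrite expr2 mderivM mderivXU eq_sym (negPf ji) mulr0 mul0r addr0.
Qed.

Lemma mderiv_exp i p k : mderiv i (p ^+ k) = k%:R * p ^+ k.-1 * mderiv i p.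
Proof.
elim: k => [|k IH]; first by rewrite expr0 !mul0r -[1]/(1%:MP) mderivC.
rewrite exprS mderivM IH; case: k {IH} => [|k] /=; first by ring.
by rewrite [p ^+ k.+1]exprS -[k.+2]addn1 natrD; ring.
Qed.

Lemma mderiv_linnrm i u a j :
  mderiv i (lin u ^+ a * nrm ^+ j) =
  a%:R * (u i)%:MP * (lin u ^+ a.-1 * nrm ^+ j)
  + (2 * j)%:R * 'X_i * (lin u ^+ a * nrm ^+ j.-1).
Proof. by rewrite mderivM !mderiv_exp mderiv_lin mderiv_nrm natrM; ring. Qed.

Lemma mderiv_nat i k : mderiv i (k%:R : {mpoly R[n]}) = 0.
Proof. by rewrite -mpolyC_nat mderivC. Qed.

Lemma laplace_linnrm u a j :
  laplace (lin u ^+ a * nrm ^+ j) =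
  ((a * a.-1)%:R * dotp u u) *: (lin u ^+ a.-2 * nrm ^+ j)
  + (2 * j * (n + 2 * j.-1 + 2 * a))%:R *: (lin u ^+ a * nrm ^+ j.-1).
Proof.
rewrite /laplace.
have E i : mderiv i (mderiv i (lin u ^+ a * nrm ^+ j)) =
   (a * a.-1)%:R * (u i * u i)%:MP * (lin u ^+ a.-2 * nrm ^+ j)
   + (4 * j)%:R * (a%:R * lin u ^+ a.-1 * nrm ^+ j.-1) * (u i *: 'X_i)
   + (2 * j)%:R * (lin u ^+ a * nrm ^+ j.-1)
   + (4 * j * j.-1)%:R * (lin u ^+ a * nrm ^+ j.-2) * 'X_i ^+ 2.
  rewrite mderiv_linnrm mderivD mderivM [mderiv i (_ * (u i)%:MP)]mderivM mderivC.
  rewrite [mderiv i (_ * 'X_i * _)]mderivM [mderiv i (_ * 'X_i)]mderivM.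
  rewrite !mderiv_nat mderivXU eqxx !mderiv_linnrm -mul_mpolyC mpolyCM !natrM.
  by rewrite /=; ring.
under eq_bigr do rewrite E.
rewrite !big_split /= -!mulr_suml -!mulr_sumr -/(lin u) -/nrm.
rewrite sumr_const card_ord -[\sum_i (_)%:MP]raddf_sum /= -/(dotp u u).
rewrite -!mul_mpolyC !mpolyCM !mpolyC_nat.
(* The predecessors are truncated at 0, but there the numerical factor in front is zero, so [La] and
   [Nj] hold for all exponents. *)
have La : a%:R * lin u ^+ a.-1 * lin u = a%:R * lin u ^+ a.
  by case: a {E} => [|a] /=; rewrite ?mul0r // -mulrA -exprSr.
have Nj : (j * j.-1)%:R * nrm ^+ j.-2 * nrm = (j * j.-1)%:R * nrm ^+ j.-1.
  by case: j {E} => [|[|j]] /=; rewrite ?mul0r // -mulrA -exprSr.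
transitivity ((a * a.-1)%:R * (dotp u u)%:MP_[n] * (lin u ^+ a.-2 * nrm ^+ j) +
   (4 * j)%:R * (a%:R * lin u ^+ a.-1 * lin u) * nrm ^+ j.-1 +
   ((2 * j)%:R * (lin u ^+ a * nrm ^+ j.-1) *+ n) +
   4 * ((j * j.-1)%:R * nrm ^+ j.-2 * nrm) * lin u ^+ a).
  by rewrite -mulnA natrM; ring.
by rewrite La Nj -mulr_natr !(natrM, natrD); ring.
Qed.

Lemma laplaceD p q : laplace (p + q) = laplace p + laplace q.
Proof. by rewrite /laplace -big_split; apply: eq_bigr => i _; rewrite !mderivD. Qed.

Lemma laplaceZ c p : laplace (c *: p) = c *: laplace p.
Proof. by rewrite /laplace scaler_sumr; apply: eq_bigr => i _; rewrite !mderivZ. Qed.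

Lemma laplace_sum (I : Type) (r : seq I) (P : pred I) (F : I -> {mpoly R[n]}) :
  laplace (\sum_(i <- r | P i) F i) = \sum_(i <- r | P i) laplace (F i).
Proof.
apply: (big_morph _ laplaceD); rewrite /laplace big1 // => i _.
by rewrite !mderiv0.
Qed.

Lemma dirder_linnrm u v b a j :
  dirder u (lin u ^+ b * lin v ^+ a * nrm ^+ j) =
  (b%:R * dotp u u) *: (lin u ^+ b.-1 * lin v ^+ a * nrm ^+ j)
  + (a%:R * dotp u v) *: (lin u ^+ b * lin v ^+ a.-1 * nrm ^+ j)
  + (2 * j)%:R *: (lin u ^+ b.+1 * lin v ^+ a * nrm ^+ j.-1).
Proof.
rewrite /dirder.
have E i : u i *: mderiv i (lin u ^+ b * lin v ^+ a * nrm ^+ j) =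
   (u i * u i)%:MP * (b%:R * (lin u ^+ b.-1 * lin v ^+ a * nrm ^+ j))
   + (u i * v i)%:MP * (a%:R * (lin u ^+ b * lin v ^+ a.-1 * nrm ^+ j))
   + (u i *: 'X_i) * ((2 * j)%:R * (lin u ^+ b * lin v ^+ a * nrm ^+ j.-1)).
  rewrite !mderivM !mderiv_exp !mderiv_lin mderiv_nrm -!mul_mpolyC.
  by rewrite !mpolyCM natrM; ring.
under eq_bigr do rewrite E.
rewrite !big_split /= -!mulr_suml -/(lin u) -!raddf_sum /= -/(dotp u u) -/(dotp u v).
by rewrite -!mul_mpolyC !mpolyCM !mpolyC_nat exprS; ring.
Qed.

(** Pairing a form of degree k with [lin u ^+ k] evaluates it at [u], up to a factorial. The factor
    [lin u ^+ b] makes the induction go through, since differentiating [nrm] along [u] produces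
    [lin u]; the weights b, a and 2j then add up as in Euler's identity. *)
Lemma fischer_lin_linnrm k u v b a j : (b + a + 2 * j = k)%N ->
  fischer k (lin u ^+ k) (lin u ^+ b * lin v ^+ a * nrm ^+ j) =
  k`!%:R * (dotp u u ^+ b * dotp u v ^+ a * dotp u u ^+ j).
Proof.
elim: k b a j => [|k IH] b a j bajk.
  have [-> -> ->] : [/\ b = 0, a = 0 & j = 0]%N by split; lia.
  rewrite !expr0 !mulr1 fact0; have -> : 1 = 'X_[0%MM] :> {mpoly R[n]} by rewrite mpolyX0.
  rewrite fischerXl mdeg0 eqxx.
  by rewrite mcoeffX eqxx /mfact big1 ?mulr1 // => i _; rewrite mnm0E.
rewrite exprS fischer_lin dirder_linnrm !fischerDr !fischerZr.
have -> : (b%:R * dotp u u) * fischer k (lin u ^+ k) (lin u ^+ b.-1 * lin v ^+ a * nrm ^+ j)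
  = b%:R * k`!%:R * (dotp u u ^+ b * dotp u v ^+ a * dotp u u ^+ j).
  case: b bajk => [|b] bajk; first by rewrite !mul0r.
  by rewrite IH /=; [rewrite exprS; ring | lia].
have -> : (a%:R * dotp u v) * fischer k (lin u ^+ k) (lin u ^+ b * lin v ^+ a.-1 * nrm ^+ j)
  = a%:R * k`!%:R * (dotp u u ^+ b * dotp u v ^+ a * dotp u u ^+ j).
  case: a bajk => [|a] bajk; first by rewrite !mul0r.
  by rewrite IH /=; [rewrite [dotp u v ^+ a.+1]exprS; ring | lia].
have -> : (2 * j)%:R * fischer k (lin u ^+ k) (lin u ^+ b.+1 * lin v ^+ a * nrm ^+ j.-1)
  = (2 * j)%:R * k`!%:R * (dotp u u ^+ b * dotp u v ^+ a * dotp u u ^+ j).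
  case: j bajk => [|j] bajk; first by rewrite muln0 !mul0r.
  by rewrite IH /=; [rewrite !exprS; ring | lia].
by rewrite factS -bajk !(natrM, natrD); ring.
Qed.

Section Zonal.
Variables (K : nat) (g : nat -> R).
Hypothesis g0 : g 0%N = 1.
(** Differentiating [lin] twice in term j of [zonalp] and [nrm] in term j + 1 gives the same
    monomial; this recurrence makes the two contributions cancel. *)
Hypothesis gS : forall j, (j < K)%N ->
  g j * (2 * (K - j) * (2 * (K - j)).-1)%:R
  + g j.+1 * (2 * j.+1 * (n + 2 * j + 2 * (2 * (K - j.+1))))%:R = 0.

(** The even Gegenbauer polynomial with pole [u], made homogeneous of degree 2K by powers of the
    squared norm. *)
Definition zonalp u : {mpoly R[n]} :=
  \sum_(j < K.+1) (g j * dotp u u ^+ j) *: (lin u ^+ (2 * (K - j)) * nrm ^+ j).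

Definition zonal u v : R :=
  \sum_(j < K.+1) g j * dotp u v ^+ (2 * (K - j)) * (dotp u u * dotp v v) ^+ j.

Lemma fischer_lin_zonal u v :
  fischer (2 * K) (lin u ^+ (2 * K)) (zonalp v) = (2 * K)`!%:R * zonal u v.
Proof.
rewrite /zonalp fischer_sumr mulr_sumr; apply: eq_bigr => j _.
have := @fischer_lin_linnrm (2 * K) u v 0 (2 * (K - j)) j.
rewrite expr0 !mul1r fischerZr => ->; last by have := ltn_ord j; lia.
by rewrite exprMn; ring.
Qed.

Lemma laplace_zonal u : laplace (zonalp u) = 0.
Proof.
rewrite /zonalp laplace_sum.
under eq_bigr do rewrite laplaceZ laplace_linnrm scalerDr !scalerA.
(* The term j = K has no [lin] to differentiate and the term j = 0 has no [nrm], so the two sums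
   match after a shift by one. *)
rewrite big_split /= big_ord_recr [X in _ + X]big_ord_recl /= subnn !muln0 !mul0n !mul0r.
rewrite !mulr0 !scale0r addr0 add0r -big_split big1 //= => j _.
have := gS (ltn_ord j); set G := g _ * _ + _ => G0.
have -> : (2 * (K - j)).-2 = (2 * (K - bump 0 j))%N by rewrite /bump; lia.
rewrite /bump /= !add1n add0n -scalerDl; set c := (X in X *: _).
have -> : c = dotp u u ^+ j.+1 * G by rewrite /c /G exprS; ring.
by rewrite G0 mulr0 scale0r.
Qed.

(** All terms of [zonalp] but the first contain [nrm], whose adjoint is the Laplacian; they are
    orthogonal to a harmonic [q]. *)
Lemma fischer_zonal u q : laplace q = 0 ->
  fischer (2 * K) (zonalp u) q = fischer (2 * K) (lin u ^+ (2 * K)) q.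
Proof.
move=> q0; rewrite /zonalp big_ord_recl /= g0 !mulr1 scale1r subn0.
rewrite fischerC fischerDr fischerC [X in _ + X]fischerC fischer_suml big1 ?addr0 //.
move=> j _; rewrite fischerZl /bump /= add1n [nrm ^+ _]exprS [lin _ ^+ _ * _]mulrCA.
have -> : (2 * K = (2 * K).-2.+2)%N by have := ltn_ord j; lia.
by rewrite fischer_nrm q0 fischer0r mulr0.
Qed.

(* If f is the sum of the zonal harmonics of the points of C, then <f, f> is the sum of the
   values of f on C, and f vanishes everywhere as soon as <f, f> = 0. *)
Lemma zonal_sum_eq0 (T : Type) (C : seq T) (V : T -> 'I_n -> R) :
  \sum_(y <- C) \sum_(z <- C) zonal (V y) (V z) = 0 ->
  forall u, \sum_(y <- C) zonal u (V y) = 0.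
Proof.
move=> H u; pose f := \sum_(y <- C) zonalp (V y).
have f0 : laplace f = 0 by rewrite laplace_sum big1 // => y _; apply: laplace_zonal.
have E v : fischer (2 * K) (lin v ^+ (2 * K)) f = (2 * K)`!%:R * \sum_(y <- C) zonal v (V y).
  by rewrite fischer_sumr mulr_sumr; apply: eq_bigr => y _; apply: fischer_lin_zonal.
have ff0 : fischer (2 * K) f f = 0.
  rewrite {1}/f fischer_suml.
  under eq_bigr do rewrite fischer_zonal // E.
  by rewrite -mulr_sumr H mulr0.
have := E u; rewrite fischer_eq0 // => /esym/eqP; rewrite mulf_eq0 pnatr_eq0.
by rewrite gtn_eqF ?fact_gt0 //= => /eqP.
Qed.
End Zonal.
End Fischer.
End Fischer.

Require Import Defs.

(** * The Golay code *)

Definition golay_bit (k i : nat) : bool :=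
  if (i < 23)%N then [&& k <= i, i - k <= 11 & golay_gcoef (i - k)]%N else true.

Definition golay_row (k : nat) : seq bool := mkseq (golay_bit k) 24.

Fixpoint xors (s t : seq bool) : seq bool :=
  match s, t with b :: s', c :: t' => (b (+) c) :: xors s' t' | _, _ => [::] end.

Fixpoint span (rows : seq (seq bool)) : seq (seq bool) :=
  if rows is r :: rows' then let s := span rows' in s ++ map (xors r) s
  else [:: nseq 24 false].

Definition golay_words := span (map golay_row (iota 0 12)).

(** Words become binary numbers so that their distinctness can be read off a sorted list. *)
Fixpoint code_num (s : seq bool) : N :=
  if s is b :: s' then
    if b then N.succ_double (code_num s') else N.double (code_num s')
  else 0%num.

Definition golay_check : bool :=
  [&& all (fun w => (count id w %% 4 == 0) && ((count id w < 8) ==> ~~ has id w)) golay_words,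
      size golay_words == 4096,
      sorted N.ltb (sort N.leb (map code_num golay_words)) &
      nseq 24 true \in golay_words]%N.

Definition octads := [seq w <- golay_words | count id w == 8]%N.

(** 253 and 77 are the numbers of blocks of the Steiner system S(5,8,24) through one point and
    through two points. *)
Definition octad_check : bool :=
  let o := octads in
  all (fun i => all (fun j =>
    count (fun w => nth false w i && nth false w j) o == (if i == j then 253 else 77))
    (iota 0 24)) (iota 0 24).

Definition golay_col (i : nat) : seq bool := mkseq (fun k => golay_bit k i) 12.

(** Different pairs of columns of the generator matrix have different sums, so neither two nor four
    distinct columns add up to zero. *)
Definition column_check : bool :=
  let cols := map golay_col (iota 0 24) in
  let prs := flatten [seq [seq (i, j, code_num (xors (nth [::] cols i) (nth [::] cols j)))
    | j <- iota 0 24] | i <- iota 0 24] in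
  all (fun p => all (fun q =>
     N.eqb p.2 q.2 ==> [|| (p.1.1 == p.1.2) && (q.1.1 == q.1.2),
        (p.1.1 == q.1.1) && (p.1.2 == q.1.2) | (p.1.1 == q.1.2) && (p.1.2 == q.1.1)]) prs) prs.

Lemma golay_checkE : golay_check = true.
Proof. vm_compute. reflexivity. Qed.
Lemma octad_checkE : octad_check = true.
Proof. vm_compute. reflexivity. Qed.
Lemma column_checkE : column_check = true.
Proof. vm_compute. reflexivity. Qed.

#[global] Opaque golay_words.

Definition wset (w : seq bool) : {set 'I_24} := [set i : 'I_24 | nth false w i].

Definition symd (S T : {set 'I_24}) : {set 'I_24} := [set i | (i \in S) (+) (i \in T)].

Lemma size_xors s t : size (xors s t) = minn (size s) (size t).
Proof. by elim: s t => [|b s IH] [|c t] //=; rewrite IH minnSS. Qed.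

Lemma nth_xors s t i : size s = size t ->
  nth false (xors s t) i = nth false s i (+) nth false t i.
Proof.
elim: s t i => [|b s IH] [|c t] [|i] //= [st]; rewrite ?addbF // IH //.
Qed.

Definition comb (rows : seq (seq bool)) (b : nat -> bool) : seq bool :=
  mkseq (fun i => \big[addb/false]_(k < size rows) (b k && nth false (nth [::] rows k) i)) 24.

Lemma spanP rows w : {in rows, forall r, size r = 24} ->
  (w \in span rows) <-> exists b, w = comb rows b.
Proof.
elim: rows w => [|r rows IH] w sz.
  have E b : comb [::] b = nseq 24 false.
    by rewrite /comb (@eq_mkseq _ _ (fun=> false)) // => i; rewrite big_ord0.
  by rewrite inE; split => [/eqP ->|[b ->]]; [exists xpredT|]; rewrite E.
have szr : size r = 24 by rewrite sz ?mem_head.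
have {}IH v : v \in span rows <-> exists b, v = comb rows b.
  by apply: IH => t tr; rewrite sz // inE tr orbT.
have E b : comb (r :: rows) b =
    if b 0 then xors r (comb rows (b \o succn)) else comb rows (b \o succn).
  apply: (@eq_from_nth _ false) => [|i]; rewrite size_mkseq.
    by case: ifP; rewrite ?size_xors size_mkseq ?szr.
  move=> i24; rewrite nth_mkseq // big_ord_recl /=; case: (b 0) => /=.
    by rewrite nth_xors ?size_mkseq ?szr // nth_mkseq.
  by rewrite nth_mkseq.
rewrite /= mem_cat; split => [/orP[/IH [b ->]|/mapP[v /IH[b ->] ->]]|[b ->]].
- exists (fun k => if k is k'.+1 then b k' else false); rewrite E.
  by apply: eq_mkseq.
- exists (fun k => if k is k'.+1 then b k' else true); rewrite E.
  by congr xors; apply: eq_mkseq.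
- rewrite E; case: (b 0); apply/orP; [right|left].
    by apply/map_f/IH; exists (b \o succn).
  by apply/IH; exists (b \o succn).
Qed.

Section GolaySets.
Local Open Scope ring_scope.

Lemma F2_add (x y : 'F_2) : (x + y != 0) = (x != 0) (+) (y != 0).
Proof. by case: x y => [[|[|]] //= ?] [[|[|]] //= ?]. Qed.

Lemma F2_mul (x y : 'F_2) : (x * y != 0) = (x != 0) && (y != 0).
Proof. by rewrite mulf_eq0 negb_or. Qed.

Lemma F2_eq (x y : 'F_2) : (x != 0) = (y != 0) -> x = y.
Proof. by case: x y => [[|[|]] //= ?] [[|[|]] //= ?] => // _; apply: val_inj. Qed.

Lemma F2_bool (b : bool) : ((if b then 1 else 0 : 'F_2) != 0) = b.
Proof. by case: b. Qed.

Lemma golay_gen_neq0 (k : 'I_12) (i : 'I_24) : (golay_gen k i != 0) = golay_bit k i.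
Proof.
rewrite mxE /golay_bit; case: ifP => // _; rewrite andbA; case: (_ && _) => //=.
by case: (golay_gcoef _).
Qed.

Lemma golay_comb (a : 'rV['F_2]_12) (i : 'I_24) :
  ((a *m golay_gen) 0 i != 0) = \big[addb/false]_(k < 12) ((a 0 k != 0) && golay_bit k i).
Proof.
rewrite mxE (big_morph (fun x : 'F_2 => x != 0) (id1 := false) (op1 := addb)) //.
  by apply: eq_bigr => k _; rewrite F2_mul golay_gen_neq0.
exact: F2_add.
Qed.

Lemma golay_rows_size : {in map golay_row (iota 0 12), forall r, size r = 24%N}.
Proof. by move=> _ /mapP[k _ ->]; rewrite size_mkseq. Qed.

Lemma wset_comb (b : nat -> bool) (i : 'I_24) :
  (i \in wset (comb (map golay_row (iota 0 12)) b)) =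
  \big[addb/false]_(k < 12) (b k && golay_bit k i).
Proof.
rewrite inE nth_mkseq // size_map size_iota; apply: eq_bigr => k _.
by rewrite (nth_map 0%N) ?size_iota // nth_iota // add0n nth_mkseq.
Qed.

(** Links the matrix definition of the code to the enumerated words, on which the computed checks
    bear. *)
Lemma golay_setP (S : {set 'I_24}) : reflect (golay_set S) (S \in map wset golay_words).
Proof.
apply: (iffP mapP) => [[w /(spanP _ golay_rows_size)[b ->] ->]|[a /rowP aE]].
  exists (\row_k (if b k then 1 else 0)); apply/rowP => i; apply: F2_eq.
  rewrite golay_comb mxE F2_bool wset_comb; apply: eq_bigr => k _.
  by rewrite mxE F2_bool.
exists (comb (map golay_row (iota 0 12)) (fun k => a 0 (inord k) != 0)).
  by apply/(spanP _ golay_rows_size); eexists.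
apply/setP => i; rewrite wset_comb; have := aE i; rewrite mxE => ai.
rewrite -[LHS]F2_bool ai golay_comb; apply: eq_bigr => k _.
by rewrite inord_val.
Qed.

Lemma golay_symd S T : golay_set S -> golay_set T -> golay_set (symd S T).
Proof.
move=> [a /rowP aS] [b /rowP bT]; exists (a + b); apply/rowP => i.
rewrite mulmxDl mxE [RHS]mxE -aS -bT !mxE inE; apply: F2_eq.
by rewrite F2_add !F2_bool.
Qed.

Lemma golay_row_set (k : 'I_12) : golay_set (wset (golay_row k)).
Proof.
exists (delta_mx 0 k); apply/rowP => i; rewrite -rowE; apply: F2_eq.
by rewrite !mxE F2_bool inE nth_mkseq // -golay_gen_neq0 mxE.
Qed.
End GolaySets.

Lemma card_wset w : size w = 24 -> #|wset w| = count id w.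
Proof.
by move=> sw; rewrite /wset -sum1dep_card -sum1_count (big_nth false) big_mkord sw.
Qed.

Lemma size_golay_word w : w \in golay_words -> size w = 24.
Proof. by case/(spanP _ golay_rows_size) => b ->; rewrite size_mkseq. Qed.

Lemma uniq_golay_words : uniq golay_words.
Proof.
have /and4P[_ _ H _] := golay_checkE.
apply: (@map_uniq _ _ code_num); rewrite -(sort_uniq N.leb).
apply: sorted_uniq H; first by move=> x y z /N.ltb_lt yx /N.ltb_lt /(N.lt_trans _ _ _ yx) /N.ltb_lt.
by move=> x; apply: N.ltb_irrefl.
Qed.

Lemma wset_inj : {in golay_words &, injective wset}.
Proof.
move=> v w /size_golay_word sv /size_golay_word sw /setP vw.
apply: (@eq_from_nth _ false) => [|i]; rewrite sv ?sw // => i24.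
by have := vw (Ordinal i24); rewrite !inE.
Qed.

Lemma golay_set_card S : golay_set S -> 4 %| #|S| /\ (#|S| < 8 -> S = set0).
Proof.
move=> /golay_setP/mapP[w wC ->]; rewrite card_wset ?size_golay_word //.
have /and4P[/allP/(_ w wC)/andP[w4 w8] _ _ _] := golay_checkE; split=> [//|lt8].
apply/setP => i; rewrite !inE; apply/negbTE/negP => wi.
move: w8; rewrite lt8 /= => /hasP; apply; exists (nth false w i) => //.
by rewrite mem_nth // size_golay_word.
Qed.

Lemma golay_setT : golay_set [set: 'I_24].
Proof.
have /and4P[_ _ _ H] := golay_checkE; apply/golay_setP/mapP; eexists; first exact: H.
by apply/setP => i; rewrite !inE nth_nseq ltn_ord.
Qed.

Lemma symd_setI_card S T : #|symd S T| + 2 * #|S :&: T| = #|S| + #|T|.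
Proof.
have -> : symd S T = (S :\: T) :|: (T :\: S).
  by apply/setP => i; rewrite !inE; case: (i \in S); case: (i \in T).
have dis : [disjoint S :\: T & T :\: S].
  by rewrite -setI_eq0; apply/eqP/setP => i; rewrite !inE; case: (i \in S); rewrite ?andbF.
rewrite cardsU (_ : _ :&: _ = set0) ?cards0 ?subn0; last exact/eqP/(etrans (setI_eq0 _ _)).
have := cardsID T S; have := cardsID S T; rewrite (setIC T S); lia.
Qed.

(** [S], [T] and their symmetric difference have cardinalities divisible by 4, hence so is twice the
    cardinality of the intersection. *)
Lemma golay_setI_even S T : golay_set S -> golay_set T -> ~~ odd #|S :&: T|.
Proof.
move=> gS gT; have [s4 _] := golay_set_card gS; have [t4 _] := golay_set_card gT.
have [u4 _] := golay_set_card (golay_symd gS gT).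
have := symd_setI_card S T; rewrite -dvdn2.
move: s4 t4 u4 => /dvdnP[a ->] /dvdnP[b ->] /dvdnP[c ->] H.
by apply/dvdnP; exists (a + b - c); lia.
Qed.

Lemma golay_setC S : golay_set S -> golay_set (~: S).
Proof.
move=> gS; have -> : ~: S = symd S setT by apply/setP => i; rewrite !inE addbT.
exact: golay_symd gS golay_setT.
Qed.

Lemma golay_set0 : golay_set (set0 : {set 'I_24}).
Proof. by rewrite -setCT; exact: golay_setC golay_setT. Qed.

(* The Golay code has dual distance greater than 4. *)
Lemma golay_separate (i j k l : 'I_24) :
  ~~ [|| (i == j) && (k == l), (i == k) && (j == l) | (i == l) && (j == k)] ->
  exists2 S, golay_set S & (i \in S) (+) (j \in S) (+) ((k \in S) (+) (l \in S)).
Proof.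
move=> nij.
(* If no generator row separates the two pairs, their column sums agree, which [column_check]
   excludes. *)
have [r /eqP rP|H] := pickP (fun r : 'I_12 =>
  (golay_bit r i (+) golay_bit r j) != (golay_bit r k (+) golay_bit r l)).
  exists (wset (golay_row r)); first exact: golay_row_set.
  rewrite !inE !nth_mkseq //; move: rP.
  by case: (golay_bit r i (+) golay_bit r j); case: (golay_bit r k (+) golay_bit r l).
case/negP: nij; have := column_checkE; rewrite /column_check.
set cols := map golay_col _; set prs := flatten _ => /allP ch.
pose pr (a b : 'I_24) := (a : nat, b : nat, code_num (xors (nth [::] cols a) (nth [::] cols b))).
have prP a b : pr a b \in prs.
  apply/flattenP.
  exists [seq (a : nat, j, code_num (xors (nth [::] cols a) (nth [::] cols j))) | j <- iota 0 24].
    by apply/mapP; exists (a : nat) => //; rewrite mem_iota ltn_ord.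
  by apply/mapP; exists (b : nat) => //; rewrite mem_iota ltn_ord.
have colE (a : 'I_24) : nth [::] cols a = golay_col a.
  by rewrite (nth_map 0) ?size_iota // nth_iota.
have e : xors (golay_col i) (golay_col j) = xors (golay_col k) (golay_col l).
  apply: (@eq_from_nth _ false); rewrite !size_xors !size_mkseq // => r r12.
  rewrite !nth_xors ?size_mkseq // !nth_mkseq //.
  by have /negbFE/eqP := H (Ordinal r12).
have /allP/(_ _ (prP k l)) := ch _ (prP i j).
rewrite /pr /= !colE e N.eqb_refl /= => /or3P[] /andP[/eqP/val_inj -> /eqP/val_inj ->].
- by rewrite !eqxx.
- by rewrite !eqxx orbT.
- by rewrite !eqxx !orbT.
Qed.

Definition golay_sets : {set {set 'I_24}} := [set S | S \in map wset golay_words].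

Lemma golay_setsP S : reflect (golay_set S) (S \in golay_sets).
Proof. by rewrite in_set; apply: golay_setP. Qed.

Lemma card_golay_sets : #|golay_sets| = 4096.
Proof.
rewrite cardsE; have /and4P[_ /eqP <- _ _] := golay_checkE.
by rewrite -(size_map wset) -(card_uniqP _) // map_inj_in_uniq ?uniq_golay_words //; exact: wset_inj.
Qed.

Definition octad_sets : {set {set 'I_24}} :=
  [set S in golay_sets | #|S| == 8].

Lemma octad_setP S : reflect (golay_set S /\ #|S| = 8) (S \in octad_sets).
Proof.
by rewrite inE; apply: (iffP andP) => [[/golay_setsP ? /eqP ?]|[/golay_setsP ? /eqP ?]].
Qed.

Lemma card_octad_pair (i j : 'I_24) :
  #|[set S in octad_sets | (i \in S) && (j \in S)]| = if i == j then 253 else 77.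
Proof.
have /allP/(_ (i : nat)) := octad_checkE; rewrite mem_iota => /(_ (ltn_ord i)).
move=> /allP/(_ (j : nat)); rewrite mem_iota => /(_ (ltn_ord j)) /eqP <-.
rewrite -size_filter; set s := filter _ _.
have sC w : w \in s -> w \in golay_words by rewrite !mem_filter => /andP[_ /andP[]].
rewrite -(size_map wset) -(card_uniqP _); last first.
  rewrite map_inj_in_uniq ?filter_uniq ?uniq_golay_words // => v w /sC vC /sC wC.
  exact: wset_inj.
apply: eq_card => S; rewrite !in_set; apply/idP/mapP.
  case/andP => /andP[/mapP[w wC ->] w8] ijw; exists w => //.
  by rewrite !mem_filter wC -card_wset ?size_golay_word // w8; move: ijw; rewrite !in_set => ->.
case=> w; rewrite !mem_filter => /and3P[ijw w8 wC] ->.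
by rewrite map_f // card_wset ?size_golay_word // w8 !in_set.
Qed.

(** * The Leech lattice *)

Local Open Scope ring_scope.

Section Leech.
Implicit Types (x y v w : 'rV[int]_24) (S T : {set 'I_24}).

Definition ind S i : int := (i \in S)%:R.

Lemma sum_ind S : \sum_i ind S i = #|S|%:Z.
Proof.
rewrite -sum1_card -natz natr_sum [RHS]big_mkcond /=.
by apply: eq_bigr => i _; rewrite /ind; case: (i \in S).
Qed.

Lemma ind_symd S T i : ind (symd S T) i = ind S i + ind T i - 2 * ind (S :&: T) i.
Proof. by rewrite /ind !inE; case: (i \in S); case: (i \in T). Qed.

Lemma golay_ind4 S : golay_set S -> exists q : int, \sum_i ind S i = 4 * q.
Proof.
by move=> /golay_set_card [/dvdnP[q E] _]; exists q%:Z; rewrite sum_ind E; lia.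
Qed.

Lemma golay_indI S T : golay_set S -> golay_set T -> exists q : int, \sum_i ind (S :&: T) i = 2 * q.
Proof.
move=> gS gT; have := golay_setI_even gS gT; rewrite -dvdn2 => /dvdnP[q E].
by exists q%:Z; rewrite sum_ind E; lia.
Qed.

(* The lattice in the form [x = m + 2 S + 4 z] with [S] a Golay codeword and [sum z = m] mod 2. *)
Definition rep x (m : int) S (z : 'I_24 -> int) :=
  [/\ golay_set S, forall i, x 0 i = m + 2 * ind S i + 4 * z i &
      exists q, \sum_i z i = m + 2 * q].

Lemma sum_rep x m S z : (forall i, x 0 i = m + 2 * ind S i + 4 * z i) ->
  \sum_i x 0 i = 24 * m + 2 * \sum_i ind S i + 4 * \sum_i z i.
Proof.
move=> E; under eq_bigr do rewrite E.
by rewrite !big_split /= -!mulr_sumr sumr_const card_ord -[m *+ 24]mulr_natl.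
Qed.

Lemma leech_rep x : leech x -> exists m S z, (m = 0 \/ m = 1) /\ rep x m S z.
Proof.
(* By the parity condition, the coordinates outside [S] are congruent to [m] modulo 4. *)
case=> m [m01 [xm [xS xs]]]; pose S := [set i | (x ord0 i == m + 2 %[mod 4])%Z].
have gS : golay_set S by apply: xS.
pose z (i : 'I_24) := ((x 0%R i - m - 2 * ind S i) %/ 4)%Z.
have E i : x 0 i = m + 2 * ind S i + 4 * z i.
  have xmi : (x 0%R i = m %[mod 2])%Z := xm i.
  rewrite /z /ind inE -[x ord0 i]/(x 0 i); case: eqP => /=; lia.
exists m, S, z; split; first by case: m01 => /eqP; [left|right].
split => //; have [q qE] := golay_ind4 gS.
have xs' : (\sum_i x 0%R i = 4 * m %[mod 8])%Z := xs.
move: xs'; rewrite (sum_rep E) qE => /eqP; rewrite eqz_mod_dvd => /dvdzP[p H].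
(* The witness solves 24m + 8q + 4s = 4m + 8p for s, the sum of [z]. *)
exists (p - q - 3 * m); move: H; move: (\sum_i z i) => s H; lia.
Qed.

(** Here [m] is any integer, so that sums and negatives need no normalization. The coordinates
    congruent to [nu] form the complement of [S], [S] itself or the empty set, according to [nu - m]
    modulo 4. *)
Lemma rep_leech x m S z : rep x m S z -> leech x.
Proof.
move=> [gS E [q sz]]; exists (m %% 2)%Z; split; [|split; [|split]].
- have : (m %% 2)%Z = 0 \/ (m %% 2)%Z = 1 by lia.
  by case=> ->; [left|right].
- by move=> i; rewrite -[x ord0 i]/(x 0 i) E; lia.
- move=> nu.
  have [H|[H|[H|H]]] : ((nu - m) %% 4)%Z = 0 \/ ((nu - m) %% 4)%Z = 2 \/
      ((nu - m) %% 4)%Z = 1 \/ ((nu - m) %% 4)%Z = 3 by lia.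
  + rewrite (_ : [set _ | _] = ~: S); first exact: golay_setC.
    by apply/setP => i; rewrite !inE -[x ord0 i]/(x 0 i) E /ind; case: (i \in S) => /=; apply/eqP; lia.
  + rewrite (_ : [set _ | _] = S) //.
    by apply/setP => i; rewrite !inE -[x ord0 i]/(x 0 i) E /ind; case: (i \in S) => /=; apply/eqP; lia.
  + rewrite (_ : [set _ | _] = set0); first exact: golay_set0.
    by apply/setP => i; rewrite !inE -[x ord0 i]/(x 0 i) E /ind; case: (i \in S) => /=; apply/eqP; lia.
  + rewrite (_ : [set _ | _] = set0); first exact: golay_set0.
    by apply/setP => i; rewrite !inE -[x ord0 i]/(x 0 i) E /ind; case: (i \in S) => /=; apply/eqP; lia.
- rewrite -[\sum_i _]/(\sum_i x 0 i) (sum_rep E) sz; have [p ->] := golay_ind4 gS; lia.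
Qed.

(** Adding two codewords carries the indicator of their intersection into [z]; the parity of the sum
    of [z] survives because codewords meet evenly. *)
Lemma leechD x y : leech x -> leech y -> leech (x + y).
Proof.
move=> /leech_rep[m [S [z [_ [gS Ex [q sz]]]]]] /leech_rep[m' [T [z' [_ [gT Ey [q' sz']]]]]].
apply: (@rep_leech _ (m + m') (symd S T) (fun i => z i + z' i + ind (S :&: T) i)).
split; first exact: golay_symd.
- by move=> i; rewrite mxE Ex Ey ind_symd; ring.
- have [p E] := golay_indI gS gT; exists (q + q' + p).
  by rewrite !big_split /= E sz sz'; ring.
Qed.

Lemma leechN x : leech x -> leech (- x).
Proof.
move=> /leech_rep[m [S [z [_ [gS Ex [q sz]]]]]].
apply: (@rep_leech _ (- m) S (fun i => - z i - ind S i)); split => //.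
- by move=> i; rewrite mxE Ex; ring.
- have [p E] := golay_ind4 gS; exists (- q - 2 * p).
  by rewrite big_split /= !sumrN sz E; ring.
Qed.

Lemma leechB x y : leech x -> leech y -> leech (x - y).
Proof. by move=> Lx Ly; apply: leechD => //; apply: leechN. Qed.

Definition flip S x : 'rV[int]_24 := \row_i ((1 - 2 * ind S i) * x 0 i).

Lemma flipK S : involutive (flip S).
Proof.
move=> x; apply/rowP => i; rewrite !mxE /ind; case: (i \in S) => /=; ring.
Qed.

(** Negation fixes the classes 0 and 2 modulo 4 and exchanges 1 and 3. So the codeword of [x] is
    unchanged when m = 0 and becomes its symmetric difference with [T] when m = 1. *)
Lemma leech_flip T x : golay_set T -> leech x -> leech (flip T x).
Proof.
move=> gT /leech_rep[m [S [z [m01 [gS Ex [q sz]]]]]].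
have [a aE] := golay_ind4 gT; have [b bE] := golay_indI gT gS.
have sTz : exists c, \sum_i ind T i * z i = c by eexists.
have [c cE] := sTz.
have E i : ind T i * ind S i = ind (T :&: S) i.
  by rewrite /ind !inE; case: (i \in T); case: (i \in S).
case: m01 => m01; move: Ex sz; rewrite {}m01 => Ex sz.
- apply: (@rep_leech _ 0 S (fun i => z i - ind (T :&: S) i - 2 * (ind T i * z i))); split => //.
  + by move=> i; rewrite mxE Ex -E; ring.
  + by exists (q - b - c); rewrite !sumrB -mulr_sumr sz bE cE; ring.
- apply: (@rep_leech _ 1 (symd T S) (fun i => z i - ind T i - 2 * (ind T i * z i))); split.
  + exact: golay_symd.
  + by move=> i; rewrite mxE Ex ind_symd -E; ring.
  + by exists (q - 2 * a - c); rewrite !sumrB -mulr_sumr sz aE cE; ring.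
Qed.

Lemma ind_sqr S i : ind S i ^+ 2 = ind S i.
Proof. by rewrite /ind; case: (i \in S). Qed.

Lemma sqnorm_leech x : leech x -> exists q, sqnorm24 x = 16 * q.
Proof.
move=> /leech_rep[m [S [z [m01 [gS Ex [q sz]]]]]]; rewrite /sqnorm24.
have E i : x 0 i ^+ 2 = m ^+ 2 + (4 + 4 * m) * ind S i + 8 * m * z i + 16 * (z i ^+ 2 + ind S i * z i).
  by rewrite Ex; have := ind_sqr S i; rewrite !expr2 => e; ring: e.
under eq_bigr do rewrite E.
rewrite !big_split /= -!mulr_sumr sumr_const card_ord sz.
have [p ->] := golay_ind4 gS; set u := \sum_i (_ + _).
case: m01 => ->; first by exists (p + u); lia.
by exists (2 + 2 * p + q + u); lia.
Qed.

Definition idot x y : int := \sum_i x 0 i * y 0 i.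

Lemma sqnormD x y : sqnorm24 (x + y) = sqnorm24 x + sqnorm24 y + 2 * idot x y.
Proof.
rewrite /sqnorm24 /idot mulr_sumr -!big_split; apply: eq_bigr => i _.
by rewrite mxE /=; ring.
Qed.

Lemma sqnormB x y : sqnorm24 (x - y) = sqnorm24 x + sqnorm24 y - 2 * idot x y.
Proof.
rewrite /sqnorm24 /idot mulr_sumr -big_split -sumrB; apply: eq_bigr => i _.
by rewrite !mxE /=; ring.
Qed.

(** Polarization of the divisibility of squared norms by 16. *)
Lemma idot_leech x y : leech x -> leech y -> exists q, idot x y = 8 * q.
Proof.
move=> Lx Ly; have [a aE] := sqnorm_leech Lx; have [b bE] := sqnorm_leech Ly.
have [c cE] := sqnorm_leech (leechD Lx Ly).
by exists (c - a - b); have := sqnormD x y; lia.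
Qed.

(** Confines the excess of a short vector over the least possible coordinates to a single place. *)
Lemma sum_nneg_le1 (y : 'I_24 -> int) : (forall i, 0 <= y i) -> \sum_i y i <= 1 ->
  (forall i, y i = 0) \/ exists k, forall i, y i = (i == k)%:R.
Proof.
move=> y0 ys; have [k /eqP yk|H] := pickP (fun k => y k != 0); last first.
  by left => i; have /negbFE/eqP := H i.
right; exists k => i; move: ys; rewrite (bigD1 k) //=; have := y0 k.
case: eqP => [->|/eqP ik].
  have : 0 <= \sum_(i0 < 24 | i0 != k) y i0 by apply: sumr_ge0.
  by move: (\sum_(i0 < 24 | _) _) => s /=; lia.
rewrite (bigD1 i) //=; have := y0 i.
have : 0 <= \sum_(i0 < 24 | (i0 != k) && (i0 != i)) y i0 by apply: sumr_ge0.
by move: (\sum_(i0 < 24 | _) _) => s /=; lia.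
Qed.

(* The shapes (2^8, 0^16), (3, 1^23) and (4^2, 0^22), up to signs, of the minimal vectors. *)
Definition min2 (p : {set 'I_24} * {set 'I_24}) : 'rV[int]_24 :=
  \row_i (2 * ind p.1 i - 4 * ind p.2 i).

Definition min3 (p : 'I_24 * {set 'I_24}) : 'rV[int]_24 :=
  \row_i ((1 - 2 * ind p.2 i) * (1 - 4 * (i == p.1)%:R)).

Definition min4 (p : ('I_24 * 'I_24) * (bool * bool)) : 'rV[int]_24 :=
  \row_i (4 * (-1) ^+ p.2.1 * (i == p.1.1)%:R + 4 * (-1) ^+ p.2.2 * (i == p.1.2)%:R).

Definition par2 : {set {set 'I_24} * {set 'I_24}} :=
  [set p : {set 'I_24} * {set 'I_24} | [&& p.1 \in octad_sets, p.2 \subset p.1 & ~~ odd #|p.2|]].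

Definition par3 : {set 'I_24 * {set 'I_24}} :=
  [set p : 'I_24 * {set 'I_24} | p.2 \in golay_sets].

Definition par4 : {set ('I_24 * 'I_24) * (bool * bool)} :=
  [set p : ('I_24 * 'I_24) * (bool * bool) | (p.1.1 < p.1.2)%N].

Definition minvecs : seq 'rV[int]_24 :=
  map min2 (enum par2) ++ map min3 (enum par3) ++ map min4 (enum par4).

Lemma par2P (O s : {set 'I_24}) : reflect [/\ golay_set O, #|O| = 8%N, s \subset O & ~~ odd #|s|]
  ((O, s) \in par2).
Proof.
rewrite inE /=; apply: (iffP and3P) => [[/octad_setP[? ?] ? ?]|[? ? ? ?]] //.
by split => //; apply/octad_setP.
Qed.

Lemma par3P (k : 'I_24) S : reflect (golay_set S) ((k, S) \in par3).
Proof. by rewrite in_set; apply: golay_setsP. Qed.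

Lemma min2_rep (O s : {set 'I_24}) : (O, s) \in par2 ->
  rep (min2 (O, s)) 0 O (fun i => - ind s i) /\ sqnorm24 (min2 (O, s)) = 32.
Proof.
move=> /par2P[gO O8 sO os]; split.
  split=> // [i|]; first by rewrite mxE /=; ring.
  have /dvdnP[q sq] : (2 %| #|s|)%N by rewrite dvdn2.
  by exists (- q%:Z); rewrite sumrN sum_ind sq; lia.
rewrite /sqnorm24; have E i : min2 (O, s) 0 i ^+ 2 = 4 * ind O i.
  rewrite mxE /= /ind; have := subsetP sO i.
  by case: (i \in s) => [/(_ isT) ->|_] //=; case: (i \in O).
by under eq_bigr do rewrite E; rewrite -mulr_sumr sum_ind O8.
Qed.

Lemma sum_delta (k : 'I_24) : \sum_i (i == k)%:R = 1 :> int.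
Proof.
by rewrite (bigD1 k) //= eqxx big1 ?addr0 // => i /negPf ->.
Qed.

Lemma min3_rep (k : 'I_24) S : golay_set S ->
  rep (min3 (k, S)) 1 S (fun i => - (1 - 2 * ind S i) * (i == k)%:R - ind S i)
  /\ sqnorm24 (min3 (k, S)) = 32.
Proof.
move=> gS; split.
  split=> // [i|]; first by rewrite mxE /=; ring.
  have [q qE] := golay_ind4 gS; exists (ind S k - 2 * q - 1).
  rewrite big_split sumrN qE /= (bigD1 k) //= big1 => [|i /negPf ->]; last by rewrite mulr0.
  by rewrite eqxx /=; ring.
rewrite /sqnorm24; have E i : min3 (k, S) 0 i ^+ 2 = 1 + 8 * (i == k)%:R.
  by rewrite mxE /= /ind; case: (i \in S); case: (i == k).
by under eq_bigr do rewrite E; rewrite big_split -mulr_sumr sum_delta sumr_const card_ord.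
Qed.

Lemma min4_sqr p i : p \in par4 ->
  min4 p 0 i ^+ 2 = 16 * ((i == p.1.1)%:R + (i == p.1.2)%:R).
Proof.
case: p => [[j k] [a b]]; rewrite inE /= => jk; have jk' : j != k by rewrite neq_ltn jk.
rewrite mxE /=; case: (altP (i =P j)) => [->|_]; first by rewrite (negPf jk'); case: a; case: b.
by case: (i == k); case: a; case: b.
Qed.

Lemma min4_rep p : p \in par4 ->
  rep (min4 p) 0 set0 (fun i => (-1) ^+ p.2.1 * (i == p.1.1)%:R + (-1) ^+ p.2.2 * (i == p.1.2)%:R)
  /\ sqnorm24 (min4 p) = 32.
Proof.
case: p => [[j k] [a b]]; rewrite inE /= => jk; split.
  split=> /= [|i|]; first exact: golay_set0.
    by rewrite mxE /ind inE /=; ring.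
  by rewrite big_split -!mulr_sumr !sum_delta; case: a; case: b; [exists (-1)|exists 0|exists 0|exists 1].
rewrite /sqnorm24; under eq_bigr do rewrite min4_sqr ?inE //.
by rewrite -mulr_sumr big_split !sum_delta.
Qed.

Lemma minvecs_leech x : x \in minvecs -> leech x /\ sqnorm24 x = 32.
Proof.
rewrite !mem_cat => /or3P[] /mapP[p]; rewrite mem_enum.
- by case: p => O s /min2_rep[/rep_leech ? ?] ->.
- by case: p => k S /par3P/(min3_rep k) [/rep_leech ? ?] ->.
- by move=> /min4_rep[/rep_leech ? ?] ->.
Qed.
(** An odd square is 1 + 8y, and squared norm 32 leaves a total of at most 1 for y over 24
    coordinates. Total 0 would make the sum of [z] equal to minus the cardinality of [S], which is
    even, while m = 1 asks for an odd sum. *)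
Lemma min3_complete x S z : rep x 1 S z -> sqnorm24 x <= 32 ->
  exists k, x = min3 (k, S).
Proof.
move=> [gS Ex [q sz]] nx.
pose y i := (if i \in S then (2 * z i + 1) * (z i + 1) else z i * (2 * z i + 1) : int).
have y0 i : 0 <= y i.
  by rewrite /y; case: (lerP 0 (z i)) => zi0; case: ifP => _;
    [| |rewrite -mulrNN|rewrite -mulrNN]; apply: mulr_ge0; lia.
have Ey i : x 0 i ^+ 2 = 1 + 8 * y i.
  by rewrite Ex /y /ind; case: (i \in S) => /=; ring.
have : \sum_i y i <= 1.
  move: nx; rewrite /sqnorm24; under eq_bigr do rewrite Ey.
  by rewrite big_split -mulr_sumr sumr_const card_ord /=; move: (\sum_i y i) => s; lia.
have z0 i : y i = 0 -> z i = - ind S i.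
  by rewrite /y /ind; case: (i \in S) => /= /eqP; rewrite mulf_eq0 => /orP[] /eqP; lia.
case/(sum_nneg_le1 y0) => [yi|[k yk]].
  have [p pE] := golay_ind4 gS; have : \sum_i z i = - \sum_i ind S i.
    by rewrite -sumrN; apply: eq_bigr => i _; rewrite z0.
  by rewrite sz pE; lia.
exists k; apply/rowP => i; rewrite Ex mxE /=; have := yk i; case: (i == k) => /= yi.
  by move: yi; rewrite /y /ind; case: (i \in S) => /=; nia.
by rewrite z0 //; ring.
Qed.

(** The eight coordinates in [S] already contribute at least 8 * 4 = 32, so no coordinate can exceed
    its least absolute value. *)
Lemma min2_complete x S z : rep x 0 S z -> #|S| = 8%N -> sqnorm24 x <= 32 ->
  exists2 s, (S, s) \in par2 & x = min2 (S, s).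
Proof.
move=> [gS Ex [q sz]] S8 nx.
pose y i := z i * (z i + ind S i).
have y0 i : 0 <= y i by rewrite /y /ind; case: (i \in S) => /=; nia.
have Ey i : x 0 i ^+ 2 = 4 * ind S i + 16 * y i.
  by rewrite Ex /y /ind; case: (i \in S) => /=; ring.
have ys : \sum_i y i <= 0.
  move: nx; rewrite /sqnorm24; under eq_bigr do rewrite Ey.
  by rewrite big_split -!mulr_sumr sum_ind S8 /=; move: (\sum_i y i) => s; lia.
have yi i : y i = 0.
  apply/eqP; rewrite eq_le y0 andbT; apply: le_trans ys.
  by rewrite (bigD1 i) //= lerDl sumr_ge0.
pose s := [set i | z i != 0].
have zs i : z i = - ind s i /\ (i \in s -> i \in S).
  have /eqP := yi i; rewrite /y /ind /s inE mulf_eq0.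
  case: (altP (z i =P 0)) => [-> _|zi] //=.
  by case: (i \in S) => /= /eqP; lia.
exists s; last by apply/rowP => i; rewrite Ex mxE /= (zs i).1; ring.
apply/par2P; split => //; first by apply/subsetP => i; case: (zs i).
have : \sum_i z i = - #|s|%:Z by rewrite -sum_ind -sumrN; apply: eq_bigr => i _; case: (zs i).
by rewrite sz -dvdn2; move: #|s| => n ?; apply/dvdnP; exists `|q|%N; lia.
Qed.

Lemma min4_complete x z : rep x 0 set0 z -> x != 0 -> sqnorm24 x <= 32 ->
  exists2 p, p \in par4 & x = min4 p.
Proof.
move=> [_ Ex [q sz]] x0 nx.
have {}Ex i : x 0 i = 4 * z i by rewrite Ex /ind inE /=; ring.
have nz : \sum_i z i ^+ 2 <= 2.
  move: nx; rewrite /sqnorm24; under eq_bigr do rewrite Ex exprMn.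
  by rewrite -mulr_sumr; move: (\sum_i z i ^+ 2) => s; lia.
have [j zj] : exists j, z j != 0.
  apply/existsP; apply: contraNT x0; rewrite negb_exists => /forallP H.
  by apply/eqP/rowP => i; rewrite Ex mxE; have /negPn/eqP -> := H i.
pose y i := (if i == j then 0 else z i ^+ 2).
have y0 i : 0 <= y i by rewrite /y; case: ifP => // _; rewrite sqr_ge0.
have ysum : \sum_i z i ^+ 2 = z j ^+ 2 + \sum_i y i.
  rewrite (bigD1 j) //= [in RHS](bigD1 j) //= {1}/y eqxx add0r; congr (_ + _).
  by apply: eq_bigr => i /negPf ij; rewrite /y ij.
have : \sum_i y i <= 1 by move: nz; rewrite ysum; move: (\sum_i y i) => s; nia.
(* A single nonzero entry of [z] would be 1 or -1, against the even sum of [z]. *)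
case/(sum_nneg_le1 y0) => [yi|[k yk]].
  have zi i : i != j -> z i = 0 by have := yi i; rewrite /y; case: (i == j) => //=; nia.
  move: sz nz; rewrite ysum (bigD1 j) //= !big1 // => sz' nz'; nia.
have kj : k != j by have := yk k; rewrite /y eqxx; case: (k == j).
have zi i : i != j -> i != k -> z i = 0.
  move=> ij ik; have := yk i; rewrite /y (negPf ij) (negPf ik) /=; nia.
have zk : z k = 1 \/ z k = -1 by have := yk k; rewrite /y eqxx (negPf kj) /=; nia.
have zj1 : z j = 1 \/ z j = -1.
  have : \sum_i y i = 1 by under eq_bigr do rewrite yk; exact: sum_delta.
  move: nz; rewrite ysum => + yE; rewrite yE; nia.
have sg (t : int) : t = 1 \/ t = -1 -> exists b : bool, t = (-1) ^+ b.
  by case=> ->; [exists false | exists true].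
have [a aE] := sg _ zj1; have [b bE] := sg _ zk.
have E i : x 0 i = 4 * (-1) ^+ a * (i == j)%:R + 4 * (-1) ^+ b * (i == k)%:R.
  rewrite Ex -aE -bE; case: (altP (i =P j)) => [->|ij].
    by rewrite eq_sym (negPf kj) /=; ring.
  case: (altP (i =P k)) => [->|ik] /=; first by ring.
  by rewrite zi //; ring.
have := neq_ltn k j; rewrite kj => /esym/orP[lt|lt].
  exists ((k, j), (b, a)); first by rewrite inE.
  by apply/rowP => i; rewrite E mxE /= addrC.
exists ((j, k), (a, b)); first by rewrite inE.
by apply/rowP => i; rewrite E mxE.
Qed.

Lemma minvecs_complete x : leech x -> x != 0 -> sqnorm24 x <= 32 -> x \in minvecs.
Proof.
move=> /leech_rep[m [S [z [m01 r]]]] x0 nx; rewrite !mem_cat.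
case: m01 r => -> r; last first.
  have [k ->] := min3_complete r nx; rewrite map_f ?orbT // mem_enum.
  by apply/par3P; case: r.
have [gS Ex _] := r; have [S4 S8] := golay_set_card gS.
case: (ltngtP #|S| 8) => S8'.
- have S0 := S8 S8'; move: r; rewrite S0 => r.
  by have [p pP ->] := min4_complete r x0 nx; rewrite map_f ?orbT // mem_enum.
(* Coordinates in [S] are congruent to 2 modulo 4, so their squares are at least 4. *)
- have : 4 * #|S|%:Z <= sqnorm24 x.
    rewrite -sum_ind /sqnorm24 mulr_sumr; apply: ler_sum => i _; rewrite Ex /ind.
    by case: (i \in S) => /=; nia.
  by move: nx S8'; lia.
- by have [s sP ->] := min2_complete r S8' nx; rewrite map_f // mem_enum.
Qed.

Lemma leech_minimalP x : leech_minimal x <-> x \in minvecs.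
Proof.
have [v vP] : exists v, v \in minvecs.
  exists (min3 (ord0, set0)); rewrite !mem_cat map_f ?orbT // mem_enum.
  by apply/par3P; exact: golay_set0.
have [Lv v32] := minvecs_leech vP.
have neq0 y : sqnorm24 y = 32 -> y != 0.
  by apply: contra_eq_neq => ->; rewrite /sqnorm24 big1 // => i _; rewrite mxE.
split=> [[Lx [x0 xmin]]|xP].
  by apply: minvecs_complete => //; rewrite -v32; apply: xmin => //; exact: neq0.
have [Lx x32] := minvecs_leech xP; split => //; split; first exact: neq0.
move=> z Lz z0; rewrite x32 leNgt; apply/negP => z32.
have [_ E] := minvecs_leech (minvecs_complete Lz z0 (ltW z32)).
by rewrite E in z32.
Qed.
End Leech.

(** * Moments and inner product distribution of the Leech minimal vectors *)

Lemma sum_by_values (V : nmodType) (T : Type) (U : eqType) (s : seq T) (g : T -> U) (vals : seq U)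
    (F : U -> V) :
  uniq vals -> all (fun x => g x \in vals) s ->
  \sum_(x <- s) F (g x) = \sum_(t <- vals) F t *+ count (fun x => g x == t) s.
Proof.
move=> uv; elim: s => [_|x s IH /= /andP[gx /IH {}IH]].
  by rewrite big_nil big1.
rewrite big_cons IH [in RHS](eq_bigr (fun t => (if g x == t then F t else 0) +
    F t *+ count (fun x => g x == t) s)); last first.
  by move=> t _; rewrite mulrnDr; case: eqP.
rewrite big_split /= -big_mkcond /=; congr (_ + _).
rewrite -big_filter (_ : filter _ _ = [:: g x]) ?big_seq1 //.
rewrite -(filter_pred1_uniq uv gx); apply: eq_filter => t /=; exact: eq_sym.
Qed.

(** Toggling the membership of [o] exchanges the even and the odd subsets of [O]. *)
Lemma card_even_subsets (T : finType) (O : {set T}) (o : T) : o \in O ->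
  (2 * #|[set s : {set T} | (s \subset O) && ~~ odd #|s|]|)%N = (2 ^ #|O|)%N.
Proof.
move=> oO; set A := [set s | _]; pose B := [set s : {set T} | (s \subset O) && odd #|s|].
pose f (s : {set T}) := if o \in s then s :\ o else o |: s.
have fK : involutive f.
  move=> s; rewrite /f; case: (boolP (o \in s)) => os; rewrite !inE eqxx /= ?setD1K //.
  by rewrite setU1K.
have fodd s : odd #|f s| = ~~ odd #|s|.
  rewrite /f; case: (boolP (o \in s)) => os; first by rewrite [in RHS](cardsD1 o) os /= negbK.
  by rewrite cardsU1 os.
have fO (s : {set T}) : s \subset O -> f s \subset O.
  rewrite /f; case: ifP => _ sO; first by rewrite (subset_trans (subsetDl _ _)).
  by rewrite subUset sub1set oO.
have le (P Q : {set {set T}}) : {in P, forall s, f s \in Q} -> (#|P| <= #|Q|)%N.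
  move=> PQ; rewrite -(card_imset (mem P) (inv_inj fK)); apply: subset_leq_card.
  by apply/subsetP => _ /imsetP[s sP ->]; exact: PQ.
have AB : #|A| = #|B|.
  by apply/eqP; rewrite eqn_leq !le // => s; rewrite !inE => /andP[/fO -> so]; rewrite fodd // so.
rewrite mul2n -addnn {2}AB -card_powerset -(cardsID A (powerset O)); congr (_ + _)%N.
  by apply: eq_card => s; rewrite !inE andbA andbb.
by apply: eq_card => s; rewrite !inE; case: (s \subset O); case: (odd _).
Qed.

Section Sums.
Implicit Types (x y v w u : 'rV[int]_24) (S : {set 'I_24}).

Lemma min2_inj : {in par2 &, injective min2}.
Proof.
move=> [O s] [O' s'] /par2P[_ _ /subsetP sO _] /par2P[_ _ /subsetP sO' _] /rowP E.
have H i : (i \in O) = (i \in O') /\ (i \in s) = (i \in s').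
  have := sO i; have := sO' i; have := E i; rewrite !mxE /= /ind.
  by case: (i \in O); case: (i \in O'); case: (i \in s); case: (i \in s') => //= + + /(_ isT).
by congr pair; apply/setP => i; case: (H i).
Qed.

Lemma min3_inj : injective min3.
Proof.
move=> [k S] [k' S'] /rowP E.
have H i : (i \in S) = (i \in S') /\ (i == k) = (i == k').
  have := E i; rewrite !mxE /= /ind.
  by case: (i \in S); case: (i \in S'); case: (i == k); case: (i == k').
congr pair; first by apply/eqP; rewrite -(H k).2.
by apply/setP => i; case: (H i).
Qed.

Lemma min4_inj : {in par4 &, injective min4}.
Proof.
move=> [[j k] [a b]] [[j' k'] [a' b']]; rewrite !inE /= => jk jk' /rowP E.
have nz (c : bool) : 4 * (-1) ^+ c != 0 :> int by case: c.
have kj : (k == j) = false by apply/eqP => e; move: jk; rewrite e ltnn.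
have kj' : (k' == j') = false by apply/eqP => e; move: jk'; rewrite e ltnn.
have Ej := E j; have Ek := E k; rewrite !mxE /= !eqxx (eq_sym j k) kj /= in Ej Ek.
have jin : (j == j') || (j == k').
  by move: Ej; case: (j == j') => //; case: (j == k') => //; case: (a); case: (b); case: (a'); case: (b').
have kin : (k == j') || (k == k').
  by move: Ek; case: (k == j') => //; case: (k == k') => //; case: (a); case: (b); case: (a'); case: (b').
have [jj' kk'] : j = j' /\ k = k'.
  case/orP: jin => /eqP ej; case/orP: kin => /eqP ek //; rewrite ej ek in jk.
  - by rewrite ltnn in jk.
  - by have := ltn_trans jk jk'; rewrite ltnn.
  - by rewrite ltnn in jk.
move: Ej Ek; rewrite jj' kk' !eqxx kj' (eq_sym j') kj' /=.
by case: a {E}; case: a'; case: b; case: b'.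
Qed.

Lemma uniq_minvecs : uniq minvecs.
Proof.
have u2 : uniq (map min2 (enum par2)).
  by rewrite map_inj_in_uniq ?enum_uniq // => p q; rewrite !mem_enum; exact: min2_inj.
have u3 : uniq (map min3 (enum par3)) by rewrite map_inj_uniq ?enum_uniq //; exact: min3_inj.
have u4 : uniq (map min4 (enum par4)).
  by rewrite map_inj_in_uniq ?enum_uniq // => p q; rewrite !mem_enum; exact: min4_inj.
rewrite /minvecs !cat_uniq u2 u3 u4 /= andbT; apply/andP; split; apply/hasPn => x.
  rewrite mem_cat => /orP[] /mapP[p]; rewrite mem_enum => pP ->; apply/negP.
    case/mapP => -[O s] _ /rowP/(_ ord0); rewrite !mxE /= /ind.
    by case: (_ \in _); case: (_ \in _); case: (_ \in _); case: (_ == _).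
  case/mapP => -[O s]; rewrite mem_enum => /par2P[_ O8 _ _] /rowP E.
  have /card_gt0P[i iO] : (0 < #|O|)%N by rewrite O8.
  have := E i; rewrite !mxE /= /ind iO.
  by case: p {pP E} => [[j k] [a b]] /=; case: a; case: b; case: (i == j); case: (i == k); case: (i \in s).
case/mapP => p; rewrite mem_enum => pP ->; apply/negP => /mapP[[k S] _ /rowP/(_ ord0)].
rewrite !mxE /= /ind; case: p {pP} => [[j l] [a b]] /=.
by case: a; case: b; case: (_ == _); case: (_ == _); case: (_ == _); case: (_ \in _).
Qed.

Lemma sum_minvecs (V : nmodType) (F : 'rV[int]_24 -> V) :
  \sum_(v <- minvecs) F v =
  \sum_(p in par2) F (min2 p) + \sum_(p in par3) F (min3 p) + \sum_(p in par4) F (min4 p).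
Proof. by rewrite /minvecs !big_cat /= !big_map !big_enum addrA. Qed.

Definition tens i j k l : int := \sum_(v <- minvecs) v 0 i * v 0 j * (v 0 k * v 0 l).

Lemma flip_minvecs S : golay_set S -> perm_eq minvecs (map (flip S) minvecs).
Proof.
move=> gS; have fi := inv_inj (flipK S).
have fM v : v \in minvecs -> flip S v \in minvecs.
  move=> /minvecs_leech[Lv v32].
  have n32 : sqnorm24 (flip S v) = 32.
    rewrite -v32; apply: eq_bigr => i _; rewrite mxE /ind.
    by case: (i \in S) => /=; ring.
  apply: minvecs_complete; rewrite ?n32 //; first exact: leech_flip.
  by apply: contra_eq_neq n32 => ->; rewrite /sqnorm24 big1 // => i _; rewrite mxE.
apply: uniq_perm; rewrite ?map_inj_uniq ?uniq_minvecs // => v.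
apply/idP/mapP => [vM|[w wM ->]]; last exact: fM.
by exists (flip S v); rewrite ?flipK //; exact: fM.
Qed.

(** Negation on a codeword that meets the list i, j, k, l an odd number of times permutes the
    minimal vectors and changes the sign of every summand. *)
Lemma tens_eq0 i j k l :
  ~~ [|| (i == j) && (k == l), (i == k) && (j == l) | (i == l) && (j == k)] -> tens i j k l = 0.
Proof.
move=> /golay_separate[S gS odd_S].
suff : tens i j k l = - tens i j k l by lia.
rewrite {1}/tens (perm_big _ (flip_minvecs gS)) /= big_map -sumrN.
apply: eq_bigr => v _; rewrite !mxE /ind; move: odd_S.
by case: (i \in S); case: (j \in S); case: (k \in S); case: (l \in S) => //= _; ring.
Qed.

Lemma sum_delta_mul (i : 'I_24) (F : 'I_24 -> int) : \sum_a (i == a)%:R * F a = F i.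
Proof.
rewrite (bigD1 i) //= eqxx mul1r big1 ?addr0 // => a /negPf ai.
by rewrite eq_sym ai mul0r.
Qed.

(* Kept folded: unary naturals of this size are costly to compute with. *)
Definition c1024 : int := 1024.

(** An octad through [i] and [j] contributes 16 for each of its 128 sign choices, that is 2 *
    1024. *)
Lemma tens_diag2 i j : \sum_(p in par2) min2 p 0 i ^+ 2 * min2 p 0 j ^+ 2 =
  c1024 * (2 * (if i == j then 253 else 77)).
Proof.
rewrite (eq_bigl (fun p : {set 'I_24} * {set 'I_24} =>
  (p.1 \in octad_sets) && ((p.2 \subset p.1) && ~~ odd #|p.2|))); last first.
  by move=> p; rewrite inE.
rewrite (eq_bigr (fun p => 16 * (ind p.1 i * ind p.1 j))); last first.
  move=> [O s] /= /andP[_ /andP[/subsetP sO _]]; rewrite !mxE /= /ind.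
  have := sO i; have := sO j.
  by case: (i \in O); case: (j \in O); case: (i \in s); case: (j \in s) => //= H1 H2;
    first [by move: (H1 isT) | by move: (H2 isT)].
rewrite -(pair_big_dep (fun O => O \in octad_sets)
    (fun O (s : {set 'I_24}) => (s \subset O) && ~~ odd #|s|)
    (fun O _ => 16 * (ind O i * ind O j))) /=.
rewrite (eq_bigr (fun O => c1024 * 2 * (ind O i * ind O j))); last first.
  move=> O /octad_setP[_ O8]; have /card_gt0P[o oO] : (0 < #|O|)%N by rewrite O8.
  have := card_even_subsets oO; rewrite O8 sumr_const cardsE /=.
  set n := #|_|; move=> n2; have -> : n = 128%N by lia.
  by rewrite /c1024; ring.
rewrite mulrA -mulr_sumr; congr (_ * _).
rewrite -(fun_if (fun n : nat => n%:Z)) -(card_octad_pair i j) -sum1_card -natz natr_sum.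
rewrite [RHS](eq_bigl (fun O => (O \in octad_sets) && ((i \in O) && (j \in O)))); last first.
  by move=> O; rewrite inE.
by rewrite [RHS]big_mkcondr /=; apply: eq_bigr => O _; rewrite /ind; case: (i \in O); case: (j \in O).
Qed.

(** For each of the 4096 sign patterns, summing over the position of the entry 3 gives 81 + 23 = 104
    if [i = j] and 9 + 9 + 22 = 40 otherwise. *)
Lemma tens_diag3 i j : \sum_(p in par3) min3 p 0 i ^+ 2 * min3 p 0 j ^+ 2 =
  c1024 * (4 * (if i == j then 104 else 40)).
Proof.
rewrite (eq_bigl (fun p : 'I_24 * {set 'I_24} => true && (p.2 \in golay_sets))); last first.
  by move=> p; rewrite !in_set.
rewrite (eq_bigr (fun p => (1 + 8 * (i == p.1)%:R) * (1 + 8 * (j == p.1)%:R))); last first.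
  move=> [k S] _; rewrite !mxE /= /ind.
  by case: (i \in S); case: (j \in S); case: (i == k); case: (j == k).
rewrite -(pair_big_dep xpredT (fun _ S => S \in golay_sets)
    (fun k _ => (1 + 8 * (i == k)%:R) * (1 + 8 * (j == k)%:R))) /=.
under eq_bigr do rewrite sumr_const card_golay_sets.
rewrite sumrMnl -[LHS]mulr_natl (_ : 4096%:R = c1024 * 4); last by rewrite /c1024 -natrM.
rewrite -mulrA; do 2 congr (_ * _).
rewrite (eq_bigr (fun k => 1 + 8 * ((i == k)%:R * 1) + 8 * ((j == k)%:R * 1) +
  64 * ((i == k)%:R * (j == k)%:R))); last by move=> k _; ring.
rewrite !big_split /= sumr_const card_ord -!mulr_sumr !sum_delta_mul eq_sym.
by case: (i == j).
Qed.

(** Squares 16 * 16 and four sign choices give 1024 per pair of positions; 23 pairs contain [i], and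
    one contains two given positions. *)
Lemma tens_diag4 i j : \sum_(p in par4) min4 p 0 i ^+ 2 * min4 p 0 j ^+ 2 =
  c1024 * (if i == j then 23 else 1).
Proof.
rewrite (eq_bigr (fun p : ('I_24 * 'I_24) * (bool * bool) =>
    256 * (((i == p.1.1)%:R + (i == p.1.2)%:R) * ((j == p.1.1)%:R + (j == p.1.2)%:R)))); last first.
  by move=> p pP; rewrite !min4_sqr //; ring.
rewrite (eq_bigl (fun p : ('I_24 * 'I_24) * (bool * bool) => (p.1.1 < p.1.2)%N && true)); last first.
  by move=> p; rewrite inE andbT.
rewrite -(pair_big_dep (fun q : 'I_24 * 'I_24 => (q.1 < q.2)%N) (fun _ _ => true)
  (fun q (c : bool * bool) => 256 * (((i == q.1)%:R + (i == q.2)%:R) * ((j == q.1)%:R + (j == q.2)%:R)))) /=.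
under eq_bigr do rewrite sumr_const card_prod card_bool.
rewrite sumrMnl -mulr_sumr -mulrnAl (_ : 256 *+ _ = c1024); last by rewrite /c1024; ring.
congr (_ * _).
rewrite -(pair_big_dep xpredT (fun a b : 'I_24 => (a < b)%N)
  (fun a b => ((i == a)%:R + (i == b)%:R) * ((j == a)%:R + (j == b)%:R))) /=.
pose lt (a b : 'I_24) : int := (a < b)%N%:R.
transitivity (\sum_a ((i == a)%:R * ((j == a)%:R * \sum_b lt a b)
    + (i == a)%:R * \sum_b (j == b)%:R * lt a b
    + (j == a)%:R * \sum_b (i == b)%:R * lt a b)
    + \sum_b (i == b)%:R * ((j == b)%:R * \sum_a lt a b)).
  under [X in _ = _ + X]eq_bigr do rewrite !mulr_sumr.
  rewrite exchange_big -big_split; apply: eq_bigr => a _ /=.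
  rewrite !mulr_sumr -!big_split big_mkcond; apply: eq_bigr => b _ /=.
  by rewrite /lt; case: ifP => _ /=; ring.
rewrite !big_split /= !sum_delta_mul !(eq_sym j).
have : \sum_b lt i b + \sum_a lt a i = 23.
  rewrite -big_split /= (eq_bigr (fun a => 1 - (i == a)%:R * 1)).
    by rewrite sumrB sum_delta_mul sumr_const card_ord.
  by move=> a _; rewrite /lt -val_eqE /=; case: ltngtP.
by rewrite /lt -val_eqE /=; case: ltngtP => /= ij; lia.
Qed.

(** Off the diagonal 2 * 77 + 4 * 40 + 1 = 315; on it 2 * 253 + 4 * 104 + 23 = 3 * 315. The ratio 3
    is what makes the fourth moment tensor isotropic. *)
Definition tensc : int := c1024 * 315.

Lemma tens_iijj i j : tens i i j j = tensc * (1 + 2 * (i == j)%:R).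
Proof.
rewrite /tens (eq_bigr (fun v => v 0 i ^+ 2 * v 0 j ^+ 2)) // sum_minvecs.
rewrite tens_diag2 tens_diag3 tens_diag4 /tensc; move: c1024 => c.
by case: (i == j); rewrite /=; ring.
Qed.

Lemma tensE i j k l : tens i j k l =
  tensc * ((i == j)%:R * (k == l)%:R + (i == k)%:R * (j == l)%:R + (i == l)%:R * (j == k)%:R).
Proof.
have [/or3P[]|nij] := boolP [|| (i == j) && (k == l), (i == k) && (j == l) | (i == l) && (j == k)].
- by case/andP => /eqP -> /eqP ->; rewrite tens_iijj !eqxx; case: (j == l).
- case/andP => /eqP -> /eqP ->; rewrite (_ : tens k l k l = tens k k l l).
    by rewrite tens_iijj !eqxx (eq_sym l); case: (k == l).
  by apply: eq_bigr => v _; ring.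
- case/andP => /eqP -> /eqP ->; rewrite (_ : tens l k k l = tens k k l l).
    by rewrite tens_iijj !eqxx (eq_sym l); case: (k == l).
  by apply: eq_bigr => v _; ring.
rewrite tens_eq0 //; move: tensc nij => c; rewrite !negb_or !negb_and.
by case: (i == j); case: (k == l); case: (i == k); case: (j == l); case: (i == l); case: (j == k);
  rewrite //= => _; ring.
Qed.

Lemma sum4_minvecs u : \sum_(v <- minvecs) idot u v ^+ 4 = 3 * tensc * sqnorm24 u ^+ 2.
Proof.
have E v : idot u v ^+ 4 = \sum_i \sum_j \sum_k \sum_l
    (u 0 i * u 0 j * (u 0 k * u 0 l)) * (v 0 i * v 0 j * (v 0 k * v 0 l)).
  rewrite (_ : _ ^+ 4 = idot u v * (idot u v * (idot u v * idot u v))); last by ring.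
  rewrite {1}/idot mulr_suml; apply: eq_bigr => i _.
  rewrite {1}/idot mulr_suml mulr_sumr; apply: eq_bigr => j _.
  rewrite {1}/idot mulr_suml !mulr_sumr; apply: eq_bigr => k _.
  by rewrite {1}/idot !mulr_sumr; apply: eq_bigr => l _; ring.
under eq_bigr do rewrite E.
rewrite exchange_big /=; under eq_bigr do rewrite exchange_big /=.
under eq_bigr do under eq_bigr do rewrite exchange_big /=.
under eq_bigr do under eq_bigr do under eq_bigr do rewrite exchange_big /=.
under eq_bigr do under eq_bigr do under eq_bigr do under eq_bigr do rewrite -mulr_sumr -/(tens _ _ _ _) tensE.
move: tensc => c; set q := sqnorm24 u.
have qE : \sum_k u 0 k ^+ 2 = q by [].
have El i j k : \sum_l u 0 i * u 0 j * (u 0 k * u 0 l) * (c * ((i == j)%:R * (k == l)%:R +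
    (i == k)%:R * (j == l)%:R + (i == l)%:R * (j == k)%:R)) =
    (i == j)%:R * (c * u 0 i * u 0 j) * u 0 k ^+ 2 + (i == k)%:R * (c * u 0 i * u 0 j ^+ 2 * u 0 k)
    + (j == k)%:R * (c * u 0 i ^+ 2 * u 0 j * u 0 k).
  rewrite (eq_bigr (fun l => (k == l)%:R * ((i == j)%:R * (c * u 0 i * u 0 j) * u 0 k * u 0 l) +
    (j == l)%:R * ((i == k)%:R * (c * u 0 i * u 0 j * u 0 k * u 0 l)) +
    (i == l)%:R * ((j == k)%:R * (c * u 0 i * u 0 j * u 0 k * u 0 l)))); last first.
    by move=> l _; ring.
  by rewrite !big_split /= !sum_delta_mul; ring.
under eq_bigr do under eq_bigr do under eq_bigr do rewrite El.
have Ek i j : \sum_k ((i == j)%:R * (c * u 0 i * u 0 j) * u 0 k ^+ 2 +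
    (i == k)%:R * (c * u 0 i * u 0 j ^+ 2 * u 0 k) + (j == k)%:R * (c * u 0 i ^+ 2 * u 0 j * u 0 k)) =
    (i == j)%:R * (c * u 0 i * u 0 j * q) + 2 * c * u 0 i ^+ 2 * u 0 j ^+ 2.
  by rewrite !big_split /= !sum_delta_mul -mulr_sumr qE; ring.
under eq_bigr do under eq_bigr do rewrite Ek.
have Ej i : \sum_j ((i == j)%:R * (c * u 0 i * u 0 j * q) + 2 * c * u 0 i ^+ 2 * u 0 j ^+ 2) =
    3 * c * q * u 0 i ^+ 2.
  by rewrite big_split /= sum_delta_mul -mulr_sumr qE; ring.
under eq_bigr do rewrite Ej.
by rewrite -mulr_sumr qE; ring.
Qed.

(** Writing 32 as the squared norm of [v] turns the second moment into a trace of [tens], which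
    brings the factor 24 + 2 = 26. *)
Lemma sum2_minvecs u : \sum_(v <- minvecs) idot u v ^+ 2 = 32 * (26 * 315) * sqnorm24 u.
Proof.
suff : \sum_(v <- minvecs) 32 * idot u v ^+ 2 = 26 * tensc * sqnorm24 u.
  by rewrite -mulr_sumr; rewrite /tensc /c1024; move: (\sum_(v <- _) _) => s; lia.
have E v : v \in minvecs -> 32 * idot u v ^+ 2 =
    \sum_i \sum_j \sum_k (u 0 i * u 0 j) * (v 0 i * v 0 j * (v 0 k * v 0 k)).
  case/minvecs_leech => _ <-; rewrite /sqnorm24 mulrC expr2 {1}/idot !mulr_suml.
  apply: eq_bigr => i _; rewrite {1}/idot mulr_sumr !mulr_suml; apply: eq_bigr => j _.
  by rewrite mulr_sumr; apply: eq_bigr => k _; ring.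
rewrite (eq_big_seq _ E) exchange_big /=; under eq_bigr do rewrite exchange_big /=.
under eq_bigr do under eq_bigr do rewrite exchange_big /=.
under eq_bigr do under eq_bigr do under eq_bigr do rewrite -mulr_sumr -/(tens _ _ _ _) tensE.
move: tensc => c.
have Ek i j : \sum_k u 0 i * u 0 j * (c * ((i == j)%:R * (k == k)%:R + (i == k)%:R * (j == k)%:R
    + (i == k)%:R * (j == k)%:R)) = (i == j)%:R * (26 * c * u 0 i * u 0 j).
  rewrite (eq_bigr (fun k => (i == j)%:R * (c * u 0 i * u 0 j) +
    (i == k)%:R * ((j == k)%:R * (2 * c * u 0 i * u 0 j)))).
    by rewrite big_split /= sum_delta_mul sumr_const card_ord (eq_sym j); ring.
  by move=> k _; rewrite eqxx /=; ring.
under eq_bigr do under eq_bigr do rewrite Ek.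
under eq_bigr do rewrite sum_delta_mul.
by rewrite /sqnorm24 mulr_sumr; apply: eq_bigr => i _; ring.
Qed.

(** The full trace of [tens] counts every vector with weight 32 * 32. *)
Lemma size_minvecs : (size minvecs)%:R = 24 * (26 * 315) :> int.
Proof.
suff : \sum_(v <- minvecs) c1024 = 624 * tensc :> int.
  rewrite big_const_seq count_predT iter_addr_0 -[LHS]mulr_natr /tensc /c1024.
  by move: ((size minvecs)%:R : int) => s; lia.
have E v : v \in minvecs -> c1024 = \sum_i \sum_j (v 0 i * v 0 i * (v 0 j * v 0 j)).
  case/minvecs_leech => _ v32; rewrite (_ : c1024 = 32 * 32) // -{1}v32 /sqnorm24 mulr_suml.
  apply: eq_bigr => i _; rewrite -v32 /sqnorm24 mulr_sumr; apply: eq_bigr => j _; ring.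
rewrite (eq_big_seq _ E) exchange_big /=; under eq_bigr do rewrite exchange_big /=.
under eq_bigr do under eq_bigr do rewrite -/(tens _ _ _ _) tens_iijj.
move: tensc => c.
have Ej (i : 'I_24) : \sum_j c * (1 + 2 * (i == j)%:R) = 26 * c.
  rewrite (eq_bigr (fun j => c + (i == j)%:R * (2 * c))); last by move=> j _; ring.
  by rewrite big_split /= sum_delta_mul sumr_const card_ord; ring.
by under eq_bigr do rewrite Ej; rewrite sumr_const card_ord; ring.
Qed.
Lemma leech_norm_ge x : leech x -> x != 0 -> 32 <= sqnorm24 x.
Proof.
move=> Lx x0; rewrite leNgt; apply/negP => x32.
have [_ E] := minvecs_leech (minvecs_complete Lx x0 (ltW x32)).
by rewrite E in x32.
Qed.

Lemma idotNr x y : idot x (- y) = - idot x y.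
Proof. by rewrite /idot -sumrN; apply: eq_bigr => i _; rewrite mxE mulrN. Qed.

Lemma sqnormN x : sqnorm24 (- x) = sqnorm24 x.
Proof. by apply: eq_bigr => i _; rewrite mxE sqrrN. Qed.

Lemma minvecsN v : v \in minvecs -> - v \in minvecs.
Proof.
move=> /minvecs_leech[Lv v32]; apply: minvecs_complete; first exact: leechN.
  rewrite oppr_eq0; apply: contra_eq_neq v32 => ->.
  by rewrite /sqnorm24 big1 // => i _; rewrite mxE.
by rewrite sqnormN v32.
Qed.

(* Two distinct vectors are at squared distance at least 32. *)
Lemma idot_le x v : leech x -> v \in minvecs -> x != v -> 2 * idot x v <= sqnorm24 x.
Proof.
move=> Lx /minvecs_leech[Lv v32] xv; rewrite -subr_eq0 in xv.
by have := leech_norm_ge (leechB Lx Lv) xv; rewrite sqnormB v32; lia.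
Qed.

(* Inner products of lattice vectors are multiples of 8. *)
Definition q8 u v : int := (idot u v %/ 8)%Z ^+ 2.

(** With inner product 8k, [idot_le] applied to [v] and to [- v] leaves only |k| <= 2 unless [v] is
    [u] or [- u], where |k| = 4. *)
Lemma q8_min u v : u \in minvecs -> v \in minvecs ->
  q8 u v \in [:: 0; 1; 4; 16] /\ (q8 u v == 16) = (v \in [:: u; - u]).
Proof.
move=> uM vM; have [Lu u32] := minvecs_leech uM; have [Lv v32] := minvecs_leech vM.
have [k E] := idot_leech Lu Lv; rewrite /q8 E mulrC mulzK // !inE.
have uu : idot u u = 32 by rewrite -u32; apply: eq_bigr => i _; rewrite expr2.
have [uv|uv] := eqVneq v u; first by have -> : k = 4 by move: E; rewrite uv uu; lia.
have [uNv|uNv] := eqVneq v (- u).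
  by have -> : k = - 4 by move: E; rewrite uNv idotNr uu; lia.
have k2 : k <= 2.
  by have := idot_le Lu vM _; rewrite eq_sym uv E u32 => /(_ isT); lia.
have k2' : - 2 <= k.
  have := idot_le Lu (minvecsN vM) _; rewrite -eqr_oppLR eq_sym uNv idotNr E u32.
  by move=> /(_ isT); lia.
have [->|[->|[->|[->|->]]]] : k = -2 \/ k = -1 \/ k = 0 \/ k = 1 \/ k = 2 by lia.
all: by [].
Qed.

Lemma q8_sqr u v : leech u -> v \in minvecs -> idot u v ^+ 2 = 64 * q8 u v.
Proof.
move=> Lu /minvecs_leech[Lv _]; have [k E] := idot_leech Lu Lv.
by rewrite /q8 E mulrC mulzK //; ring.
Qed.

Lemma sum_q8 u : leech u -> 2 * \sum_(v <- minvecs) q8 u v = 26 * 315 * sqnorm24 u.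
Proof.
move=> Lu; have := sum2_minvecs u; rewrite (eq_big_seq _ (fun v => q8_sqr Lu)) -mulr_sumr.
by move: (\sum_(v <- _) _) => s; lia.
Qed.

Lemma sum_q8_sqr u : leech u -> 4 * \sum_(v <- minvecs) q8 u v ^+ 2 = 3 * 315 * sqnorm24 u ^+ 2.
Proof.
move=> Lu; have := sum4_minvecs u; rewrite /tensc /c1024.
rewrite (eq_big_seq (fun v => 4096 * q8 u v ^+ 2)) -?mulr_sumr; last first.
  move=> v vM; have -> : idot u v ^+ 4 = (idot u v ^+ 2) ^+ 2 by ring.
  by rewrite (q8_sqr Lu vM); ring.
by move: (\sum_(v <- _) _) (sqnorm24 u ^+ 2) => s t; lia.
Qed.

(** [n 16] counts [u] and [- u]; the moments of degree 0, 2 and 4 are three linear equations for the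
    other three counts. The values are kept factored so that numerals stay small. *)
Lemma q8_count u : u \in minvecs -> let n t := (count (fun v => q8 u v == t) minvecs)%:R : int in
  [/\ n 0 = 450 * 207, n 1 = 64 * 64 * 23, n 4 = 92 * 100 & n 16 = 2].
Proof.
move=> uM n; have [Lu u32] := minvecs_leech uM.
have vals : all (fun v => q8 u v \in [:: 0; 1; 4; 16]) minvecs.
  by apply/allP => v vM; case: (q8_min uM vM).
have n16 : n 16 = 2.
  rewrite /n (_ : count _ _ = 2%N) //.
  rewrite (eq_in_count (a2 := fun v => v \in [:: u; - u])); last first.
    by move=> v vM; case: (q8_min uM vM).
  have un : u != - u.
    apply/eqP => uN; have : sqnorm24 (u + u) = 0.
      by rewrite {2}uN subrr /sqnorm24 big1 // => i _; rewrite mxE.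
    rewrite sqnormD u32; have -> : idot u u = 32 by rewrite -u32; apply: eq_bigr => i _; rewrite expr2.
    by [].
  rewrite (eq_count (a2 := predU (pred1 u) (pred1 (- u)))); last by move=> v; rewrite !inE.
  have := count_predUI (pred1 u) (pred1 (- u)) minvecs.
  rewrite !count_uniq_mem ?uniq_minvecs // uM minvecsN // (@eq_count _ (predI _ _) pred0) ?count_pred0.
    by rewrite addn0 => ->.
  by move=> v /=; apply/negbTE/negP => /andP[/eqP -> /eqP /eqP]; rewrite (negPf un).
have H (F : int -> int) : \sum_(v <- minvecs) F (q8 u v) =
    F 0 * n 0 + F 1 * n 1 + F 4 * n 4 + F 16 * n 16.
  rewrite (sum_by_values _ _ vals); last by [].
  by rewrite !big_cons big_nil addr0 !addrA /n !mulr_natr.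
have h0 := H (fun=> 1); have h1 := H id; have h2 := H (fun t => t ^+ 2).
have s1 := sum_q8 Lu; have s2 := sum_q8_sqr Lu; have s0 := size_minvecs.
rewrite big_const_seq count_predT iter_addr_0 in h0.
rewrite h1 u32 /= in s1; rewrite h2 u32 /= in s2; rewrite h0 /= in s0.
move: (n 0) (n 1) (n 4) (n 16) n16 s0 s1 s2 => a b c d -> s0 s1 s2.
by split; lia.
Qed.
End Sums.

From mathcomp Require Import all_classical all_reals all_analysis.
Import numFieldNormedType.Exports.

(** * Interpolation *)

Section Interpolation.
Variable R : realFieldType.
Implicit Types (nodes U W : seq R) (F Q H : {poly R}).

Definition poly_nneg F := forall i, 0 <= F`_i.

Lemma poly_nneg_horner F s : poly_nneg F -> 0 <= s -> 0 <= F.[s].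
Proof.
by move=> F0 s0; rewrite horner_coef sumr_ge0 // => i _; rewrite mulr_ge0 ?exprn_ge0.
Qed.

(** Synthetic division: the coefficients of the quotient are the partial values of Horner's scheme
    at [a]. *)
Lemma div_XsubC_nneg F a : 0 <= a -> poly_nneg F ->
  exists2 Q, poly_nneg Q & F = ('X - a%:P) * Q + F.[a]%:P.
Proof.
move=> a0; elim/poly_ind: F => [|F c IH] Fc.
  by exists 0; [move=> i; rewrite coef0 | rewrite horner0 mulr0 addr0].
have F0 : poly_nneg F.
  by move=> i; have := Fc i.+1; rewrite coefD coefMX coefC addr0.
have [Q Q0 FE] := IH F0.
exists ('X * Q + F.[a]%:P).
  move=> i; rewrite coefD coefXM coefC.
  by case: i => [|i] /=; rewrite ?add0r ?addr0 // poly_nneg_horner.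
by rewrite hornerMXaddC {1}FE polyCD polyCM; ring.
Qed.

(* Newton's interpolation formula: for nonnegative nodes, all divided differences of a
   polynomial with nonnegative coefficients are nonnegative. *)
Lemma newton_nneg nodes F : {in nodes, forall a, 0 <= a} -> poly_nneg F ->
  exists Q H, [/\ F = \prod_(a <- nodes) ('X - a%:P) * Q + H, poly_nneg Q,
    (size H <= size nodes)%N & 0 <= H`_(size nodes).-1].
Proof.
elim: nodes F => [|a s IH] F n0 F0.
  by exists F, 0; split; rewrite ?size_poly0 ?coef0 // big_nil mul1r addr0.
have a0 : 0 <= a by apply: n0; rewrite mem_head.
have [G G0 FE] := div_XsubC_nneg a0 F0.
have [|Q [H [GE Q0 sH H0]]] := IH G _ G0.
  by move=> b bs; apply: n0; rewrite inE bs orbT.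
exists Q, (('X - a%:P) * H + F.[a]%:P); split => //.
- by rewrite {1}FE {1}GE big_cons; ring.
- rewrite (leq_trans (size_polyD _ _)) // geq_max (leq_trans (size_polyC_leq1 _)) // andbT.
  by rewrite (leq_trans (size_polyMleq _ _)) // size_XsubC.
- rewrite /= coefD coefC mulrBl coefB coefXM coefCM.
  have /leq_sizeP/(_ _ (leqnn _)) -> := sH; rewrite mulr0 subr0.
  by case: s sH H0 {GE IH n0} => [|b s] sH H0 /=; rewrite ?add0r ?addr0 // poly_nneg_horner.
Qed.

(** [U] and [W] stand for the inner products with the code at an arbitrary point and at the claimed
    minimizer. *)
Lemma interpolation_le nodes U W a :
  {in nodes, forall s, 0 <= s} ->
  (forall s, 0 <= s <= 1 -> 0 <= (\prod_(b <- nodes) ('X - b%:P)).[s]) ->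
  {in U, forall u, -1 <= u <= 1} ->
  {in W, forall w, w ^+ 2 \in nodes} ->
  (forall j, (j.+1 < size nodes)%N ->
     \sum_(u <- U) (u ^+ 2) ^+ j = \sum_(w <- W) (w ^+ 2) ^+ j) ->
  \sum_(u <- U) ((u ^+ 2) ^+ size nodes - a * (u ^+ 2) ^+ (size nodes).-1) =
  \sum_(w <- W) ((w ^+ 2) ^+ size nodes - a * (w ^+ 2) ^+ (size nodes).-1) ->
  (0 < size nodes)%N -> \sum_(s <- nodes) s < a ->
  forall F, poly_nneg F -> \sum_(w <- W) F.[w ^+ 2] <= \sum_(u <- U) F.[u ^+ 2].
Proof.
move=> n0 p0 U1 Wn mom top d0 sa F F0.
set p := \prod_(b <- nodes) _ in p0; set d := size nodes in mom top d0.
pose D G := \sum_(u <- U) G.[u ^+ 2] - \sum_(w <- W) G.[w ^+ 2] : R.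
have DD G1 G2 : D (G1 + G2) = D G1 + D G2.
  rewrite /D; under eq_bigr do rewrite hornerD.
  by under [X in _ - X]eq_bigr do rewrite hornerD; rewrite !big_split /=; ring.
have DZ c G : D (c *: G) = c * D G.
  rewrite /D; under eq_bigr do rewrite hornerZ.
  by under [X in _ - X]eq_bigr do rewrite hornerZ; rewrite -!mulr_sumr; ring.
have Dsum m (G : nat -> {poly R}) : D (\sum_(i < m) G i) = \sum_(i < m) D (G i).
  by apply: big_morph => //; rewrite /D !big1 ?subrr // => i _; rewrite horner0.
have DXn j : D 'X^j = \sum_(u <- U) (u ^+ 2) ^+ j - \sum_(w <- W) (w ^+ 2) ^+ j.
  by rewrite /D; under eq_bigr do rewrite hornerXn;
     under [X in _ - X]eq_bigr do rewrite hornerXn.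
have Dlow (G : {poly R}) : (size G <= d)%N -> D G = G`_d.-1 * D 'X^(d.-1).
  move=> sG; have -> : G = \sum_(i < d) G`_i *: 'X^i.
    by rewrite -poly_def; apply/polyP => i; rewrite coef_poly; case: ltnP => // di;
       rewrite nth_default // (leq_trans sG).
  rewrite (Dsum d (fun i => G`_i *: 'X^i)) -poly_def coef_poly prednK // leqnn.
  rewrite -(prednK d0) big_ord_recr /= DZ big1 ?add0r // => i _.
  by rewrite DZ DXn mom ?subrr ?mulr0 //; have := ltn_ord i; lia.
(* [p] vanishes at the squares from [W] and is nonnegative at those from [U]. *)
have pD Q : poly_nneg Q -> 0 <= D (p * Q).
  move=> Q0; rewrite /D [X in _ - X]big1_seq ?subr0 => [|w /andP[_ wW]]; last first.
    rewrite hornerM; have /rootP -> : root p (w ^+ 2) by rewrite root_prod_XsubC Wn.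
    by rewrite mul0r.
  rewrite big_seq sumr_ge0 // => u /U1 u1; rewrite hornerM mulr_ge0 //; last first.
    by rewrite poly_nneg_horner // sqr_ge0.
  by apply: p0; rewrite sqr_ge0 /=; nra.
have Dtop : D 'X^d = a * D 'X^(d.-1).
  rewrite !DXn mulrBr !mulr_sumr; move: top; rewrite !sumrB; lra.
(* The coefficient of [p] below the leading one is minus the sum of the nodes, so by [Dtop] the
   value [D p], nonnegative by [pD], is a positive multiple of [D 'X^(d.-1)]. *)
have D0 : 0 <= D 'X^(d.-1).
  have := pD 1; rewrite mulr1; set pd := D p.
  have -> : pd = (a - \sum_(s <- nodes) s) * D 'X^(d.-1).
    rewrite /pd; have -> : p = 'X^d + (p - 'X^d) by rewrite addrC subrK.
    rewrite DD Dtop (Dlow (p - 'X^d)).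
      rewrite coefB coefXn ltn_eqF ?prednK // subr0 /p.
      by rewrite coefPn_prod_XsubC -/d // -?lt0n //; ring.
    apply/leq_sizeP => j dj; rewrite coefB coefXn; move: dj; rewrite leq_eqVlt.
    case/predU1P => [<-|dj]; last first.
      by rewrite nth_default ?size_prod_XsubC // gtn_eqF ?subrr.
    have := monic_prod_XsubC nodes xpredT id; rewrite monicE lead_coefE size_prod_XsubC -/d /= -/p.
    by move/eqP ->; rewrite eqxx subrr.
  move=> H; rewrite -(pmulr_rge0 _ (_ : 0 < a - \sum_(s <- nodes) s)) ?subr_gt0 //.
  by apply: H => i; rewrite coefC; case: (i) => [|?]; rewrite /= ?ler01.
have [Q [H [FE Q0 sH H0]]] := newton_nneg n0 F0.
rewrite -subr_ge0 -/(D F) FE DD addr_ge0 ?pD // Dlow //.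
by rewrite mulr_ge0.
Qed.
End Interpolation.

(** * Absolutely monotone functions *)

Section AbsolutelyMonotone.
Local Open Scope classical_set_scope.
Local Open Scope ring_scope.
Variable R : realType.
Implicit Types (W F : nat -> R -> R) (p : {poly R}).

(** A function together with all its derivatives, so that differences and rescalings carry theirs
    along. *)
Definition tower W := forall (j : nat) (t : R), t \in `]-1, 1[ -> is_derive t 1 (W j) (W j.+1 t).

Lemma tower_mvt W j a b : tower W -> -1 < a -> a <= b -> b < 1 ->
  exists2 c, a <= c <= b & W j b - W j a = W j.+1 c * (b - a).
Proof.
move=> tW a1 ab b1.
have sub x : x \in `[a, b] -> x \in `]-1, 1[.
  by rewrite !in_itv /= => /andP[ax xb]; apply/andP; split; lra.
have [x xab|  |c cab E] := @MVT_segment _ (W j) (W j.+1) a b ab.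

- apply: tW; apply: sub; exact: (subset_itv_oo_cc xab).
- apply: continuous_in_subspaceT => x /set_mem xab.
  apply: differentiable_continuous; apply/derivable1_diffP.
  by have [] := tW j x (sub _ xab).
- by exists c => //; rewrite in_itv in cab.
Qed.

(** Descent from level k to level 0: each lower level vanishes at 0 and has a nonpositive
    derivative. *)
Lemma tower_le0 W k t : tower W -> (forall j, (j < k)%N -> W j 0 = 0) ->
  (forall x, 0 <= x < 1 -> W k x <= 0) -> 0 <= t < 1 -> W 0 t <= 0.
Proof.
move=> tW W0 Wk t1; have : forall j, (j <= k)%N -> forall x, 0 <= x < 1 -> W (k - j)%N x <= 0.
  elim=> [|j IH] jk x x1; first by rewrite subn0 Wk.
  have [|||c cx] := @tower_mvt W (k - j.+1) 0 x tW; try lra.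
  rewrite (W0 _ _); last by lia.
  have -> : (k - j.+1).+1 = (k - j)%N by lia.
  rewrite !subr0 => ->; have := IH (ltnW jk) c _; nra.
by move=> /(_ k (leqnn k)); rewrite subnn => /(_ t t1).
Qed.

Lemma tower_homo W j a b : tower W -> (forall x, a <= x <= b -> 0 <= W j.+1 x) ->
  -1 < a -> a <= b -> b < 1 -> W j a <= W j b.
Proof.
move=> tW W0 a1 ab b1; have [c cab E] := @tower_mvt W j a b tW a1 ab b1.
by rewrite -subr_ge0 E mulr_ge0 ?W0 // subr_ge0.
Qed.

Lemma towerB V W : tower V -> tower W -> tower (fun j t => V j t - W j t).
Proof.
by move=> tV tW j t t1; apply: is_deriveB; [exact: tV | exact: tW].
Qed.

Lemma tower_horner p : tower (fun j t => p^`(j).[t]).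
Proof. by move=> j t _; rewrite derivnS; apply: is_derive_poly. Qed.

Lemma tower_scale W c : tower W -> -1 <= c <= 1 -> tower (fun j t => c ^+ j * W j (c * t)).
Proof.
move=> tW c1 j t; rewrite in_itv /= => t1.
have ct : c * t \in `]-1, 1[.
  rewrite in_itv /= -!ltr_norml ?normrM in t1 *.
    by have := normr_ge0 t; have := normr_ge0 c; move: c1; rewrite -ler_norml; nra.
have Dc : is_derive t 1 (fun s : R => c * s) c.
  by have := is_deriveZ c (is_derive_id t 1); rewrite /GRing.scale /= mulr1.
have := is_deriveZ (c ^+ j) (is_derive1_comp (tW j _ ct) Dc).
have -> : c ^+ j *: (W j.+1 (c * t) * c) = c ^+ j.+1 * W j.+1 (c * t).
  by rewrite /GRing.scale /= exprS; ring.
by [].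
Qed.

Lemma tower_mul W c : tower W -> tower (fun j t => c * W j t).
Proof. by move=> tW j t t1; exact: (is_deriveZ c (tW j t t1)). Qed.

Section Bernstein.
Variable E : nat -> R -> R.
Hypothesis tE : tower E.
Hypothesis E0 : forall j t, 0 <= t < 1 -> 0 <= E j t.

Definition taylor k : {poly R} := \poly_(j < k) (E j 0 / j`!%:R).

Lemma taylor_derivn k j : (j < k)%N -> ((taylor k)^`(j)).[0] = E j 0.
Proof.
move=> jk; rewrite horner_coef0 coef_derivn addn0 coef_poly jk ffactnn -[LHS]mulr_natr.
by rewrite divfK // pnatr_eq0 -lt0n fact_gt0.
Qed.

Lemma taylor_derivn_eq0 k : (taylor k)^`(k) = 0.
Proof. by apply: derivn_poly0; apply: size_poly. Qed.

Lemma taylor_le k t : 0 <= t < 1 -> (taylor k).[t] <= E 0 t.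
Proof.
move=> t1; rewrite -subr_le0.
have := @tower_le0 (fun j t => (taylor k)^`(j).[t] - E j t) k t.
rewrite derivn0; apply => //.
- by apply: towerB => //; apply: tower_horner.
- by move=> j jk; rewrite taylor_derivn // subrr.
- by move=> x x1; rewrite taylor_derivn_eq0 horner0 sub0r oppr_le0 E0.
Qed.

(* Bernstein: the k-th Taylor remainder r of an absolutely monotone function satisfies
   r (c s) <= c^k r s for 0 <= c <= 1, since the k-th derivative of r (c s) - c^k r s in s
   is nonpositive and the lower ones vanish at 0. *)
Lemma taylor_remainder_le k c s : 0 <= c <= 1 -> 0 <= s < 1 ->
  E 0 (c * s) - (taylor k).[c * s] <= c ^+ k * E 0 s.
Proof.
move=> c1 s1; apply: (@le_trans _ _ (c ^+ k * (E 0 s - (taylor k).[s]))); last first.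
  rewrite ler_wpM2l ?exprn_ge0 ?gerBl ?poly_nneg_horner //; try lra.
  move=> i; rewrite coef_poly; case: ifP => // _; rewrite divr_ge0 ?ler0n // E0 //; lra.
rewrite -subr_le0.
pose V j t := E j t - (taylor k)^`(j).[t].
have tV : tower V by apply: towerB => //; apply: tower_horner.
have c11 : -1 <= c <= 1 by lra.
have := @tower_le0 (fun j t => c ^+ j * V j (c * t) - c ^+ k * V j t) k s.
rewrite /V !derivn0 expr0 mul1r; apply => //.
- by apply: towerB; [exact: tower_scale tV c11 | exact: tower_mul].
- by move=> j jk; rewrite mulr0 taylor_derivn // subrr !mulr0 subrr.
- move=> x x1; rewrite taylor_derivn_eq0 !horner0 !subr0 -mulrBr.
  rewrite mulr_ge0_le0 ?exprn_ge0 //; try lra.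
  rewrite subr_le0; apply: tower_homo => //; try nra.
  by move=> y yx; apply: E0; nra.
Qed.
End Bernstein.

Lemma sum_le_limit (N : R) (q S B : R) : 0 <= q < 1 ->
  (forall K, N <= S + B * q ^+ K) -> N <= S.
Proof.
move=> q1 H.
have cv : (fun K => S + B * q ^+ K) @ \oo --> S.
  rewrite -[X in _ --> X]addr0; apply: cvgD; first exact: cvg_cst.
  by have := @cvg_geometric R B q; apply; rewrite ger0_norm; lra.
apply: ler_cvg_to cv _; first exact: (@cvg_cst _ N).
by apply: nearW.
Qed.

Lemma towerD V W : tower V -> tower W -> tower (fun j t => V j t + W j t).
Proof.
by move=> tV tW j t t1; apply: is_deriveD; [exact: tV | exact: tW].
Qed.

Section EvenPart.
Variable h : R -> \bar R.
Hypothesis hm : absolutely_monotone h.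

Let F j := derive1n j (fun s => fine (h s)).
(** The derivatives of h(t) + h(-t), the part of [h] that an antipodal code sees. *)
Let E j t := F j t + (-1) ^+ j * F j (-1 * t).

Let tF : tower F.
Proof.
move=> j t t1; case: hm => _ _ _ /(_ j t t1) [dF _].
by apply: DeriveDef; [exact: dF | rewrite /F derive1nS derive1E].
Qed.

Let F0 j t : -1 < t < 1 -> 0 <= F j t.
Proof. by move=> t1; case: hm => _ _ _ /(_ j t) []; rewrite ?in_itv. Qed.

Let tE : tower E.
Proof. by apply: towerD => //; apply: tower_scale => //; lra. Qed.

(** For odd [j] this is [F j t - F j (- t)], and [F j] is nondecreasing because [F j.+1] is
    nonnegative. *)
Let E0 j t : 0 <= t < 1 -> 0 <= E j t.
Proof.
move=> t1; rewrite /E -signr_odd; case: (odd j); last first.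
  by rewrite expr0 mul1r addr_ge0 // F0 //; lra.
rewrite expr1 mulN1r subr_ge0; apply: tower_homo => //; try lra.
by move=> x x1; apply: F0; lra.
Qed.

Let Eodd j : odd j -> E j 0 = 0.
Proof. by move=> oj; rewrite /E -signr_odd oj mulr0 expr1 mulN1r subrr. Qed.

Let G K : {poly R} := \poly_(l < K) (E (2 * l) 0 / (2 * l)`!%:R).

Let G_nneg K : poly_nneg (G K).
Proof.
move=> i; rewrite coef_poly; case: ifP => // _.
by rewrite divr_ge0 ?ler0n // E0 // lexx ltr01.
Qed.

Let taylorG K t : (taylor E (2 * K)).[t] = (G K).[t ^+ 2].
Proof.
rewrite /taylor /G !horner_poly; elim: K => [|K IH]; first by rewrite !big_ord0.
rewrite (_ : 2 * K.+1 = (2 * K).+2)%N; last by lia.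
rewrite !big_ord_recr /= IH -/E (Eodd (j := (2 * K).+1)); last first.
  by rewrite /= mul2n odd_double.
by rewrite !mul0r addr0 exprM.
Qed.

Let E_norm t : E 0 `|t| = E 0 t.
Proof. by case: ler0P => _; rewrite /E !expr0 !mul1r !mulN1r ?opprK // addrC. Qed.

Let fineh t : -1 < t < 1 -> h t = (F 0 t)%:E.
Proof.
move=> t1; rewrite /F derive1n0 fineK //; case: hm => _ _ + _; apply.
by rewrite in_itv /=; apply/andP; split; lra.
Qed.

Let G_le_int K t : -1 < t < 1 -> (((G K).[(t ^+ 2)%R])%:E <= h t + h (- t)%R)%E.
Proof.
move=> t1; have t2 : -1 < - t < 1 by lra.
rewrite (fineh t1) (fineh t2) -EFinD lee_fin.
have -> : F 0 t + F 0 (- t) = E 0 `|t| by rewrite E_norm /E expr0 mul1r mulN1r.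
rewrite -real_normK ?num_real // -taylorG; apply: taylor_le => //.
by rewrite normr_ge0 ltr_norml.
Qed.

(** The interior bound passes to the endpoint by continuity. [h 1] may be infinite, but [h (-1)] is
    finite, so the limit of the sum makes sense. *)
Let G_le1 K : (((G K).[1])%:E <= h 1 + h (- 1)%R)%E.
Proof.
have [/subspace_continuousP hc _ hf _] := hm.
have m1 : `[-1, 1]%classic (1 : R) by rewrite /= in_itv /=; apply/andP; split; lra.
have mN1 : `[-1, 1]%classic (-1 : R) by rewrite /= in_itv /=; apply/andP; split; lra.
have near1 : \forall t \near (1 : R)^'-, 0 < t < 1.
  near=> t; apply/andP; split; near: t.
    by apply: nbhs_left_gt; exact: ltr01.
  exact: nbhs_left_lt.
have c1 : h @ (1 : R)^'- --> h 1.
  move=> P /(hc _ m1); rewrite /nbhs /= /within /= => hP.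
  have hQ : \forall t \near (1 : R)^'-, `[-1, 1]%classic t -> P (h t).
    by rewrite near_withinE; apply: filterS hP => s Ps _.
  near=> t.
  have t1 : 0 < t < 1 by near: t.
  have : `[-1, 1]%classic t -> P (h t) by near: t.
  by apply; rewrite /= in_itv /=; apply/andP; split; lra.
have cN1 : (fun t => h (- t)) @ (1 : R)^'- --> h (- 1).
  suff : h @ (- 1 : R)^'+ --> h (- 1) by move/cvg_at_rightNP; rewrite opprK.
  have nearN1 : \forall t \near (- 1 : R)^'+, -1 < t < 0.
    near=> t; apply/andP; split; near: t; first exact: nbhs_right_gt.
    by apply: nbhs_right_lt; lra.
  move=> P /(hc _ mN1); rewrite /nbhs /= /within /= => hP.
  have hQ : \forall t \near (-1 : R)^'+, `[-1, 1]%classic t -> P (h t).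
    by rewrite near_withinE; apply: filterS hP => s Ps _.
  near=> t.
  have t1 : -1 < t < 0 by near: t.
  have : `[-1, 1]%classic t -> P (h t) by near: t.
  by apply; rewrite /= in_itv /=; apply/andP; split; lra.
have hN1 : h (-1) \is a fin_num by apply: hf; rewrite in_itv /=; apply/andP; split; lra.
have cG : (fun t => ((G K).[(t ^+ 2)%R])%:E) @ (1 : R)^'- --> ((G K).[1])%:E.
  apply: cvg_EFin; first by apply: nearW.
  have -> : (G K).[1] = (G K \Po 'X^2).[1] by rewrite horner_comp hornerXn expr1n.
  have -> : (fine \o (fun t => ((G K).[(t ^+ 2)%R])%:E)) = horner (G K \Po 'X^2).
    by apply/funext => t; rewrite /= horner_comp hornerXn.
  by apply: cvg_at_left_filter; apply: continuous_horner.
apply: lee_cvg_to cG (cvgeD _ c1 cN1) _; first by rewrite fin_num_adde_defl.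
near=> t; have t1 : 0 < t < 1 by near: t.
by apply: G_le_int; lra.
Unshelve. all: end_near. Qed.

Let G_le K t : -1 <= t <= 1 -> (((G K).[(t ^+ 2)%R])%:E <= h t + h (- t)%R)%E.
Proof.
move=> /andP[]; rewrite le_eqVlt => /predU1P[<- _|t1].
  by rewrite sqrrN expr1n opprK addeC G_le1.
rewrite le_eqVlt => /predU1P[->|t1']; first by rewrite expr1n G_le1.
by apply: G_le_int; rewrite t1.
Qed.

Lemma absolutely_monotone_sum_le (U W : seq R) :
  {in U, forall u, -1 <= u <= 1} -> {in W, forall w, -1 < w < 1} ->
  perm_eq U [seq - u | u <- U] -> perm_eq W [seq - w | w <- W] ->
  (forall p, poly_nneg p -> \sum_(w <- W) p.[w ^+ 2] <= \sum_(u <- U) p.[u ^+ 2]) ->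
  (\sum_(w <- W) h w <= \sum_(u <- U) h u)%E.
Proof.
move=> U1 W1 sU sW H.
(* Writing |w| = c r, the bound gives c <= r, so the remainder of degree 2K at [w] is at most r^(2K)
   [E 0 r], uniformly over [W]. *)
have [r r1 Wr] : exists2 r, 0 < r < 1 & {in W, forall w, `|w| <= r ^+ 2}.
  have [m m1 Wm] : exists2 m, 0 <= m < 1 & {in W, forall w, `|w| <= m}.
    elim: W W1 {sW H} => [|w W IH] W1; first by exists 0 => //; rewrite lexx ltr01.
    have [|m m1 Wm] := IH; first by move=> x xW; apply: W1; rewrite inE xW orbT.
    have w1 : `|w| < 1 by rewrite ltr_norml W1 ?mem_head.
    exists (Num.max m `|w|); first by rewrite le_max gt_max w1; lra.
    move=> x; rewrite inE le_max => /predU1P[->|/Wm ->]; by rewrite ?lexx ?orbT.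
  (* Its square is at least [m] by the inequality of arithmetic and geometric means. *)
  exists ((1 + m) / 2); first by apply/andP; split; lra.
  by move=> w /Wm wm; apply: le_trans wm _; rewrite expr2; nra.
have h0 u : u \in U -> (0 <= h u)%E.
  by move=> /U1 u1; case: hm => _ + _ _; apply; rewrite in_itv.
have hW : (\sum_(w <- W) h w = (\sum_(w <- W) F 0 w)%:E)%E.
  by rewrite -sumEFin; apply: eq_big_seq => w /W1; exact: fineh.
have EW : \sum_(w <- W) E 0 w = 2 * \sum_(w <- W) F 0 w.
  rewrite /E; under eq_bigr do rewrite expr0 mul1r mulN1r.
  rewrite big_split /= mulr2n mulrDl mul1r; congr (_ + _).
  by rewrite [RHS](perm_big _ sW) /= big_map.
have : (0 <= \sum_(u <- U) h u)%E by rewrite big_seq sume_ge0 // => u /h0.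
case US : (\sum_(u <- U) h u)%E => [S| |//] _; last by rewrite leey.
rewrite hW lee_fin -(ler_pM2l (_ : 0 < 2 :> R)) // -EW.
have GU K : \sum_(u <- U) (G K).[u ^+ 2] <= 2 * S.
  have US' : (\sum_(u <- U) h (- u)%R = S%:E)%E by rewrite -US [RHS](perm_big _ sU) big_map.
  have : (\sum_(u <- U) (h u + h (- u)%R) = (2 * S)%:E)%E.
    by rewrite big_split /= US US' -EFinD; congr EFin; ring.
  rewrite -lee_fin -sumEFin => <-.
  rewrite big_seq [leRHS]big_seq; apply: lee_sum => u /U1 u1.
  exact: G_le.
apply: (@sum_le_limit _ (r ^+ 2) _ ((size W)%:R * E 0 r)); first by nra.
move=> K; apply: le_trans (_ : \sum_(w <- W) ((G K).[w ^+ 2] + E 0 r * (r ^+ 2) ^+ K) <= _).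
  rewrite !(big_seq_cond predT); apply: ler_sum => w /andP[/Wr wr _].
  have c1 : 0 <= `|w| / r <= 1.
    by rewrite divr_ge0 //= ?ler_pdivrMr; nra.
  have r01 : 0 <= r < 1 by lra.
  have := taylor_remainder_le tE E0 (2 * K) c1 r01.
  rewrite divfK ?gt_eqF //; last by lra.
  rewrite E_norm taylorG real_normK ?num_real // lerBlDl => /le_trans -> //.
  rewrite lerD2l mulrC ler_wpM2l ?E0 // exprM; apply: lerXn2r; rewrite ?nnegrE; try nra.
  rewrite lerXn2r ?nnegrE //; try lra.
  by rewrite ler_pdivrMr; nra.
rewrite big_split /= big_const_seq count_predT iter_addr_0 -[_ *+ size W]mulr_natl mulrA.
by rewrite lerD2r; apply: le_trans (GU K); apply: H.
Qed.
End EvenPart.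
End AbsolutelyMonotone.

(** * Polarization of designs *)

Section Polarization.
Local Open Scope classical_set_scope.
Local Open Scope ring_scope.
Variables (R : realType) (n : nat).
Implicit Types (x y : 'rV[R]_n) (C : seq 'rV[R]_n).

Lemma dotC x y : dot x y = dot y x.
Proof. by apply: eq_bigr => i _; rewrite mulrC. Qed.

Lemma dotDl x y z : dot (x + y) z = dot x z + dot y z.
Proof. by rewrite /dot -big_split; apply: eq_bigr => i _; rewrite mxE mulrDl. Qed.

Lemma dotZl c x y : dot (c *: x) y = c * dot x y.
Proof. by rewrite /dot mulr_sumr; apply: eq_bigr => i _; rewrite mxE mulrA. Qed.

Lemma dotNl x y : dot (- x) y = - dot x y.
Proof. by rewrite -scaleN1r dotZl mulN1r. Qed.

Lemma dotNr x y : dot x (- y) = - dot x y.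
Proof. by rewrite dotC dotNl dotC. Qed.

Lemma dotZr c x y : dot x (c *: y) = c * dot x y.
Proof. by rewrite dotC dotZl dotC. Qed.

Lemma dotDr x y z : dot x (y + z) = dot x y + dot x z.
Proof. by rewrite dotC dotDl !(dotC _ x). Qed.

Lemma dot_ge0 x : 0 <= dot x x.
Proof. by rewrite sumr_ge0 // => i _; rewrite -expr2 sqr_ge0. Qed.

Lemma sphere_dot x y : sphere x -> sphere y -> -1 <= dot x y <= 1.
Proof.
move=> xx yy; have := dot_ge0 (x + y); have := dot_ge0 (x - y).
rewrite !(dotDl, dotDr, dotNl, dotNr) xx yy (dotC y x); lra.
Qed.

Definition moment C x i : R := \sum_(y <- C) (dot x y ^+ 2) ^+ i.

Definition antipodal C := forall y, y \in C -> - y \in C.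

Lemma antipodal_perm C : uniq C -> antipodal C -> perm_eq C [seq - y | y <- C].
Proof.
move=> uC aC; apply: uniq_perm => //; first by rewrite map_inj_uniq //; exact: oppr_inj.
move=> y; apply/idP/mapP => [yC|[z zC ->]]; last exact: aC.
by exists (- y); rewrite ?opprK //; exact: aC.
Qed.

(** [e] and [t] express that the lower moments, and one combination of the two top ones, are the
    same at every point of the sphere. *)
Lemma polarization_min (h : R -> \bar R) C (xt : 'rV[R]_n) (nodes : seq R) (a : R) (e : nat -> R) t :
  absolutely_monotone h -> uniq C -> antipodal C ->
  (forall y, y \in C -> sphere y) -> sphere xt ->
  {in nodes, forall s, 0 <= s < 1} -> (0 < size nodes)%N ->
  (forall y, y \in C -> dot xt y ^+ 2 \in nodes) ->
  (forall s, 0 <= s <= 1 -> 0 <= (\prod_(b <- nodes) ('X - b%:P)).[s]) ->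
  \sum_(s <- nodes) s < a ->
  (forall x i, sphere x -> (i.+1 < size nodes)%N -> moment C x i = e i) ->
  (forall x, sphere x -> moment C x (size nodes) - a * moment C x (size nodes).-1 = t) ->
  ereal_inf [set hsum h C x | x in @sphere R n] = hsum h C xt.
Proof.
move=> hm uC aC C1 xt1 n01 d0 Cn p0 sa eq_e eq_t.
have H x : sphere x -> (hsum h C xt <= hsum h C x)%E.
  move=> x1; rewrite /hsum.
  have sym z : perm_eq [seq dot z y | y <- C] [seq - u | u <- [seq dot z y | y <- C]].
    have -> : [seq - u | u <- [seq dot z y | y <- C]] = [seq dot z y | y <- [seq - y | y <- C]].
      by rewrite -!map_comp; apply: eq_map => y /=; rewrite dotNr.
    exact: perm_map (antipodal_perm uC aC).
  have -> : (\sum_(y <- C) h (dot xt y) = \sum_(w <- [seq dot xt y | y <- C]) h w)%E by rewrite big_map.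
  have -> : (\sum_(y <- C) h (dot x y) = \sum_(w <- [seq dot x y | y <- C]) h w)%E by rewrite big_map.
  apply: absolutely_monotone_sum_le => //.
  - by move=> _ /mapP[y yC ->]; apply: sphere_dot => //; exact: C1.
  - by move=> _ /mapP[y yC ->]; have := n01 _ (Cn y yC); nra.
  apply: (interpolation_le (nodes := nodes) (a := a)) => //.
  - by move=> s /n01 /andP[].
  - by move=> _ /mapP[y yC ->]; apply: sphere_dot => //; exact: C1.
  - by move=> _ /mapP[y yC ->]; exact: Cn.
  - move=> j jd; rewrite !big_map; have := eq_e _ j x1 jd.
    by have := eq_e _ j xt1 jd; rewrite /moment => -> ->.
  - rewrite !big_map !sumrB -!mulr_sumr; have := eq_t _ x1; have := eq_t _ xt1.
    by rewrite /moment => -> ->.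
apply/eqP; rewrite eq_le; apply/andP; split.
  by apply: ereal_inf_lbound; exists xt.
by apply: le_ereal_inf_tmp => _ [x x1 <-]; exact: H.
Qed.

(** The ratio of consecutive coefficients that harmonicity of [Fischer.zonalp] forces. *)
Definition gegen_step (K j : nat) : R :=
  - (2 * (K - j) * (2 * (K - j)).-1)%:R / (2 * j.+1 * (n + 2 * j + 2 * (2 * (K - j.+1))))%:R.

(* Coefficients of the monic Gegenbauer polynomial of degree 2K in dimension n. *)
Fixpoint gegen (K j : nat) : R := if j is i.+1 then gegen K i * gegen_step K i else 1.

(** On unit vectors the sums are sums of [Fischer.zonal], so vanishing at the points of [C] itself
    spreads to the whole sphere. *)
Lemma gegen_moment C K x : (0 < n)%N -> (forall y, y \in C -> sphere y) ->
  (forall z, z \in C -> \sum_(j < K.+1) gegen K j * moment C z (K - j) = 0) ->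
  sphere x -> \sum_(j < K.+1) gegen K j * moment C x (K - j) = 0.
Proof.
move=> n0 C1 H x1.
have E z : sphere z -> \sum_(j < K.+1) gegen K j * moment C z (K - j) =
    \sum_(y <- C) Fischer.zonal K (gegen K) (z 0) (y 0).
  move=> z1; rewrite /Fischer.zonal exchange_big /=; apply: eq_bigr => j _.
  rewrite mulr_sumr !big_seq; apply: eq_bigr => y yC.
  rewrite -[Fischer.dotp _ _ in RHS]/(dot z y) -[Fischer.dotp (z 0) (z 0)]/(dot z z).
  rewrite -[Fischer.dotp (y 0) (y 0)]/(dot y y).
  by rewrite z1 C1 // mulr1 expr1n mulr1 exprM.
rewrite E //; apply: (Fischer.zonal_sum_eq0 (g := gegen K)) => //.
  move=> j jK /=; rewrite /gegen_step; set N := (2 * j.+1 * _)%:R.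
  have N0 : N != 0 by rewrite pnatr_eq0 -lt0n !muln_gt0 /=; lia.
  by rewrite mulrA mulrN !mulNr divfK // subrr.
by rewrite big_seq big1 // => y yC; rewrite -E ?H //; exact: C1.
Qed.

Lemma moments_eq C (e : nat -> R) K : (0 < n)%N -> (forall y, y \in C -> sphere y) ->
  (forall z i, z \in C -> moment C z i = e i) ->
  \sum_(j < K.+1) gegen K j * e (K - j)%N = 0 ->
  forall x, sphere x -> \sum_(j < K.+1) gegen K j * moment C x (K - j) = 0.
Proof.
move=> n0 C1 Ce eK x x1; apply: gegen_moment => // z zC; rewrite -[RHS]eK.
by apply: eq_bigr => j _; rewrite Ce.
Qed.

(* A code in which all points see the same distribution [e] of squared inner products is a
   design in the degrees where the Gegenbauer averages of [e] vanish. *)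
Lemma design_moments C (e : nat -> R) m : (0 < n)%N -> (forall y, y \in C -> sphere y) ->
  (forall z i, z \in C -> moment C z i = e i) -> (size C)%:R = e 0%N ->
  (forall K, (0 < K <= m)%N -> \sum_(j < K.+1) gegen K j * e (K - j)%N = 0) ->
  forall x i, sphere x -> (i <= m)%N -> moment C x i = e i.
Proof.
move=> n0 C1 Ce eC eK x i x1; elim/ltn_ind: i => -[|i] IH im.
  by rewrite /moment; under eq_bigr do rewrite expr0; rewrite big_const_seq count_predT iter_addr_0.
have := eK i.+1 im; have := moments_eq n0 C1 Ce (eK i.+1 im) x1.
(* The Gegenbauer polynomial is monic, so its vanishing average expresses the moment in question by
   lower ones. *)
rewrite !(big_ord_recl i.+1) /= !mul1r subn0.
set S1 := \sum_(j < _) _; set S2 := \sum_(j < _) _; suff -> : S1 = S2 by lra.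
apply: eq_bigr => j _; rewrite IH //; rewrite /bump /=; lia.
Qed.

(* The degree 2K harmonics may be missing from the design: then only one combination of the
   two top moments is constant, and this is enough. *)
Lemma polarization_design (h : R -> \bar R) C (e : nat -> R) K (xt : 'rV[R]_n) (nodes : seq R) :
  absolutely_monotone h -> (0 < n)%N -> uniq C -> antipodal C ->
  (forall y, y \in C -> sphere y) ->
  (forall z i, z \in C -> moment C z i = e i) -> (size C)%:R = e 0%N ->
  (forall k, (0 < k <= K)%N || (k == K.+2) -> \sum_(j < k.+1) gegen k j * e (k - j)%N = 0) ->
  sphere xt -> size nodes = K.+2 ->
  {in nodes, forall s, 0 <= s < 1} ->
  (forall y, y \in C -> dot xt y ^+ 2 \in nodes) ->
  (forall s, 0 <= s <= 1 -> 0 <= (\prod_(b <- nodes) ('X - b%:P)).[s]) ->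
  \sum_(s <- nodes) s < - gegen K.+2 1 ->
  ereal_inf [set hsum h C x | x in @sphere R n] = hsum h C xt.
Proof.
move=> hm n0 uC aC C1 Ce eC eK xt1 sn n01 xn p0 sa.
have mom : forall x i, sphere x -> (i <= K)%N -> moment C x i = e i.
  by apply: design_moments => // k kK; apply: eK; rewrite kK.
apply: (polarization_min (nodes := nodes) (a := - gegen K.+2 1) (e := e)
  (t := - \sum_(j < K.+1) gegen K.+2 j.+2 * e (K - j)%N)) => //; rewrite ?sn //.
move=> x x1; have top : \sum_(j < K.+3) gegen K.+2 j * e (K.+2 - j)%N = 0.
  by apply: eK; rewrite eqxx orbT.
have := moments_eq n0 C1 Ce top x1.
rewrite (big_ord_recl K.+2) (big_ord_recl K.+1) /= !mul1r subn0 subn1 /=.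
set S1 := \sum_(j < _) _; set S2 := \sum_(j < _) _.
suff -> : S1 = S2 by rewrite /= => ?; lra.
by apply: eq_bigr => j _; rewrite /bump /= !add1n !subSS mom // leq_subr.
Qed.
End Polarization.

(** * The Leech code *)

(** Evaluates the truncated differences, predecessors, products and sums in the Gegenbauer
    coefficients before [field] or [lra] is called. *)
Ltac eval_nat :=
  repeat match goal with
  | |- context [(?a - ?b)%N] => let c := eval vm_compute in (a - b)%N in change (a - b)%N with c
  | |- context [(?a).-1] => let c := eval vm_compute in (a).-1 in change (a).-1 with c
  | |- context [(?a * ?b)%N] => let c := eval vm_compute in (a * b)%N in change (a * b)%N with c
  | |- context [(?a + ?b)%N] => let c := eval vm_compute in (a + b)%N in change (a + b)%N with c
  end.

Section LeechCode.
Local Open Scope classical_set_scope.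
Local Open Scope ring_scope.
Variable R : realType.

(** The counts of [q8_count], with squared inner products 0, 1/16, 1/4 and 1 after scaling to unit
    length. *)
Definition leech_e (i : nat) : R :=
  450 * 207 * 0 ^+ i + 64 * 64 * 23 * (1 / 16) ^+ i + 92 * 100 * (1 / 4) ^+ i + 2.

(** The harmonic degrees 2, 4, 6, 8, 10 and 14; degree 12 is the gap. *)
Lemma leech_gegen k : (0 < k <= 5)%N || (k == 7)%N ->
  \sum_(j < k.+1) gegen R 24 k j * leech_e (k - j)%N = 0.
Proof.
case: k => [|[|[|[|[|[|[|[|k]]]]]]]] //= _;
  by rewrite !big_ord_recr big_ord0 /= /gegen_step; eval_nat; rewrite /leech_e; field.
Qed.

Definition emb (v : 'rV[int]_24) : 'rV[R]_24 :=
  (Num.sqrt 32)^-1 *: map_mx (fun z : int => z%:~R) v.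

Lemma sqrt_neq0 (k : nat) : (0 < k)%N -> Num.sqrt k%:R != 0 :> R.
Proof. by move=> k0; rewrite sqrtr_eq0 -ltNge ltr0n. Qed.

Lemma dot_map_mx u v : dot (map_mx (fun z : int => z%:~R) u) (map_mx (fun z : int => z%:~R) v)
  = (idot u v)%:~R :> R.
Proof.
rewrite /dot /idot rmorph_sum; apply: eq_bigr => i _.
by rewrite !mxE rmorphM.
Qed.

Lemma dot_emb u v : dot (emb u) (emb v) = (idot u v)%:~R / 32.
Proof.
rewrite dotZl dotZr dot_map_mx mulrA -invfM -expr2 sqr_sqrtr ?ler0n //.
by rewrite mulrC.
Qed.

Lemma emb_inj : injective emb.
Proof.
move=> u v /(scalerI (invr_neq0 (@sqrt_neq0 32 isT))) /rowP E.
by apply/rowP => i; have := E i; rewrite !mxE => /eqP; rewrite eqr_int => /eqP.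
Qed.

Lemma leech_code_perm (C : seq 'rV[R]_24) : uniq C -> (forall y, y \in C <-> leech_code_pt y) ->
  perm_eq C (map emb minvecs).
Proof.
move=> uC CE; apply: uniq_perm => //.
  by rewrite (map_inj_uniq emb_inj) uniq_minvecs.
move=> y; apply/idP/mapP => [/CE[x /leech_minimalP xM ->]|[x xM ->]].
  by exists x => //; rewrite /emb (minvecs_leech xM).2.
apply/CE; exists x; first exact/leech_minimalP.
by rewrite (minvecs_leech xM).2.
Qed.

Lemma dot_emb_sqr u v : leech u -> v \in minvecs -> dot (emb u) (emb v) ^+ 2 = (q8 u v)%:~R / 16.
Proof.
move=> Lu vM; rewrite dot_emb expr_div_n -rmorphXn /= (q8_sqr Lu vM) rmorphM /=.
by field.
Qed.

Lemma moment_emb u i : u \in minvecs ->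
  \sum_(v <- minvecs) (dot (emb u) (emb v) ^+ 2) ^+ i = leech_e i.
Proof.
move=> uM; have [Lu _] := minvecs_leech uM.
rewrite (eq_big_seq (fun v => ((q8 u v)%:~R / 16) ^+ i)); last first.
  by move=> v vM; rewrite dot_emb_sqr.
have vals : all (fun v => q8 u v \in [:: 0; 1; 4; 16]) minvecs.
  by apply/allP => v vM; case: (q8_min uM vM).
rewrite (@sum_by_values _ _ _ _ (q8 u) [:: 0; 1; 4; 16] (fun t => (t%:~R / 16) ^+ i)); last by [].
  2: by [].
rewrite !big_cons big_nil addr0.
have [n0 n1 n4 n16] := q8_count uM.
have H (x : R) t (N : int) : (count (fun v => q8 u v == t) minvecs)%:R = N ->
    x *+ count (fun v => q8 u v == t) minvecs = N%:~R * x.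
  by move=> <-; rewrite -[LHS]mulr_natl; congr (_ * _); rewrite natz.
rewrite (H _ _ _ n0) (H _ _ _ n1) (H _ _ _ n4) (H _ _ _ n16).
rewrite /leech_e !rmorphM /= mul0r (_ : 4%:~R / 16 = 1 / 4 :> R); last by field.
rewrite (_ : 16%:~R / 16 = 1 :> R); last by field.
by rewrite !rmorph_nat rmorph1 expr1n mulr1 -!addrA.
Qed.

Lemma leech_antipodal (C : seq 'rV[R]_24) : perm_eq C (map emb minvecs) -> antipodal C.
Proof.
move=> CE y; rewrite !(perm_mem CE) => /mapP[x xM ->]; apply/mapP; exists (- x).
  exact: minvecsN.
by apply/rowP => i; rewrite !mxE rmorphN mulrN.
Qed.

Lemma emb_sphere v : v \in minvecs -> sphere (emb v).
Proof.
move=> vM; rewrite /sphere /= dot_emb (_ : idot v v = sqnorm24 v).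
  by rewrite (minvecs_leech vM).2 divff // pnatr_eq0.
by apply: eq_bigr => i _; rewrite expr2.
Qed.

(* A lattice vector of squared norm 48, so of type 3 in Conway's terminology. *)
Definition type3 : 'rV[int]_24 := \row_i (1 + 4 * (i == ord0)%:R).

Lemma leech_type3 : leech type3.
Proof.
apply: (@rep_leech _ 1 finset.set0 (fun i : 'I_24 => (i == ord0)%:R)); split; first exact: golay_set0.
  by move=> i; rewrite mxE /ind finset.in_set0 mulr0 addr0.
by exists 0; rewrite sum_delta.
Qed.

Lemma sqnorm_type3 : sqnorm24 type3 = 48.
Proof.
rewrite /sqnorm24 (eq_bigr (fun i : 'I_24 => 1 + 24 * (i == ord0)%:R)); last first.
  by move=> i _; rewrite mxE; case: (i == ord0).
by rewrite big_split -mulr_sumr sum_delta sumr_const card_ord.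
Qed.

(** Twice the inner product is at most the squared norm 48 of [type3], for [v] and for [- v]. *)
Lemma idot_type3 v : v \in minvecs -> exists2 k : int, -3 <= k <= 3 & idot type3 v = 8 * k.
Proof.
move=> vM; have [Lv v32] := minvecs_leech vM; have [k kE] := idot_leech leech_type3 Lv.
have ne w : w \in minvecs -> type3 != w.
  by move=> /minvecs_leech[_ w32]; apply: contra_eq_neq sqnorm_type3 => ->; rewrite w32.
have := idot_le leech_type3 vM (ne _ vM).
have := idot_le leech_type3 (minvecsN vM) (ne _ (minvecsN vM)).
by rewrite idotNr kE sqnorm_type3 => *; exists k => //; apply/andP; split; lia.
Qed.

Definition xtype3 : 'rV[R]_24 := (Num.sqrt 48)^-1 *: map_mx (fun z : int => z%:~R) type3.

Lemma xtype3_sphere : sphere xtype3.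
Proof.
rewrite /sphere /= dotZl dotZr dot_map_mx mulrA -invfM -expr2 sqr_sqrtr ?ler0n //.
rewrite (_ : idot _ _ = sqnorm24 type3); last by apply: eq_bigr => i _; rewrite expr2.
by rewrite sqnorm_type3 mulVf // pnatr_eq0.
Qed.

Lemma dot_xtype3 v : v \in minvecs ->
  dot xtype3 (emb v) \in [seq k%:~R * (Num.sqrt 6 / 12) | k <- [:: -3; -2; -1; 0; 1; 2; 3 : int]].
Proof.
move=> vM; have [k k3 kE] := idot_type3 vM.
rewrite dotZl dotZr dot_map_mx kE; apply/mapP; exists k.
  rewrite !inE; lia.
have s48 : Num.sqrt 48 * Num.sqrt 32 = 16 * Num.sqrt 6 :> R.
  rewrite -sqrtrM ?ler0n // -natrM (_ : 48 * 32 = 16 ^ 2 * 6)%N // natrM natrX.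
  by rewrite sqrtrM ?exprn_ge0 // sqrtr_sqr ger0_norm.
have s6 := @sqrt_neq0 6 isT; have s6' : Num.sqrt 6 ^+ 2 = 6 :> R by rewrite sqr_sqrtr.
rewrite mulrA -invfM s48 rmorphM /=.
apply: (mulfI s6); rewrite [RHS]mulrCA [Num.sqrt 6 * (_ / _)]mulrA -expr2 s6' invfM.
rewrite mulrA [Num.sqrt 6 * _]mulrCA mulfV // mulr1.
by field.
Qed.

Lemma leech_min_attained (h : R -> \bar R) (C : seq 'rV[R]_24) :
  absolutely_monotone h -> uniq C -> (forall y, y \in C <-> leech_code_pt y) ->
  min_attained_with h C
       [:: (- (Num.sqrt 6 / 4), 552%N); (- (Num.sqrt 6 / 6), 11178%N);
           (- (Num.sqrt 6 / 12), 48600%N); (0, 75900%N);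
           (Num.sqrt 6 / 12, 48600%N); (Num.sqrt 6 / 6, 11178%N);
           (Num.sqrt 6 / 4, 552%N)].
Proof.
move=> hm uC CE; have pC := leech_code_perm uC CE.
have aC := leech_antipodal pC.
have C1 y : y \in C -> sphere y by rewrite (perm_mem pC) => /mapP[v vM ->]; exact: emb_sphere.
have Ce z i : z \in C -> moment C z i = leech_e i.
  rewrite (perm_mem pC) => /mapP[u uM ->].
  by rewrite /moment (perm_big _ pC) /= big_map moment_emb.
have sC : (size C)%:R = leech_e 0.
  have z0 : exists z, z \in C.
    have : sphere (emb (min3 (ord0, finset.set0))) /\ emb (min3 (ord0, finset.set0)) \in C.
      split.
        by apply: emb_sphere; rewrite !mem_cat map_f ?orbT // mem_enum; apply/par3P/golay_set0.
      rewrite (perm_mem pC) map_f // !mem_cat map_f ?orbT // mem_enum; apply/par3P/golay_set0.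
    by case=> _ zC; eexists; exact: zC.
  have [z zC] := z0; rewrite -(Ce z 0%N zC) /moment.
  by under eq_bigr do rewrite expr0; rewrite big_const_seq count_predT iter_addr_0.
have [s sE] : exists s : R, s = Num.sqrt 6 / 12 by eexists.
have s2 : s ^+ 2 = 1 / 24.
  by rewrite sE expr_div_n sqr_sqrtr ?ler0n //; field.
have s0 : 0 < s by rewrite sE divr_gt0 ?sqrtr_gt0.
have Cx y : y \in C -> dot xtype3 y \in [seq k%:~R * s | k <- [:: -3; -2; -1; 0; 1; 2; 3 : int]].
  by rewrite (perm_mem pC) sE => /mapP[v vM ->]; exact: dot_xtype3.
(* The squares of k s. Nonzero nodes are doubled, and 0 is simple because the variable is
   nonnegative, so the product is b times a square. *)
pose nodes : seq R := [:: 0; 1 / 24; 1 / 24; 4 / 24; 4 / 24; 9 / 24; 9 / 24].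
have nodes01 : {in nodes, forall b, 0 <= b < 1}.
  by clear => b; rewrite !inE => /or4P[|||/or4P[]] /eqP ->; lra.
have nodes_sum : \sum_(b <- nodes) b < - gegen R 24 7 1.
  by rewrite /nodes !big_cons big_nil /= /gegen_step; eval_nat; clear; lra.
have mom i : (i <= 5)%N -> moment C xtype3 i = leech_e i.
  apply: (design_moments (m := 5)) => //; last exact: xtype3_sphere.
  by move=> K K5; apply: leech_gegen; rewrite K5.
pose n (k : int) := (count (fun y => dot xtype3 y == k%:~R * s) C)%:R : R.
have momn i : (i <= 5)%N -> leech_e i =
    \sum_(k <- [:: -3; -2; -1; 0; 1; 2; 3 : int]) n k * (k%:~R ^+ 2 / 24) ^+ i.
  move=> i5; rewrite -mom // /moment.
  rewrite (@sum_by_values _ _ _ C (dot xtype3) [seq k%:~R * s | k <- [:: -3; -2; -1; 0; 1; 2; 3 : int]]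
    (fun t => (t ^+ 2) ^+ i)).
  - rewrite big_map; apply: eq_bigr => k _.
    by rewrite /n mulr_natl [(k%:~R * s) ^+ 2]exprMn s2 mul1r.
  - rewrite map_inj_uniq // => k l /(mulIf (lt0r_neq0 s0)) /eqP.
    by rewrite eqr_int => /eqP.
  - by apply/allP => y /Cx.
have nN k : n (- k) = n k.
  rewrite /n; congr (_%:R); have /permP -> := antipodal_perm uC aC.
  rewrite count_map; apply: eq_count => y /=.
  by rewrite dotNr rmorphN mulNr eqr_opp.
(* By antipodal symmetry four counts are unknown, and the design moments of degree 0, 2, 4 and 6
   determine them. *)
have := momn 0%N isT; have := momn 1%N isT; have := momn 2%N isT; have := momn 3%N isT.
rewrite !big_cons !big_nil (nN 1) (nN 2) (nN 3) /leech_e.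
rewrite !(rmorphN, rmorph1, rmorph0, rmorph_nat) /=.
move=> e3 e2 e1 e0.
have n0 : n 0 = 759 * 100 by lra.
have n1 : n 1 = 486 * 100 by lra.
have n2 : n 2 = 162 * 69 by lra.
have n3 : n 3 = 552 by lra.
have v3 : Num.sqrt 6 / 4 = 3%:~R * s by rewrite sE; field.
have v2 : Num.sqrt 6 / 6 = 2%:~R * s by rewrite sE; field.
have v1 : Num.sqrt 6 / 12 = 1%:~R * s by rewrite sE mul1r.
have v0 : 0 = 0%:~R * s by rewrite mul0r.
rewrite v1 v2 v3 -!mulNr -!rmorphN /= [X in (X, 75900%N)]v0.
exists xtype3; split; first exact: xtype3_sphere.
- by move=> y /Cx.
- have cnt (k : int) (N : nat) : n k = N%:R -> count (fun y => dot xtype3 y == k%:~R * s) C = N.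
    by move=> nk; apply/eqP; rewrite -(eqr_nat R) -nk.
  move=> vm; rewrite !inE => /or4P[|||/or4P[]] /eqP -> /=; apply: cnt.
  + by rewrite nN n3.
  + by rewrite nN n2 -natrM.
  + by rewrite nN n1 -natrM.
  + by rewrite n0 -natrM.
  + by rewrite n1 -natrM.
  + by rewrite n2 -natrM.
  + by rewrite n3.
apply: (polarization_design (e := leech_e) (K := 5) (nodes := nodes)) => //.
- by move=> k; exact: leech_gegen.
- exact: xtype3_sphere.
- have nodeP (t : R) : [\/ t = 0, t = 1 / 24, t = 4 / 24 | t = 9 / 24] -> t \in nodes.
    by rewrite !inE => -[] ->; rewrite eqxx ?orbT.
  move=> y /Cx /mapP[k + ->]; rewrite exprMn s2 => kv; apply: nodeP; move: kv.
  rewrite !inE => /or4P[|||/or4P[]] /eqP ->; rewrite ?rmorphN /=.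
  + by apply: Or44; field.
  + by apply: Or43; field.
  + by apply: Or42; field.
  + by apply: Or41; field.
  + by apply: Or42; field.
  + by apply: Or43; field.
  + by apply: Or44; field.
- move=> b /andP[b0 _]; rewrite /nodes !big_cons big_nil !hornerM !hornerXsubC hornerC.
  set t := (X in 0 <= X).
  have -> : t = b * ((b - 1 / 24) * (b - 4 / 24) * (b - 9 / 24)) ^+ 2 by rewrite /t; ring.
  by rewrite mulr_ge0 // sqr_ge0.
Qed.
End LeechCode.

(** * The E8 code *)

Fixpoint bitseqs (n : nat) : seq (seq bool) :=
  if n is m.+1 then [seq b :: w | b <- [:: false; true], w <- bitseqs m] else [:: [::]].

Lemma mem_bitseqs n w : (w \in bitseqs n) = (size w == n).
Proof.
elim: n w => [|n IH] [|b w] //=.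
  by apply/negbTE/negP; rewrite mem_cat cats0 => /orP[] /mapP[].
rewrite mem_cat cats0 eqSS -IH; apply/orP/idP => [[] /mapP[v vn [_ ->]]//|wn].
by case: b; [right|left]; rewrite map_f.
Qed.

Definition sgz2 (b : bool) : int := if b then -1 else 1.

Definition e8_odd : seq (seq int) := [seq map sgz2 w | w <- bitseqs 8 & ~~ odd (count id w)].

Definition e8_vec (i j : nat) (a b : bool) : seq int :=
  mkseq (fun k => if k == i then (if a then -2 else 2) else if k == j then (if b then -2 else 2) else 0) 8.

Definition e8_even : seq (seq int) :=
  flatten [seq [seq e8_vec p.1 p.2 a b | a <- [:: false; true], b <- [:: false; true]]
  | p <- [seq p <- [seq (i, j) | i <- iota 0 8, j <- iota 0 8] | (p.1 < p.2)%N]].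

(* The points of the code multiplied by sqrt 8. *)
Definition e8_roots := e8_odd ++ e8_even.

Fixpoint sdot (s t : seq int) : int :=
  match s, t with x :: s', y :: t' => intRing.mulz x y + sdot s' t' | _, _ => 0 end.

Definition e8_check : bool :=
  [&& uniq e8_roots, all (fun s => [&& size s == 8, sdot s s == 8 & map -%R s \in e8_roots]) e8_roots &
   all (fun u => let d := map (sdot u) e8_roots in
     [&& all (fun t : int => t \in [:: 8; -8; 4; -4; 0]%R) d,
         count (pred1 (8 : int)) d == 1, count (pred1 (-8 : int)) d == 1,
         count (pred1 (4 : int)) d == 56, count (pred1 (-4 : int)) d == 56 &
         count (pred1 (0 : int)) d == 126]%N) e8_roots].

Lemma e8_checkE : e8_check = true.
Proof. vm_compute. reflexivity. Qed.

Lemma mem_e8_roots s : (s \in e8_roots) = (s \in e8_odd) || (s \in e8_even).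
Proof. by rewrite mem_cat. Qed.

#[global] Opaque e8_roots.

Lemma uniq_e8_roots : uniq e8_roots.
Proof. by have /and3P[] := e8_checkE. Qed.

Lemma size_e8_root s : s \in e8_roots -> size s = 8%N.
Proof. by have /and3P[_ /allP H _] := e8_checkE; move=> /H /and3P[/eqP]. Qed.

Lemma sdot_e8_root s : s \in e8_roots -> sdot s s = 8.
Proof. by have /and3P[_ /allP H _] := e8_checkE; move=> /H /and3P[_ /eqP]. Qed.

Lemma e8_rootN s : s \in e8_roots -> map -%R s \in e8_roots.
Proof. by have /and3P[_ /allP H _] := e8_checkE; move=> /H /and3P[_ _]. Qed.

Lemma e8_count u : u \in e8_roots -> let n (t : int) := count (fun v => sdot u v == t) e8_roots in
  [/\ all (fun v => sdot u v \in [:: 8; -8; 4; -4; 0]) e8_roots &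
      [/\ n 8 = 1%N, n (-8) = 1%N, n 4 = 56%N, n (-4) = 56%N & n 0 = 126%N]].
Proof.
have /and3P[_ _ /allP H] := e8_checkE.
move=> /H /and4P[]; rewrite !count_map all_map.
by move=> h0 /eqP h1 /eqP h2 /and3P[/eqP h3 /eqP h4 /eqP h5]; split.
Qed.

Section E8Code.
Local Open Scope classical_set_scope.
Local Open Scope ring_scope.
Variable R : realType.

Definition emb8 (s : seq int) : 'rV[R]_8 := \row_i ((nth 0 s i)%:~R / Num.sqrt 8).

Lemma sum_sdot n (s t : seq int) : size s = n -> size t = n ->
  \sum_(i < n) (nth 0 s i)%:~R * (nth 0 t i)%:~R = (sdot s t)%:~R :> R.
Proof.
elim: n s t => [|n IH] [|x s] [|y t] //=; first by rewrite big_ord0.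
by move=> [sn] [tn]; rewrite big_ord_recl /= IH // rmorphD rmorphM.
Qed.

Lemma dot_emb8 s t : s \in e8_roots -> t \in e8_roots ->
  dot (emb8 s) (emb8 t) = (sdot s t)%:~R / 8.
Proof.
move=> /size_e8_root s8 /size_e8_root t8; rewrite -(sum_sdot s8 t8) mulr_suml.
apply: eq_bigr => i _; rewrite !mxE mulrACA -invfM -expr2 sqr_sqrtr //.
Qed.

Lemma emb8_inj : {in e8_roots &, injective emb8}.
Proof.
move=> s t /size_e8_root s8 /size_e8_root t8 /rowP E.
apply: (@eq_from_nth _ 0) => [|i]; rewrite s8 ?t8 // => i8.
have := E (Ordinal i8); rewrite !mxE /= => /(mulIf (invr_neq0 (@sqrt_neq0 R 8 isT))) /eqP.
by rewrite eqr_int => /eqP.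
Qed.

Lemma sqrt8 : Num.sqrt 8 = 2 * Num.sqrt 2 :> R.
Proof.
have -> : 8 = 2 ^+ 2 * 2 :> R by ring.
by rewrite sqrtrM ?sqr_ge0 // sqrtr_sqr ger0_norm.
Qed.

Lemma half_sqrt (z : int) : (2 * z)%:~R / Num.sqrt 8 = z%:~R / Num.sqrt 2 :> R.
Proof.
by rewrite sqrt8 rmorphM /= -mulf_div divff ?mul1r // pnatr_eq0.
Qed.

Lemma emb8_vec (i j : 'I_8) (a b : bool) : emb8 (e8_vec i j a b) =
  \row_k (if k == i then (if a then -1 else 1) / Num.sqrt 2
           else if k == j then (if b then -1 else 1) / Num.sqrt 2 else 0).
Proof.
apply/rowP => k; rewrite !mxE nth_mkseq // -!val_eqE /=.
case: eqP => _; last case: eqP => _; last by rewrite mul0r.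
  by rewrite (_ : (if a then _ else _) = 2 * (if a then -1 else 1)) ?half_sqrt; case: a; rewrite ?rmorphN.
by rewrite (_ : (if b then _ else _) = 2 * (if b then -1 else 1)) ?half_sqrt; case: b; rewrite ?rmorphN.
Qed.

Lemma E8_code_ptP (y : 'rV[R]_8) : E8_code_pt y <-> y \in map emb8 e8_roots.
Proof.
split=> [[[s [s2 ->]]|[i [j [a [b [ij ->]]]]]]|/mapP[t + ->]].
- apply/mapP; exists (map sgz2 (mkseq (fun k => s (inord k)) 8)).
    rewrite mem_e8_roots map_f // mem_filter mem_bitseqs size_mkseq eqxx andbT.
    rewrite -sum1_count big_map -[iota 0 8]/(index_iota 0 8) big_mkord.
    move: s2; rewrite -sum1_card; congr (~~ odd _); apply: eq_big => [i|//].
    by rewrite inord_val; apply/idP/idP => [/set_mem|] // si; exact: mem_set.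
  apply/rowP => i; rewrite !mxE (nth_map false) ?size_mkseq // nth_mkseq // inord_val.
  by case: (s i); rewrite /= ?rmorphN.
- have H (k l : 'I_8) c d : (k < l)%N -> e8_vec k l c d \in e8_roots.
    move=> kl; rewrite mem_e8_roots; apply/orP; right; apply/flattenP.
    exists [seq e8_vec k l a b | a <- [:: false; true], b <- [:: false; true]].
      apply/mapP; exists (k : nat, l : nat) => //; rewrite mem_filter [X in X && _]kl.
      by apply/allpairsP; exists (k : nat, l : nat); rewrite !mem_iota !ltn_ord.
    by case: c; case: d; rewrite !inE eqxx ?orbT.
  have := neq_ltn i j; rewrite ij => /esym/orP[lt|lt].
    by rewrite -emb8_vec map_f // H.
  rewrite (_ : \row_k _ = emb8 (e8_vec j i b a)) ?map_f ?H // emb8_vec.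
  apply/rowP => k; rewrite !mxE; case: (altP (k =P i)) => [->|//].
  by rewrite (negPf ij).
- rewrite mem_e8_roots => /orP[/mapP[w + ->]|/flattenP[_ /mapP[[i j] + ->]]].
    rewrite mem_filter mem_bitseqs => /andP[wo /eqP w8]; left.
    exists (fun i => nth false w i); split.
      move: wo; rewrite -sum1_count (big_nth false) big_mkord w8 -sum1_card.
      by congr (~~ odd _); apply: eq_big => [i|//]; apply/idP/idP => [wi|/set_mem //]; exact: mem_set.
    apply/rowP => i; rewrite !mxE (nth_map false) ?w8 //.
    by case: (nth _ _ _); rewrite /= ?rmorphN.
  rewrite mem_filter => /andP[ij /allpairsP[[i' j']]].
  rewrite !mem_iota => -[i8 j8 [ei ej]]; subst i' j'.
  case/allpairsP => -[a b] /= [_ _ ->]; right.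
  exists (Ordinal i8), (Ordinal j8), a, b; split.
    by rewrite -val_eqE /= neq_ltn ij.
  by rewrite -emb8_vec.
Qed.

Lemma E8_code_perm (C : seq 'rV[R]_8) : uniq C -> (forall y, y \in C <-> E8_code_pt y) ->
  perm_eq C (map emb8 e8_roots).
Proof.
move=> uC CE; apply: uniq_perm => //.
  by rewrite (map_inj_in_uniq emb8_inj) uniq_e8_roots.
by move=> y; apply/idP/idP => [/CE/E8_code_ptP|/E8_code_ptP/CE].
Qed.

Definition e8_e (i : nat) : R := 126 * 0 ^+ i + 112 * (1 / 4) ^+ i + 2.

(** The harmonic degrees 2, 4, 6 and 10; degree 8 is the gap. *)
Lemma e8_gegen k : (0 < k <= 3)%N || (k == 5)%N ->
  \sum_(j < k.+1) gegen R 8 k j * e8_e (k - j)%N = 0.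
Proof.
case: k => [|[|[|[|[|[|k]]]]]] //= _;
  by rewrite !big_ord_recr big_ord0 /= /gegen_step; eval_nat; rewrite /e8_e; field.
Qed.

Lemma moment_emb8 u i : u \in e8_roots ->
  \sum_(v <- e8_roots) (dot (emb8 u) (emb8 v) ^+ 2) ^+ i = e8_e i.
Proof.
move=> uM; rewrite (eq_big_seq (fun v => (((sdot u v)%:~R / 8) ^+ 2) ^+ i)); last first.
  by move=> v vM; rewrite dot_emb8.
have [vals [n8 nN8 n4 nN4 n0]] := e8_count uM.
rewrite (@sum_by_values _ _ _ _ (sdot u) [:: 8; -8; 4; -4; 0] (fun t => ((t%:~R / 8) ^+ 2) ^+ i)) //.
rewrite !big_cons big_nil n8 nN8 n4 nN4 n0 addr0.
have -> : 8%:~R / 8 = 1 :> R by field.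
have -> : (-8)%:~R / 8 = - 1 :> R by rewrite rmorphN; field.
have -> : (4%:~R / 8) ^+ 2 = 1 / 4 :> R by field.
have -> : ((-4)%:~R / 8) ^+ 2 = 1 / 4 :> R by rewrite rmorphN; field.
rewrite mul0r sqrrN !expr1n expr0n /= /e8_e; move: ((1 / 4) ^+ i) (0 ^+ i) => a b.
by ring.
Qed.

Lemma E8_min_attained (h : R -> \bar R) (C : seq 'rV[R]_8) :
  absolutely_monotone h -> uniq C -> (forall y, y \in C <-> E8_code_pt y) ->
  min_attained_with h C
       [:: (- (Num.sqrt 2 / 2), 14%N); (- (Num.sqrt 2 / 4), 64%N); (0, 84%N);
           (Num.sqrt 2 / 4, 64%N); (Num.sqrt 2 / 2, 14%N)].
Proof.
move=> hm uC CE; have pC := E8_code_perm uC CE.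
have [s sE] : exists s : R, s = Num.sqrt 2 / 4 by eexists.
have s2 : s ^+ 2 = 1 / 8.
  by rewrite sE expr_div_n sqr_sqrtr ?ler0n //; field.
have s0 : 0 < s by rewrite sE divr_gt0 ?sqrtr_gt0.
have q0 := @sqrt_neq0 R 2 isT.
have q2 : Num.sqrt 2 * Num.sqrt 2 = 2 :> R by rewrite -expr2 sqr_sqrtr.
have r2 : (Num.sqrt 2)^-1 = 2 * s.
  apply: (mulfI q0); rewrite mulfV // sE; transitivity ((Num.sqrt 2 * Num.sqrt 2) / 2 : R).
    by rewrite q2; field.
  by field.
have r8 : (Num.sqrt 8)^-1 = s by rewrite sqrt8 invfM r2 mulrA mulVf ?mul1r.
have aC : antipodal C.
  move=> y; rewrite !(perm_mem pC) => /mapP[t tM ->]; apply/mapP.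
  exists (map -%R t); first exact: e8_rootN.
  apply/rowP => i; rewrite !mxE (nth_map 0) ?size_e8_root //.
  by rewrite rmorphN mulNr.
have C1 y : y \in C -> sphere y.
  rewrite (perm_mem pC) => /mapP[v vM ->].
  by rewrite /sphere /= dot_emb8 // sdot_e8_root // divff // pnatr_eq0.
have Ce z i : z \in C -> moment C z i = e8_e i.
  rewrite (perm_mem pC) => /mapP[u uM ->].
  by rewrite /moment (perm_big _ pC) /= big_map moment_emb8.
have [z zC] : exists z, z \in C.
  exists (\row_k (if k == ord0 then (if false then -1 else 1) / Num.sqrt 2
                 else if k == ord_max then (if false then -1 else 1) / Num.sqrt 2 else 0)).
  by apply/CE; right; exists ord0, ord_max, false, false.
have sC : (size C)%:R = e8_e 0.
  rewrite -(Ce z 0%N zC) /moment.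
  by under eq_bigr do rewrite expr0; rewrite big_const_seq count_predT iter_addr_0.
(* For a coordinate axis the inner products are first coordinates of code points, hence 0, s, 2s and
   their negatives. *)
pose xt : 'rV[R]_8 := \row_i (i == ord0)%:R.
have xty y : dot xt y = y 0 ord0.
  rewrite /dot (bigD1 ord0) //= mxE eqxx mul1r big1 ?addr0 // => i /negPf i0.
  by rewrite mxE i0 mul0r.
have xt1 : sphere xt by rewrite /sphere /= xty mxE eqxx.
pose ks := [:: -2; -1; 0; 1; 2 : int].
have ksP (k : int) (u : R) : k \in ks -> u = k%:~R * s -> u \in [seq k%:~R * s | k <- ks].
  by move=> kk ->; apply/mapP; exists k.
have Cx y : y \in C -> dot xt y \in [seq k%:~R * s | k <- ks].
  move=> /CE [[t [_ ->]]|[i [j [a [b [_ ->]]]]]]; rewrite xty mxE ?r8 ?r2.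
    by case: (t _); [apply: (ksP (-1)) | apply: (ksP 1)].
  case: ifP => _; first by case: a; [apply: (ksP (-2)) | apply: (ksP 2)]; rewrite //= ?rmorphN; ring.
  case: ifP => _; last by apply: (ksP 0); rewrite ?mul0r.
  by case: b; [apply: (ksP (-2)) | apply: (ksP 2)]; rewrite //= ?rmorphN; ring.
pose nodes : seq R := [:: 0; 1 / 8; 1 / 8; 4 / 8; 4 / 8].
have nodes01 : {in nodes, forall b, 0 <= b < 1}.
  by clear => b; rewrite !inE => /or4P[|||/orP[]] /eqP ->; lra.
have nodes_sum : \sum_(b <- nodes) b < - gegen R 8 5 1.
  by rewrite /nodes !big_cons big_nil /= /gegen_step; eval_nat; clear; lra.
have mom i : (i <= 3)%N -> moment C xt i = e8_e i.
  apply: (design_moments (m := 3)) => //.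
  by move=> K K3; apply: e8_gegen; rewrite K3.
pose n (k : int) := (count (fun y => dot xt y == k%:~R * s) C)%:R : R.
have momn i : (i <= 3)%N -> e8_e i = \sum_(k <- ks) n k * (k%:~R ^+ 2 / 8) ^+ i.
  move=> i3; rewrite -mom // /moment.
  rewrite (@sum_by_values _ _ _ C (dot xt) [seq k%:~R * s | k <- ks] (fun t => (t ^+ 2) ^+ i)).
  - rewrite big_map; apply: eq_bigr => k _.
    by rewrite /n mulr_natl [(k%:~R * s) ^+ 2]exprMn s2 mul1r.
  - rewrite map_inj_uniq // => k l /(mulIf (lt0r_neq0 s0)) /eqP.
    by rewrite eqr_int => /eqP.
  - by apply/allP => y /Cx.
have nN k : n (- k) = n k.
  rewrite /n; congr (_%:R); have /permP -> := antipodal_perm uC aC.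
  rewrite count_map; apply: eq_count => y /=.
  by rewrite dotNr rmorphN mulNr eqr_opp.
(* Three equations for the three counts left by antipodal symmetry. *)
have := momn 0%N isT; have := momn 1%N isT; have := momn 2%N isT.
rewrite /ks !big_cons !big_nil (nN 1) (nN 2) /e8_e.
rewrite !(rmorphN, rmorph1, rmorph0, rmorph_nat) /=.
move=> e2 e1 e0.
have n0 : n 0 = 84 by lra.
have n1 : n 1 = 64 by lra.
have n2 : n 2 = 14 by lra.
have v2 : Num.sqrt 2 / 2 = 2%:~R * s by rewrite sE; field.
have v1 : Num.sqrt 2 / 4 = 1%:~R * s by rewrite sE mul1r.
have v0 : 0 = 0%:~R * s by rewrite mul0r.
rewrite v1 v2 -!mulNr -!rmorphN /= [X in (X, 84%N)]v0.
exists xt; split => //.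
- have cnt (k : int) (N : nat) : n k = N%:R -> count (fun y => dot xt y == k%:~R * s) C = N.
    by move=> nk; apply/eqP; rewrite -(eqr_nat R) -nk.
  move=> vm; rewrite !inE => /or4P[|||/orP[]] /eqP -> /=; apply: cnt.
  + by rewrite nN n2.
  + by rewrite nN n1.
  + by rewrite n0.
  + by rewrite n1.
  + by rewrite n2.
apply: (polarization_design (e := e8_e) (K := 3) (nodes := nodes)) => //.
- by move=> k; exact: e8_gegen.
- have nodeP (t : R) : [\/ t = 0, t = 1 / 8 | t = 4 / 8] -> t \in nodes.
    by rewrite !inE => -[] ->; rewrite eqxx ?orbT.
  move=> y /Cx /mapP[k + ->]; rewrite exprMn s2 => kv; apply: nodeP; move: kv.
  rewrite !inE => /or4P[|||/orP[]] /eqP ->; rewrite ?rmorphN /=.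
  + by apply: Or33; field.
  + by apply: Or32; field.
  + by apply: Or31; field.
  + by apply: Or32; field.
  + by apply: Or33; field.
- move=> b /andP[b0 _]; rewrite /nodes !big_cons big_nil !hornerM !hornerXsubC hornerC.
  set t := (X in 0 <= X).
  have -> : t = b * ((b - 1 / 8) * (b - 4 / 8)) ^+ 2 by rewrite /t; ring.
  by rewrite mulr_ge0 // sqr_ge0.
Qed.
End E8Code.

(** * The icosahedron and the dodecahedron *)

Section Rotation.
Local Open Scope classical_set_scope.
Local Open Scope ring_scope.
Variables (R : realType) (n : nat) (Q : 'M[R]_n).
Hypothesis QQ : Q *m Q^T = 1%:M.

Lemma dot_mulmx (x y : 'rV[R]_n) : dot x (y *m Q) = dot (x *m Q^T) y.
Proof.
have dE (u v : 'rV[R]_n) : dot u v = (u *m v^T) 0 0.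
  by rewrite mxE; apply: eq_bigr => i _; rewrite mxE.
by rewrite !dE trmx_mul mulmxA.
Qed.

Lemma min_attained_rotated (h : R -> \bar R) (std C : seq 'rV[R]_n) vals :
  uniq std -> uniq C -> (forall y, y \in C <-> exists2 v, v \in std & y = v *m Q) ->
  min_attained_with h std vals -> min_attained_with h C vals.
Proof.
move=> us uC CE [xt [xt1 xv xm xinf]].
have QTQ : Q^T *m Q = 1%:M by apply: mulmx1C.
have mQ : injective (mulmxr Q : 'rV[R]_n -> 'rV[R]_n).
  by move=> u v /(congr1 (mulmx^~ Q^T)); rewrite /= -!mulmxA QQ !mulmx1.
have pC : perm_eq C [seq v *m Q | v <- std].
  apply: uniq_perm => //; first by rewrite (map_inj_uniq mQ).
  by move=> y; apply/idP/mapP => /CE.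
have dQ x v : dot (x *m Q) (v *m Q) = dot x v by rewrite dot_mulmx -mulmxA QQ mulmx1.
have hQ x : hsum h C (x *m Q) = hsum h std x.
  by rewrite /hsum (perm_big _ pC) /= big_map; apply: eq_bigr => v _; rewrite dQ.
exists (xt *m Q); split.
- by rewrite /sphere /= dQ.
- by move=> y /CE[v vs ->]; rewrite dQ; exact: xv.
- move=> vm vmv; rewrite -(xm vm vmv); have /permP -> := pC.
  by rewrite count_map; apply: eq_count => v /=; rewrite dQ.
rewrite hQ -xinf; congr ereal_inf; apply/seteqP; split=> _ [x x1 <-].
  exists (x *m Q^T); last by rewrite -hQ -mulmxA QTQ mulmx1.
  by rewrite /sphere /= -dQ -mulmxA QTQ mulmx1.
by exists (x *m Q); rewrite ?hQ // /sphere /= dQ.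
Qed.
End Rotation.

Section Polyhedra.
Local Open Scope classical_set_scope.
Local Open Scope ring_scope.
Variable R : realType.
Local Notation phi := (phi R).

Lemma sqr_sqrt5 : Num.sqrt 5 ^+ 2 = 5 :> R.
Proof. by rewrite sqr_sqrtr. Qed.

Lemma phi_sqr : phi ^+ 2 = phi + 1.
Proof. by have := sqr_sqrt5; rewrite /Defs.phi; move: (Num.sqrt 5) => s; nra. Qed.

Lemma phi_bounds : 161 / 100 < phi < 162 / 100.
Proof.
have := phi_sqr; have : 0 <= phi by rewrite /Defs.phi divr_ge0 ?addr_ge0 ?sqrtr_ge0.
by move: phi => f f0 fE; apply/andP; split; nra.
Qed.

Lemma sqrt5E : Num.sqrt 5 = 2 * phi - 1.
Proof. by rewrite /Defs.phi; field. Qed.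

Lemma phiV : phi^-1 = phi - 1.
Proof.
have f0 : phi != 0 by have := phi_bounds; case: eqP => // ->; lra.
by apply: (mulfI f0); rewrite mulfV // mulrBr -expr2 phi_sqr; ring.
Qed.

Definition a1 : R := Num.sqrt ((1 + 2 / Num.sqrt 5) / 3).
Definition a2 : R := Num.sqrt ((1 - 2 / Num.sqrt 5) / 3).

Lemma inv_sqrt5 : 2 / Num.sqrt 5 = (4 * phi - 2) / 5.
Proof.
have s0 : Num.sqrt 5 != 0 :> R by rewrite sqrtr_eq0 -ltNge.
apply: (mulIf s0); rewrite divfK // sqrt5E; have := phi_sqr; lra.
Qed.

Lemma a1_sqr : a1 ^+ 2 = (4 * phi + 3) / 15.
Proof.
have := phi_bounds; rewrite /a1 inv_sqrt5 => b; rewrite sqr_sqrtr; first by field.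
lra.
Qed.

Lemma a2_sqr : a2 ^+ 2 = (7 - 4 * phi) / 15.
Proof.
have := phi_bounds; rewrite /a2 inv_sqrt5 => b; rewrite sqr_sqrtr; first by field.
lra.
Qed.

Lemma a12 : 0 < a2 < a1.
Proof.
have := phi_bounds => b; apply/andP; split.
  by rewrite /a2 inv_sqrt5 sqrtr_gt0; lra.
rewrite -(ltr_pXn2r (_ : 0 < 2)%N) ?nnegrE ?sqrtr_ge0 // a1_sqr a2_sqr; lra.
Qed.

Lemma dot_vec3 (x : 'rV[R]_3) a b c :
  dot x (vec3 a b c) = x 0 0 * a + x 0 1 * b + x 0 2 * c.
Proof.
by rewrite /dot !big_ord_recr big_ord0 /= !mxE /= add0r; congr (_ + _ + _);
   congr (_ * _); congr (x _ _); apply: val_inj.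
Qed.

(* In dimension 3 the monic Gegenbauer polynomial of degree 8 starts with t^8 - 28/15 t^6. *)
Lemma sphere_min (h : R -> \bar R) C (xt : 'rV[R]_3) e t :
  absolutely_monotone h -> uniq C -> antipodal C ->
  (forall y, y \in C -> sphere y) -> sphere xt ->
  (forall y, y \in C -> dot xt y \in [:: - a1; - a2; a2; a1]) ->
  (forall x i, sphere x -> (i <= 2)%N -> moment C x i = e i) ->
  (forall x, sphere x -> moment C x 4 - 28 / 15 * moment C x 3 = t) ->
  ereal_inf [set hsum h C x | x in @sphere R 3] = hsum h C xt.
Proof.
move=> hm uC aC C1 xt1 xC mom top.
have pb := phi_bounds.
apply: (polarization_min (nodes := [:: a1 ^+ 2; a1 ^+ 2; a2 ^+ 2; a2 ^+ 2]) (a := 28 / 15)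
  (e := e) (t := t)) => //.
- by move=> s; rewrite !inE => /or4P[] /eqP ->; rewrite ?a1_sqr ?a2_sqr; lra.
- move=> y /xC; rewrite !inE => /or4P[] /eqP ->; by rewrite ?sqrrN eqxx ?orbT.
- move=> s _; rewrite !big_cons big_nil !hornerM !hornerXsubC hornerC.
  set u := (X in 0 <= X); have -> : u = ((s - a1 ^+ 2) * (s - a2 ^+ 2)) ^+ 2 by rewrite /u; ring.
  exact: sqr_ge0.
- by rewrite !big_cons big_nil a1_sqr a2_sqr; lra.
Qed.

Definition icosa_raw : seq 'rV[R]_3 :=
  flatten [seq [:: vec3 0 s (t * phi); vec3 s (t * phi) 0; vec3 (t * phi) 0 s]
          | s <- [:: 1; -1], t <- [:: 1; -1]].

Definition ico_c : R := (Num.sqrt (1 + phi ^+ 2))^-1.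

Lemma ico_stdE : icosa_std R = [seq ico_c *: v | v <- icosa_raw].
Proof. by []. Qed.

Lemma ico_c_sqr : ico_c ^+ 2 = (3 - phi) / 5.
Proof.
have f2 := phi_sqr; have fb := phi_bounds.
rewrite exprVn sqr_sqrtr; last by rewrite addr_ge0 ?sqr_ge0.
have n0 : 1 + phi ^+ 2 != 0 by rewrite f2; apply/eqP; lra.
apply: (mulfI n0); rewrite mulfV // f2; move: phi f2 => f f2; nra.
Qed.

(** With an explicit sorting permutation, distinctness of reals needs only the inequalities between
    neighbours. *)
Lemma uniq_sorted_nth (l : seq R) (idx : seq nat) : perm_eq (iota 0 (size l)) idx ->
  sorted <%R [seq nth 0 l i | i <- idx] -> uniq l.
Proof.
move=> pidx /lt_sorted_uniq; rewrite -(perm_uniq (perm_map (nth 0 l) pidx)).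
by rewrite -[map _ _]/(mkseq (nth 0 l) (size l)) mkseq_nth.
Qed.

(* A linear form that separates the vertices. *)
Definition probe (v : 'rV[R]_3) : R := v 0 0 + 10 * v 0 1 + 100 * v 0 2.

Lemma probe_vec3 a b c : probe (vec3 a b c) = a + 10 * b + 100 * c.
Proof. by rewrite /probe !mxE. Qed.

Lemma uniq_icosa : uniq (icosa_std R).
Proof.
rewrite ico_stdE map_inj_uniq; last first.
  apply: scalerI; rewrite -sqrf_eq0 ico_c_sqr; have := phi_bounds => b; apply/eqP; lra.
apply: (@map_uniq _ _ probe).
apply: (@uniq_sorted_nth _ [:: 9; 3; 11; 8; 10; 4; 7; 1; 5; 2; 6; 0]%N) => //.
rewrite /= !probe_vec3; have := phi_bounds; move: phi => f fb.
by do ! (apply/andP; split=> //); lra.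
Qed.

Lemma moment_scaled (c : R) (raw : seq 'rV[R]_3) x i :
  moment [seq c *: v | v <- raw] x i = (c ^+ 2) ^+ i * \sum_(v <- raw) (dot x v ^+ 2) ^+ i.
Proof.
rewrite /moment big_map mulr_sumr; apply: eq_bigr => v _.
by rewrite dotZr -exprMn -exprMn.
Qed.

Lemma sphere3 (x : 'rV[R]_3) : sphere x -> x 0 0 ^+ 2 + x 0 1 ^+ 2 + x 0 2 ^+ 2 = 1.
Proof.
move=> <-; rewrite /dot !big_ord_recr big_ord0 /= add0r -!expr2.
by congr (x _ _ ^+ _ + x _ _ ^+ _ + x _ _ ^+ _); apply: val_inj.
Qed.

(** The moments seen from a vertex: two squared inner products equal 1, ten equal 1/5. *)
Definition ico_e i : R := 2 + 10 * (1 / 5) ^+ i.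

(** Polynomial identities in the coordinates of [x], modulo the equations of the golden ratio and of
    the sphere; the latter is oriented to eliminate [w ^+ 2]. *)
Lemma icosa_moment x : sphere x -> [/\ moment (icosa_std R) x 0 = ico_e 0,
   moment (icosa_std R) x 1 = ico_e 1, moment (icosa_std R) x 2 = ico_e 2 &
   moment (icosa_std R) x 4 - 28 / 15 * moment (icosa_std R) x 3 = ico_e 4 - 28 / 15 * ico_e 3].
Proof.
move=> /sphere3; rewrite ico_stdE !moment_scaled ico_c_sqr /ico_e.
rewrite /icosa_raw /= !big_cons !big_nil !dot_vec3.
have := phi_sqr; move: phi (x 0 0) (x 0 1) (x 0 2) => f u v w f2 r2.
have w2 : w ^+ 2 = 1 - u ^+ 2 - v ^+ 2 by rewrite -r2; ring.
split; by field: f2 w2.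
Qed.

Definition dodeca_raw : seq 'rV[R]_3 :=
  flatten [seq [seq vec3 a b d | d <- [:: 1; -1]] | a <- [:: 1; -1], b <- [:: 1; -1]] ++
  flatten [seq [:: vec3 0 (s / phi) (t * phi); vec3 (s / phi) (t * phi) 0;
                   vec3 (t * phi) 0 (s / phi)]
          | s <- [:: 1; -1], t <- [:: 1; -1]].

Definition dod_c : R := (Num.sqrt 3)^-1.

Lemma dod_stdE : dodeca_std R = [seq dod_c *: v | v <- dodeca_raw].
Proof. by []. Qed.

Lemma dod_c_sqr : dod_c ^+ 2 = 1 / 3.
Proof. by rewrite exprVn sqr_sqrtr // mul1r. Qed.

Lemma uniq_dodeca : uniq (dodeca_std R).
Proof.
rewrite dod_stdE map_inj_uniq; last first.
  by apply: scalerI; rewrite -sqrf_eq0 dod_c_sqr; apply/eqP; lra.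
apply: (@map_uniq _ _ probe).
apply: (@uniq_sorted_nth _
  [:: 17; 11; 7; 3; 5; 1; 19; 16; 18; 12; 15; 9; 13; 10; 6; 2; 4; 0; 14; 8]%N) => //.
rewrite /= !probe_vec3 !phiV; have := phi_bounds; move: phi => f fb.
by do ! (apply/andP; split=> //); lra.
Qed.

(** Again the moments seen from a vertex. *)
Definition dod_e i : R := 2 + 6 * (5 / 9) ^+ i + 12 * (1 / 9) ^+ i.

Lemma dodeca_moment x : sphere x -> [/\ moment (dodeca_std R) x 0 = dod_e 0,
   moment (dodeca_std R) x 1 = dod_e 1, moment (dodeca_std R) x 2 = dod_e 2 &
   moment (dodeca_std R) x 4 - 28 / 15 * moment (dodeca_std R) x 3 = dod_e 4 - 28 / 15 * dod_e 3].
Proof.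
move=> /sphere3; rewrite dod_stdE !moment_scaled dod_c_sqr /dod_e.
rewrite /dodeca_raw /= !big_cons !big_nil !dot_vec3 !phiV.
have := phi_sqr; move: phi (x 0 0) (x 0 1) (x 0 2) => f u v w f2 r2.
have w2 : w ^+ 2 = 1 - u ^+ 2 - v ^+ 2 by rewrite -r2; ring.
split; by field: f2 w2.
Qed.

Lemma vec3N a b c : - vec3 a b c = vec3 (- a) (- b) (- c) :> 'rV[R]_3.
Proof. by apply/rowP => i; rewrite !mxE; case: ifP => // _; case: ifP. Qed.

Lemma antipodal_scaled (c : R) (raw : seq 'rV[R]_3) :
  antipodal raw -> antipodal [seq c *: v | v <- raw].
Proof. by move=> H _ /mapP[v /H vr ->]; rewrite -scalerN map_f. Qed.

Lemma antipodal_signs (f : R -> R -> seq 'rV[R]_3) :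
  (forall s t v, v \in f s t -> - v \in f (- s) (- t)) ->
  antipodal (flatten [seq f s t | s <- [:: 1; -1], t <- [:: 1; -1]]).
Proof.
have signN (s : R) : s \in [:: 1; -1] -> - s \in [:: 1; -1].
  by rewrite !inE => /orP[] /eqP ->; rewrite ?opprK eqxx ?orbT.
move=> fN v /flattenP[_ /allpairsP[[s t] [s1 t1 ->]] vf].
rewrite [_.1]/= in s1 vf; rewrite [_.2]/= in t1 vf.
apply/flattenP; exists (f (- s) (- t)); last exact: fN.
by apply/allpairsP; exists (- s, - t); split; rewrite //= signN.
Qed.

Lemma antipodal_cat (n : nat) (s t : seq 'rV[R]_n) :
  antipodal s -> antipodal t -> antipodal (s ++ t).
Proof. by move=> As At v; rewrite !mem_cat => /orP[/As ->|/At ->]; rewrite ?orbT. Qed.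

Lemma sphere_scaled (c : R) (raw : seq 'rV[R]_3) :
  all (fun v => c ^+ 2 * dot v v == 1) raw -> forall y, y \in [seq c *: v | v <- raw] -> sphere y.
Proof.
move=> /allP H _ /mapP[v /H /eqP vr ->].
by rewrite /sphere /= dotZl dotZr mulrA -expr2.
Qed.

Lemma dot_vec33 a b c : dot (vec3 a b c) (vec3 a b c) = a ^+ 2 + b ^+ 2 + c ^+ 2 :> R.
Proof. by rewrite dot_vec3 !mxE. Qed.

Lemma a12E : a1 = dod_c * ico_c * (phi + 1) /\ a2 = dod_c * ico_c * (phi - 1).
Proof.
have f2 := phi_sqr; have fb := phi_bounds.
have d0 : 0 <= dod_c by rewrite invr_ge0 sqrtr_ge0.
have i0 : 0 <= ico_c by rewrite invr_ge0 sqrtr_ge0.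
split; apply/eqP; rewrite -(eqrXn2 (_ : 0 < 2)%N) ?sqrtr_ge0 ?mulr_ge0 //; try lra; apply/eqP.
  by rewrite a1_sqr !exprMn dod_c_sqr ico_c_sqr; field: f2.
by rewrite a2_sqr !exprMn dod_c_sqr ico_c_sqr; field: f2.
Qed.

Definition aval (p : bool * bool) : R :=
  let a := if p.1 then a1 else a2 in if p.2 then - a else a.

Lemma aval_inj : injective aval.
Proof. by have := a12 => b [[] []] [[] []] //; rewrite /aval /= => E; exfalso; lra. Qed.

(** [ps] encodes the inner products by booleans, so that multiplicities are found by computation and
    not by comparing reals. *)
Lemma polyhedron_min (h : R -> \bar R) (std : seq 'rV[R]_3) xt ps N e :
  absolutely_monotone h -> uniq std -> antipodal std ->
  (forall y, y \in std -> sphere y) -> sphere xt ->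
  [seq dot xt y | y <- std] = map aval ps -> (forall p, count (pred1 p) ps = N) ->
  (forall x, sphere x -> [/\ moment std x 0 = e 0%N, moment std x 1 = e 1%N, moment std x 2 = e 2%N &
     moment std x 4 - 28 / 15 * moment std x 3 = e 4%N - 28 / 15 * e 3%N]) ->
  min_attained_with h std [:: (- a1, N); (- a2, N); (a2, N); (a1, N)].
Proof.
move=> hm us As std1 xt1 D cN mom.
have xD y : y \in std -> dot xt y \in [:: - a1; - a2; a2; a1].
  move=> /(map_f (dot xt)); rewrite D => /mapP[[[] []] _ ->];
    by rewrite !inE /aval /= eqxx ?orbT.
have cnt p : count (fun y => dot xt y == aval p) std = N.
  rewrite -(cN p) -(count_map (dot xt) (pred1 (aval p))) D count_map.
  by apply: eq_count => q /=; rewrite (inj_eq aval_inj).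
exists xt; split => //.
  move=> vm; rewrite !inE => /or4P[] /eqP -> /=.
  - exact: (cnt (true, true)).
  - exact: (cnt (false, true)).
  - exact: (cnt (false, false)).
  - exact: (cnt (true, false)).
apply: (sphere_min (e := e) (t := e 4%N - 28 / 15 * e 3%N)) => //.
  by move=> x [|[|[|i]]] x1 //; case: (mom x x1).
by move=> x /mom[].
Qed.

Lemma icosa_min (h : R -> \bar R) : absolutely_monotone h ->
  min_attained_with h (icosa_std R) [:: (- a1, 3%N); (- a2, 3%N); (a2, 3%N); (a1, 3%N)].
Proof.
move=> hm; have f2 := phi_sqr; have [a1E a2E] := a12E.
(* The direction of the centre of the face whose vertices are proportional to (0, 1, phi), (1, phi,
   0) and (phi, 0, 1). *)
apply: (@polyhedron_min _ _ (dod_c *: vec3 1 1 1) (flatten [seq nseq 3 p | p <-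
  [:: (true, false); (false, true); (false, false); (true, true)]]) _ ico_e) => //.
- exact: uniq_icosa.
- rewrite ico_stdE; apply: antipodal_scaled.
  apply: antipodal_signs => s t v; rewrite !inE => /or3P[] /eqP ->;
    by rewrite vec3N oppr0 mulNr eqxx ?orbT.
- rewrite ico_stdE; apply: sphere_scaled; rewrite /icosa_raw /= !dot_vec33 ico_c_sqr.
  by do ! (apply/andP; split=> //); apply/eqP; field: f2.
- by rewrite /sphere /= dotZl dotZr mulrA -expr2 dod_c_sqr dot_vec33; field.
- rewrite ico_stdE -map_comp /icosa_raw /= !dotZl !dotZr !dot_vec3 !mxE /= /aval /= a1E a2E.
  by do ! congr (_ :: _); ring.
- by case=> [[] []].
- exact: icosa_moment.
Qed.

Lemma dodeca_min (h : R -> \bar R) : absolutely_monotone h ->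
  min_attained_with h (dodeca_std R) [:: (- a1, 5%N); (- a2, 5%N); (a2, 5%N); (a1, 5%N)].
Proof.
move=> hm; have f2 := phi_sqr; have [a1E a2E] := a12E.
pose A := (true, false); pose A' := (true, true); pose B := (false, false); pose B' := (false, true).
(* The direction of the centre of a pentagonal face; its five vertices are those marked [A]. *)
apply: (@polyhedron_min _ _ (ico_c *: vec3 0 phi 1)
  [:: A; B; B'; A'; A; B; B'; A'; A; A; B; B'; A'; B; B; A; B'; A'; A'; B'] _ dod_e) => //.
- exact: uniq_dodeca.
- rewrite dod_stdE; apply: antipodal_scaled.
  apply: antipodal_cat; apply: antipodal_signs => s t v; rewrite !inE.
    by case/orP => /eqP ->; rewrite vec3N ?opprK eqxx ?orbT.
  by case/or3P => /eqP ->; rewrite vec3N oppr0 !mulNr eqxx ?orbT.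
- rewrite dod_stdE; apply: sphere_scaled; rewrite /dodeca_raw /= !dot_vec33 dod_c_sqr !phiV.
  by do ! (apply/andP; split=> //); apply/eqP; field: f2.
- by rewrite /sphere /= dotZl dotZr mulrA -expr2 ico_c_sqr dot_vec33; field: f2.
- rewrite dod_stdE -map_comp /dodeca_raw /= !dotZl !dotZr !dot_vec3 !mxE /= !phiV.
  rewrite /aval /= a1E a2E; do ! congr (_ :: _); ring: f2.
- by case=> [[] []].
- exact: dodeca_moment.
Qed.
End Polyhedra.

Theorem theorem5p1 (R : realType) (h : R -> \bar R) :
  absolutely_monotone h ->
  let a1 := Num.sqrt ((1 + 2 / Num.sqrt 5) / 3) in
  let a2 := Num.sqrt ((1 - 2 / Num.sqrt 5) / 3) in
  (* (a) icosahedron *)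
  (forall C : seq 'rV[R]_3, uniq C -> is_rotated (icosa_std R) C ->
     min_attained_with h C [:: (- a1, 3%N); (- a2, 3%N); (a2, 3%N); (a1, 3%N)]) /\
  (* (b) dodecahedron *)
  (forall C : seq 'rV[R]_3, uniq C -> is_rotated (dodeca_std R) C ->
     min_attained_with h C [:: (- a1, 5%N); (- a2, 5%N); (a2, 5%N); (a1, 5%N)]) /\
  (* (c) E8 root code *)
  (forall C : seq 'rV[R]_8, uniq C -> (forall y, y \in C <-> E8_code_pt y) ->
     min_attained_with h C
       [:: (- (Num.sqrt 2 / 2), 14%N); (- (Num.sqrt 2 / 4), 64%N); (0, 84%N);
           (Num.sqrt 2 / 4, 64%N); (Num.sqrt 2 / 2, 14%N)]) /\
  (* (d) Leech lattice minimal vectors *)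
  (forall C : seq 'rV[R]_24, uniq C -> (forall y, y \in C <-> leech_code_pt y) ->
     min_attained_with h C
       [:: (- (Num.sqrt 6 / 4), 552%N); (- (Num.sqrt 6 / 6), 11178%N);
           (- (Num.sqrt 6 / 12), 48600%N); (0, 75900%N);
           (Num.sqrt 6 / 12, 48600%N); (Num.sqrt 6 / 6, 11178%N);
           (Num.sqrt 6 / 4, 552%N)]).
Proof.
move=> hm a1' a2'; split.
  move=> C uC [Q [QQ CE]].
  exact: (min_attained_rotated QQ (uniq_icosa R) uC CE (icosa_min hm)).
split.
  move=> C uC [Q [QQ CE]].
  exact: (min_attained_rotated QQ (uniq_dodeca R) uC CE (dodeca_min hm)).
by split=> C uC CE; [exact: E8_min_attained | exact: leech_min_attained].
Qed.
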